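(* The assignment $(\mathfrak{J},\mathfrak{M})\mapsto\mathrm{TAG}(\mathfrak{J},\mathfrak{M})$ is a functor from the category of $\mathfrak{J}$-ternary superalgebras to the category of short $\mathfrak{sl}_2$-Lie superalgebras, a morphism $(\eta_1,\eta_2):(\mathfrak{J},\mathfrak{M})\to(\mathfrak{J}',\mathfrak{M}')$ being sent to the map $x\otimes a\mapsto x\otimes\eta_1(a)$, $v\otimes m\mapsto v\otimes\eta_2(m)$, $\{a\otimes b\}\mapsto\{\eta_1(a)\otimes\eta_1(b)\}$, $\{m\otimes n\}\mapsto\{\eta_2(m)\otimes\eta_2(n)\}$.
   Context: Everything is over $\mathbb{C}$; superspaces are $\mathbb{Z}_2$-graded. $\mathfrak{sl}_2=\mathfrak{sl}_2(\mathbb{C})$ has standard basis $e,f,h$; $V=\mathbb{C}e_1\oplus\mathbb{C}e_2$ is its natural representation; both have even degree. $\kappa(x,y)=4\,\mathrm{tr}(xy)$; $\det:V\otimes V\to\mathbb{C}$ is the determinant form; $\odot:V\otimes V\to\mathfrak{sl}_2$ is bilinear with $e_1\odot e_1=e$, $e_1\odot e_2=e_2\odot e_1=-\tfrac12h$, $e_2\odot e_2=-f$. A short $\mathfrak{sl}_2$-Lie superalgebra is a Lie superalgebra on which $\mathfrak{sl}_2$ acts by even derivations and which as $\mathfrak{sl}_2$-module is of the form $\mathfrak{sl}_2\otimes\mathfrak{J}\oplus V\otimes\mathfrak{M}\oplus\mathfrak{D}$ with $\mathfrak{J},\mathfrak{M},\mathfrak{D}$ superspaces with trivial $\mathfrak{sl}_2$-action;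 morphisms are even $\mathfrak{sl}_2$-linear morphisms of Lie superalgebras. A Jordan superalgebra is a superspace $\mathfrak{J}$ with an even product satisfying $a\cdot b=(-1)^{|a||b|}b\cdot a$ and $(a\cdot b)\cdot(c\cdot d)+(-1)^{|b||c|}(a\cdot c)\cdot(b\cdot d)+(-1)^{|b||d|+|c||d|}(a\cdot d)\cdot(b\cdot c)=((a\cdot b)\cdot c)\cdot d+(-1)^{|b||c|+|b||d|+|c||d|}((a\cdot d)\cdot c)\cdot b+(-1)^{|a||b|+|a||c|+|a||d|+|c||d|}((b\cdot d)\cdot c)\cdot a$. A special $\mathfrak{J}$-supermodule is a superspace $\mathfrak{M}$ with an even bilinear $\bullet:\mathfrak{J}\otimes\mathfrak{M}\to\mathfrak{M}$ such that $(a\cdot b)\bullet m=\tfrac12(a\bullet(b\bullet m)+(-1)^{|a||b|}b\bullet(a\bullet m))$. A $\mathfrak{J}$-ternary superalgebra $(\mathfrak{J},\mathfrak{M})$ consists of a Jordan superalgebra $(\mathfrak{J},\cdot)$, a special $\mathfrak{J}$-supermodule $(\mathfrak{M},\bullet)$, an even super-anticommutative bilinear map $\star:\mathfrak{M}\otimes\mathfrak{M}\to\mathfrak{J}$ ($m\star n=-(-1)^{|m||n|}n\star m$) and an even trilinear product $(-,-,-):\mathfrak{M}^{\otimes3}\to\mathfrak{M}$ such that for all homogeneous $a\in\mathfrak{J}$, $m,n,r,s,t\in\mathfrak{M}$: (SJT1) $a\cdot(m\star n)=\tfrac12((a\bullet m)\star n+(-1)^{|a||m|}m\star(a\bullet n))$;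 (SJT2) $a\bullet(m,n,s)=(a\bullet m,n,s)-(-1)^{|a||m|}(m,a\bullet n,s)+(-1)^{|a|(|m|+|n|)}(m,n,a\bullet s)$; (SJT3) $(m,n,s)=(-1)^{|m|(|n|+|s|)+|n||s|}(s,n,m)-(-1)^{|n||s|}(m\star s)\bullet n$; (SJT4) $(m,n,s)=(-1)^{|m||n|}(n,m,s)+(m\star n)\bullet s$; (SJT5) $(m,n,r)\star s+(-1)^{|r|(|m|+|n|)}r\star(m,n,s)=(-1)^{|n|(|r|+|s|)}m\star((r\star s)\bullet n)$; (SJT6) $(m,n,(r,s,t))=((m,n,r),s,t)+(-1)^{|r|(|m|+|n|)+|m||n|}(r,(n,m,s),t)+(-1)^{(|m|+|n|)(|r|+|s|)}(r,s,(m,n,t))$. A morphism $(\mathfrak{J},\mathfrak{M})\to(\mathfrak{J}',\mathfrak{M}')$ of ternary superalgebras is a pair $(\eta_1,\eta_2)$ of even linear maps $\eta_1:\mathfrak{J}\to\mathfrak{J}'$, $\eta_2:\mathfrak{M}\to\mathfrak{M}'$ with $\eta_1(a\cdot b)=\eta_1(a)\cdot\eta_1(b)$, $\eta_2(a\bullet m)=\eta_1(a)\bullet\eta_2(m)$, $\eta_1(m\star n)=\eta_2(m)\star\eta_2(n)$, $\eta_2(m,n,r)=(\eta_2(m),\eta_2(n),\eta_2(r))$. For homogeneous $a,b,c\in\mathfrak{J}$, $m,n,r\in\mathfrak{M}$, the endomorphisms $\langle a,b\rangle,\partial_{m,n}\in\mathrm{End}(\mathfrak{J}\oplus\mathfrak{M})$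 are defined by $\langle a,b\rangle(c)=a\cdot(b\cdot c)-(-1)^{|a||b|}b\cdot(a\cdot c)$, $\langle a,b\rangle(m)=\tfrac14(a\bullet(b\bullet m)-(-1)^{|a||b|}b\bullet(a\bullet m))$, $\partial_{m,n}(a)=\tfrac12((-1)^{|a|(|m|+|n|)}(a\bullet m)\star n-(-1)^{|a||n|}m\star(a\bullet n))$, $\partial_{m,n}(r)=\tfrac12(m\star n)\bullet r-(m,n,r)$. $\mathfrak{B}^s(\mathfrak{J},\mathfrak{M})=(\mathfrak{J}\otimes\mathfrak{J}\oplus\mathfrak{M}\otimes\mathfrak{M})/R^s(\mathfrak{J},\mathfrak{M})$, where $R^s(\mathfrak{J},\mathfrak{M})$ is spanned by the following elements, for homogeneous $a,b,c\in\mathfrak{J}$, $m,n,r,s\in\mathfrak{M}$: $I_{a,b}=a\otimes b+(-1)^{|a||b|}b\otimes a$; $I_{m,n}=m\otimes n-(-1)^{|m||n|}n\otimes m$; $I_{a,b,c}=(-1)^{|a||c|}(a\cdot b)\otimes c+(-1)^{|a||b|}(b\cdot c)\otimes a+(-1)^{|b||c|}(c\cdot a)\otimes b$; $I_{a,m,n}=(a\bullet m)\otimes n-(-1)^{|a||m|}m\otimes(a\bullet n)-(-1)^{|a|(|m|+|n|)}2(m\star n)\otimes a$; $I_{m,n,r,s}=\partial_{m,n}(r)\otimes s+(-1)^{(|m|+|n|)|r|}r\otimes\partial_{m,n}(s)+(-1)^{(|m|+|n|)(|r|+|s|)}\partial_{r,s}(m)\otimes n+(-1)^{(|r|+|s|)|n|}m\otimes\partial_{r,s}(n)$.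 Classes are denoted $\{a\otimes b\}$, $\{m\otimes n\}$. Put $D(\{z_1\otimes z_2\})=\{D(z_1)\otimes z_2\}+(-1)^{|D||z_1|}\{z_1\otimes D(z_2)\}$ for $D=\langle a,b\rangle$ or $\partial_{m,n}$. $\mathrm{TAG}(\mathfrak{J},\mathfrak{M})=\mathfrak{sl}_2\otimes\mathfrak{J}\oplus V\otimes\mathfrak{M}\oplus\mathfrak{B}^s(\mathfrak{J},\mathfrak{M})$ is the short $\mathfrak{sl}_2$-Lie superalgebra with $\mathfrak{sl}_2$ acting on the first tensor factors (trivially on $\mathfrak{B}^s$) and super-anticommutative bracket: an element $\{a\otimes b\}$ (resp. $\{m\otimes n\}$) of $\mathfrak{B}^s$ acts as $D=\langle a,b\rangle$ (resp. $D=\partial_{m,n}$) by $[D,x\otimes c]=x\otimes D(c)$, $[D,v\otimes r]=v\otimes D(r)$, $[D,\{z_1\otimes z_2\}]=D(\{z_1\otimes z_2\})$; and $[x\otimes a,y\otimes b]=[x,y]\otimes a\cdot b+\tfrac12\kappa(x,y)\{a\otimes b\}$, $[x\otimes a,v\otimes m]=x(v)\otimes a\bullet m$, $[v\otimes m,w\otimes n]=(v\odot w)\otimes m\star n+\det(v,w)\{m\otimes n\}$. *)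

(* Defs.v *)
From HB Require Import structures.
From mathcomp Require Import all_boot all_algebra.
From mathcomp Require Import generic_quotient ring_quotient sesquilinear.
From mathcomp Require Import boolp.
From mathcomp Require Import reals.
From mathcomp Require Import complex.
From mathcomp Require Import freeg.

Set Implicit Arguments.
Unset Strict Implicit.
Unset Printing Implicit Defensive.

Import GRing.Theory.
Local Open Scope ring_scope.
Local Open Scope quotient_scope.

(* Superspaces. A Z_2-grading V = V_0 + V_1 (direct sum) is given by the two
   component maps v |-> v_i. Parities are booleans: [true] is odd, the sum of
   parities is [(+)], and in the exponents of the Koszul signs a parity is read
   as the number 0 or 1. *)

HB.mixin Record isSuper (K : fieldType) V of GRing.Lmodule K V := {
  scomp : bool -> V -> V;
  scomp_is_linear : forall i, linear (scomp i);
  scomp_scomp : forall i j v, scomp i (scomp j v) = if i == j then scomp j v else 0;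
  scomp_sum : forall v, scomp false v + scomp true v = v
}.

#[short(type="superType")]
HB.structure Definition Super (K : fieldType) :=
  {V of GRing.Lmodule K V & isSuper K V}.

Definition homog (K : fieldType) (V : superType K) (i : bool) (v : V) : Prop :=
  scomp i v = v.

Definition even_map (K : fieldType) (U V : superType K) (f : U -> V) : Prop :=
  forall i u, homog i u -> homog i (f u).

Definition even_map2 (K : fieldType) (U V W : superType K)
    (f : U -> V -> W) : Prop :=
  forall i j u v, homog i u -> homog j v -> homog (i (+) j) (f u v).

Definition even_map3 (K : fieldType) (U V W X : superType K)
    (f : U -> V -> W -> X) : Prop :=
  forall i j k u v w, homog i u -> homog j v -> homog k w ->
    homog (i (+) j (+) k) (f u v w).

Definition trilinear (K : fieldType) (U V W X : lmodType K)
    (f : U -> V -> W -> X) : Prop :=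
  [/\ forall v w, linear (fun u => f u v w),
      forall u w, linear (fun v => f u v w) &
      forall u v, linear (f u v)].

Section SuperTheory.
Variables (K : fieldType) (V : superType K).
Implicit Types (u v : V) (i j : bool).

HB.instance Definition _ i :=
  GRing.isLinear.Build K V V *:%R (@scomp K V i) (@scomp_is_linear K V i).

Lemma homog_scomp i v : homog i (scomp i v).
Proof. by rewrite /homog scomp_scomp eqxx. Qed.

Lemma homogD i u v : homog i u -> homog i v -> homog i (u + v).
Proof. by rewrite /homog linearD /= => -> ->. Qed.

Lemma homogN i u : homog i u -> homog i (- u).
Proof. by rewrite /homog linearN /= => ->. Qed.

Lemma homogB i u v : homog i u -> homog i v -> homog i (u - v).
Proof. by move=> hu hv; apply/homogD/homogN. Qed.

Lemma homogZ i (c : K) u : homog i u -> homog i (c *: u).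
Proof. by rewrite /homog linearZ /= => ->. Qed.

Lemma homog_cast i j v : homog i v -> i = j -> homog j v.
Proof. by move=> h <-. Qed.

Lemma scomp_homog i j v : homog j v -> scomp i v = if i == j then v else 0.
Proof. by move=> hv; rewrite -{1}hv scomp_scomp hv. Qed.

End SuperTheory.

Section PairSuper.
Variables (K : fieldType) (U V : superType K).

Definition pair_scomp i (p : U * V) : U * V := (scomp i p.1, scomp i p.2).

Fact pair_scomp_is_linear i : linear (pair_scomp i).
Proof. by move=> c [u v] [u' v']; rewrite /pair_scomp /= !linearP. Qed.

Fact pair_scomp_scomp i j p :
  pair_scomp i (pair_scomp j p) = if i == j then pair_scomp j p else 0.
Proof. by rewrite /pair_scomp /= !scomp_scomp; case: eqP. Qed.

Fact pair_scomp_sum p : pair_scomp false p + pair_scomp true p = p.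
Proof. by case: p => u v; congr pair; exact: scomp_sum. Qed.

HB.instance Definition _ := isSuper.Build K (U * V)%type
  pair_scomp_is_linear pair_scomp_scomp pair_scomp_sum.

Lemma homog_inl i (u : U) : homog i u -> homog i ((u, 0) : U * V).
Proof. by move=> h; congr pair; rewrite //= linear0. Qed.

Lemma homog_inr i (v : V) : homog i v -> homog i ((0, v) : U * V).
Proof. by move=> h; congr pair; rewrite //= linear0. Qed.

End PairSuper.

Inductive spanned (K : fieldType) (V : lmodType K) (S : V -> Prop) : V -> Prop :=
| spanned0 : spanned S 0
| spannedP (c : K) (u v : V) : S u -> spanned S v -> spanned S (c *: u + v).

Section Quotient.
Variables (K : fieldType) (V : lmodType K) (S : V -> Prop).

Definition span_pred : {pred V} := fun v => `[< spanned S v >].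

Lemma spanned_gen v : S v -> spanned S v.
Proof.
by move=> Sv; rewrite -[v]addr0 -[v]scale1r; apply: spannedP => //; exact: spanned0.
Qed.

Fact span_pred_closed : submod_closed span_pred.
Proof.
split=> [|c u v]; first by apply/asboolP; exact: spanned0.
move=> /asboolP Su /asboolP Sv; apply/asboolP.
elim: Su => [|d u1 u2 Su1 _ IH]; first by rewrite scaler0 add0r.
by rewrite scalerDr scalerA -addrA; apply: spannedP.
Qed.
HB.instance Definition _ :=
  GRing.isSubmodClosed.Build K V span_pred span_pred_closed.

Definition quotient : Type := {ideal_quot span_pred}.
HB.instance Definition _ := GRing.Zmodule.on quotient.

Definition qpi (v : V) : quotient := \pi_{ideal_quot span_pred} v.
Definition qrepr (x : quotient) : V := repr x.

Lemma qreprK x : qpi (qrepr x) = x.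
Proof. exact: reprK. Qed.

Lemma qpi_eq u v : qpi u = qpi v <-> spanned S (u - v).
Proof.
split=> [/eqP|h]; last apply/eqP.
  by rewrite -Quotient.idealrBE => /asboolP.
by rewrite -Quotient.idealrBE; apply/asboolP.
Qed.

Lemma qpiD u v : qpi (u + v) = qpi u + qpi v.
Proof. by rewrite /qpi piE. Qed.

Definition qscale (c : K) (x : quotient) : quotient := qpi (c *: qrepr x).

Lemma qscale_pi c v : qscale c (qpi v) = qpi (c *: v).
Proof.
apply/qpi_eq; rewrite -scalerBr; apply/asboolP.
by apply: (@rpredZ _ _ span_pred); apply/asboolP/qpi_eq/qreprK.
Qed.

Fact qscaleA a b x : qscale a (qscale b x) = qscale (a * b) x.
Proof. by rewrite -[x]qreprK !qscale_pi scalerA. Qed.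
Fact qscale1 : left_id 1 qscale.
Proof. by move=> x; rewrite -[x]qreprK qscale_pi scale1r. Qed.
Fact qscaleDr : right_distributive qscale +%R.
Proof.
move=> a x y; rewrite -[x]qreprK -[y]qreprK -qpiD !qscale_pi.
by rewrite scalerDr qpiD.
Qed.
Fact qscaleDl x : {morph qscale^~ x : a b / a + b}.
Proof. by move=> a b; rewrite -[x]qreprK !qscale_pi scalerDl qpiD. Qed.
HB.instance Definition _ := GRing.Zmodule_isLmodule.Build K quotient
  qscaleA qscale1 qscaleDr qscaleDl.

Fact qpi_is_linear : linear qpi.
Proof. by move=> c u v; rewrite qpiD -qscale_pi. Qed.
HB.instance Definition _ := GRing.isLinear.Build K V quotient *:%R qpi qpi_is_linear.


Section Lift.
Variables (W : lmodType K) (f : {linear V -> W}).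
Hypothesis fS : forall u, S u -> f u = 0.

Definition qlift (x : quotient) : W := f (qrepr x).

Lemma qlift_pi v : qlift (qpi v) = f v.
Proof.
apply/eqP; rewrite -subr_eq0 -linearB; apply/eqP.
have : spanned S (qrepr (qpi v) - v) by apply/qpi_eq; exact: qreprK.
elim=> [|c u w Su _ IH]; first exact: linear0.
by rewrite linearP IH fS // scaler0 addr0.
Qed.

Lemma qlift_is_linear : linear qlift.
Proof.
by move=> c x y; rewrite -[x]qreprK -[y]qreprK -linearP !qlift_pi linearP.
Qed.

End Lift.

Lemma quotient_ind_lin (W : lmodType K) (f g : quotient -> W) :
  (forall v, f (qpi v) = g (qpi v)) -> f =1 g.
Proof. by move=> fg x; rewrite -[x]qreprK. Qed.

End Quotient.

Section QuotientSuper.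
Variables (K : fieldType) (V : superType K) (S : V -> Prop).
Hypothesis S_homog : forall v, S v -> exists i, homog i v.

Definition comp_pi i : {linear V -> quotient S} :=
  (qpi S \o @scomp K V i : {linear V -> quotient S}).

Definition quotient_scomp i : quotient S -> quotient S :=
  qlift (comp_pi i).

Fact comp_pi0 i u : S u -> comp_pi i u = 0.
Proof.
move=> Su; have [j hj] := S_homog Su.
rewrite /comp_pi /= (scomp_homog i hj); case: eqP => _; last exact: linear0.
by rewrite -(linear0 (qpi S)); apply/qpi_eq; rewrite subr0; exact: spanned_gen.
Qed.

Lemma quotient_scomp_pi i v : quotient_scomp i (qpi S v) = qpi S (scomp i v).
Proof. exact: (qlift_pi (f := comp_pi i) (@comp_pi0 i)). Qed.

Lemma quotient_scomp_is_linear i : linear (quotient_scomp i).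
Proof. exact: (qlift_is_linear (f := comp_pi i) (@comp_pi0 i)). Qed.

Lemma quotient_scomp_scomp i j x :
  quotient_scomp i (quotient_scomp j x) = if i == j then quotient_scomp j x else 0.
Proof.
rewrite -[x]qreprK !quotient_scomp_pi scomp_scomp.
by case: eqP => // _; exact: linear0.
Qed.

Lemma quotient_scomp_sum x : quotient_scomp false x + quotient_scomp true x = x.
Proof.
by rewrite -[x]qreprK !quotient_scomp_pi -qpiD scomp_sum.
Qed.

End QuotientSuper.

Section Bilin.
Variables (K : fieldType) (U V W : lmodType K) (f : {bilinear U -> V -> W}).

Lemma bilinPl c u u' v : f (c *: u + u') v = c *: f u v + f u' v.
Proof. exact: linearPl. Qed.

Lemma bilinPr c u v v' : f u (c *: v + v') = c *: f u v + f u v'.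
Proof. exact: linearPr. Qed.

End Bilin.

Section Tensor.
Variables (K : fieldType) (U V : lmodType K).

(* Tensor product over K: the free vector space on U * V modulo bilinearity. *)
Local Notation F := {freeg (U * V)%type / K}.
Definition pure (u : U) (v : V) : F := [freeg [:: (1, (u, v))]].

Inductive tensor_rel : F -> Prop :=
| tensor_rel_l c u u' v :
    tensor_rel (pure (c *: u + u') v - (c *: pure u v + pure u' v))
| tensor_rel_r c u v v' :
    tensor_rel (pure u (c *: v + v') - (c *: pure u v + pure u v')).

Definition tensor : Type := quotient tensor_rel.
HB.instance Definition _ := GRing.Lmodule.on tensor.

Definition tens (u : U) (v : V) : tensor := qpi tensor_rel (pure u v).

Fact tens_is_bilinear :
  bilinear_for (GRing.Scale.Law.clone _ _ *:%R _)
               (GRing.Scale.Law.clone _ _ *:%R _) tens.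
Proof.
split=> [v c u u'|u c v v']; rewrite /tens -linearP; apply/qpi_eq;
  apply: spanned_gen; [exact: tensor_rel_l|exact: tensor_rel_r].
Qed.
HB.instance Definition _ :=
  bilinear_isBilinear.Build K U V tensor *:%R *:%R tens tens_is_bilinear.


Section FreeLift.
Variables (W : lmodType K) (g : U * V -> W).

Definition freelift : F -> W := fglift g.

HB.instance Definition _ :=
  GRing.isZmodMorphism.Build F W freelift (lift_is_additive g).

Fact freelift_is_linear : linear freelift.
Proof.
move=> c x y; rewrite raddfD; congr (_ + _).
have -> : c *: x = \sum_(z <- dom x) [freeg [:: (c * coeff z x, z)]] by [].
rewrite -[in RHS](freeg_sumE x) !raddf_sum /=.
by apply: eq_bigr => z _; rewrite /freelift !liftU scalerA.
Qed.
HB.instance Definition _ :=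
  GRing.isLinear.Build K F W *:%R freelift freelift_is_linear.

End FreeLift.

Section TensorLift.
Variables (W : lmodType K) (f : {bilinear U -> V -> W}).

Let g (p : U * V) := f p.1 p.2.

Fact freelift_pure u v : freelift g (pure u v) = f u v.
Proof. by rewrite /freelift liftU scale1r. Qed.

Fact freelift_rel x : tensor_rel x -> freelift g x = 0.
Proof.
case=> [c u u' v|c u v v']; rewrite linearB linearP /= !freelift_pure.
  by rewrite bilinPl subrr.
by rewrite bilinPr subrr.
Qed.

Definition tlift : tensor -> W := qlift (freelift g).

Lemma tlift_tens u v : tlift (tens u v) = f u v.
Proof. by rewrite /tlift (qlift_pi freelift_rel) /= freelift_pure. Qed.

Fact tlift_is_linear : linear tlift.
Proof. exact: qlift_is_linear freelift_rel. Qed.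
HB.instance Definition _ :=
  GRing.isLinear.Build K tensor W *:%R tlift tlift_is_linear.

End TensorLift.

Lemma tensor_ext (W : lmodType K) (f g : {linear tensor -> W}) :
  (forall u v, f (tens u v) = g (tens u v)) -> f =1 g.
Proof.
move=> fg; apply: quotient_ind_lin => x.
rewrite -(freeg_sumE x) !linear_sum; apply: eq_bigr => -[u v] _.
have -> : [freeg [:: (coeff (u, v) x, (u, v))]] = coeff (u, v) x *: pure u v.
  by apply/eqP/freeg_eqP => z; rewrite coeffZ !coeffU mul1r.
by rewrite !linearZ /=; congr (_ *: _); exact: fg.
Qed.

End Tensor.

Section TensorSuper.
Variables (K : fieldType) (U V : superType K).
Local Notation T := (tensor U V).

Definition tens_scomp i (u : U) (v : V) : T :=
  tens (scomp false u) (scomp i v) + tens (scomp true u) (scomp (~~ i) v).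

Fact tens_scomp_is_bilinear i :
  bilinear_for (GRing.Scale.Law.clone _ _ *:%R _)
               (GRing.Scale.Law.clone _ _ *:%R _) (tens_scomp i).
Proof.
split=> [v c u u'|u c v v']; rewrite /= /tens_scomp !linearP /= ?(bilinPl, bilinPr);
  by rewrite scalerDr addrACA.
Qed.
HB.instance Definition _ i :=
  bilinear_isBilinear.Build K U V T *:%R *:%R (tens_scomp i) (tens_scomp_is_bilinear i).

Definition tensor_scomp i : T -> T := tlift (tens_scomp i).

Lemma tensor_scomp_tens i u v : tensor_scomp i (tens u v) =
  tens (scomp false u) (scomp i v) + tens (scomp true u) (scomp (~~ i) v).
Proof. exact: tlift_tens. Qed.

HB.instance Definition _ i := GRing.Linear.on (tensor_scomp i).

Fact tensor_scomp_is_linear i : linear (tensor_scomp i).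
Proof. exact: linearP. Qed.

Fact tensor_scomp_scomp i j x :
  tensor_scomp i (tensor_scomp j x) = if i == j then tensor_scomp j x else 0.
Proof.
have -> : (if i == j then tensor_scomp j x else 0) = (i == j)%:R *: tensor_scomp j x.
  by case: eqP; rewrite ?scale1r ?scale0r.
rewrite -[LHS]/(((tensor_scomp i \o tensor_scomp j) : {linear T -> T}) x).
rewrite -[RHS]/((((i == j)%:R \*: tensor_scomp j) : {linear T -> T}) x).
apply: tensor_ext => u v /=; rewrite tensor_scomp_tens linearD /= !tensor_scomp_tens.
rewrite !scomp_scomp /=; case: i j => [] [] /=;
  by rewrite ?(linear0l, linear0r, addr0, add0r, scale1r, scale0r).
Qed.

Fact tensor_scomp_sum x : tensor_scomp false x + tensor_scomp true x = x.
Proof.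
rewrite -[LHS]/(((tensor_scomp false \+ tensor_scomp true) : {linear T -> T}) x).
rewrite -[RHS]/((idfun : {linear T -> T}) x).
apply: tensor_ext => u v /=; rewrite !tensor_scomp_tens /=.
rewrite addrACA -!linearDr /= [scomp true v + _]addrC scomp_sum -linearDl /=.
by rewrite scomp_sum.
Qed.

HB.instance Definition _ := isSuper.Build K T
  tensor_scomp_is_linear tensor_scomp_scomp tensor_scomp_sum.

Lemma homog_tens i j u v : homog i u -> homog j v -> homog (i (+) j) (tens u v).
Proof.
move=> hu hv; rewrite /homog -[LHS]/(tensor_scomp _ _) tensor_scomp_tens.
rewrite !(scomp_homog _ hu) !(scomp_homog _ hv).
by case: i j {hu hv} => [] []; rewrite /= ?(linear0l, linear0r, addr0, add0r).
Qed.

End TensorSuper.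

Section Sl2.
Variable K : fieldType.

Definition traceless : {pred 'M[K]_2} := fun x => \tr x == 0.

Fact traceless_closed : submod_closed traceless.
Proof.
split=> [|c x y]; rewrite !unfold_in ?linear0 //.
by rewrite linearP /= => /eqP-> /eqP->; rewrite mulr0 addr0.
Qed.
HB.instance Definition _ :=
  GRing.isSubmodClosed.Build K 'M[K]_2 traceless traceless_closed.

Record sl2 : Type := Sl2 { sl2_mx :> 'M[K]_2; sl2_mxP : sl2_mx \in traceless }.
HB.instance Definition _ := [isSub for sl2_mx].
HB.instance Definition _ := [Choice of sl2 by <:].
HB.instance Definition _ := [SubChoice_isSubLmodule of sl2 by <:].

Definition natrep : Type := 'cV[K]_2.
HB.instance Definition _ := GRing.Lmodule.on natrep.

Fact sl2_br_subproof (x y : 'M[K]_2) : x *m y - y *m x \in traceless.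
Proof. by rewrite unfold_in linearB /= mxtrace_mulC subrr. Qed.
Definition sl2_br (x y : sl2) : sl2 := Sl2 (sl2_br_subproof x y).

Fact sl2_e_subproof : delta_mx 0 1 \in traceless.
Proof. by rewrite unfold_in /mxtrace big_ord_recl big_ord1 !mxE addr0. Qed.
Definition sl2_e : sl2 := Sl2 sl2_e_subproof.

Fact sl2_f_subproof : delta_mx 1 0 \in traceless.
Proof. by rewrite unfold_in /mxtrace big_ord_recl big_ord1 !mxE addr0. Qed.
Definition sl2_f : sl2 := Sl2 sl2_f_subproof.

Fact sl2_h_subproof : delta_mx 0 0 - delta_mx 1 1 \in traceless.
Proof.
by rewrite unfold_in /mxtrace big_ord_recl big_ord1 !mxE /= subr0 sub0r subrr.
Qed.
Definition sl2_h : sl2 := Sl2 sl2_h_subproof.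

Definition kappa (x y : sl2) : K := 4%:R * \tr (sl2_mx x *m sl2_mx y).

Definition sl2_nat (x : sl2) (v : natrep) : natrep := sl2_mx x *m v.

Definition det2 (v w : natrep) : K := \det (row_mx v w : 'M[K]_2).

(* The bilinear extension of e_1.e_1 = e, e_1.e_2 = e_2.e_1 = - h/2 and
   e_2.e_2 = - f. *)
Definition odot (v w : natrep) : sl2 :=
  (v 0 0 * w 0 0) *: sl2_e
  - ((v 0 0 * w 1 0 + v 1 0 * w 0 0) / 2) *: sl2_h
  - (v 1 0 * w 1 0) *: sl2_f.

End Sl2.

Section PureEven.
Variables (K : fieldType) (V : lmodType K).

Definition pure_scomp (i : bool) (v : V) : V := if i then 0 else v.

Fact pure_scomp_is_linear i : linear (pure_scomp i).
Proof. by case: i => c u v //=; rewrite scaler0 addr0. Qed.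

Fact pure_scomp_scomp i j v :
  pure_scomp i (pure_scomp j v) = if i == j then pure_scomp j v else 0.
Proof. by case: i j => [] []. Qed.

Fact pure_scomp_sum v : pure_scomp false v + pure_scomp true v = v.
Proof. exact: addr0. Qed.

End PureEven.

HB.instance Definition _ (K : fieldType) := isSuper.Build K (sl2 K)
  (@pure_scomp_is_linear K (sl2 K)) (@pure_scomp_scomp K (sl2 K))
  (@pure_scomp_sum K (sl2 K)).
HB.instance Definition _ (K : fieldType) := isSuper.Build K (natrep K)
  (@pure_scomp_is_linear K (natrep K)) (@pure_scomp_scomp K (natrep K))
  (@pure_scomp_sum K (natrep K)).

Record lieSuper_on (K : fieldType) (L : superType K) := LieSuperOn {
  lbr : {bilinear L -> L -> L};
  lbr_even : even_map2 lbr;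
  lbrC : forall i j x y, homog i x -> homog j y ->
    lbr x y = - ((-1) ^+ (i * j) *: lbr y x);
  lbr_jacobi : forall i j x y z, homog i x -> homog j y ->
    lbr x (lbr y z) = lbr (lbr x y) z + (-1) ^+ (i * j) *: lbr y (lbr x z)
}.

(* As sl_2-module, L is of the form sl_2 (x) J + V (x) M + D, with J, M, D
   superspaces with trivial action. *)
Definition short_form (K : fieldType) (L : superType K) (act : sl2 K -> L -> L) : Prop :=
  exists (J M D : superType K)
         (phi : {linear (tensor (sl2 K) J * tensor (natrep K) M * D)%type -> L}),
  [/\ bijective phi, even_map phi,
      forall x y a, act x (phi (tens y a, 0, 0)) = phi (tens (sl2_br x y) a, 0, 0),
      forall x v m, act x (phi (0, tens v m, 0)) = phi (0, tens (sl2_nat x v) m, 0) &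
      forall x d, act x (phi (0, 0, d)) = 0].

Record shortLie_on (K : fieldType) (L : superType K) := ShortLieOn {
  short_lie :> lieSuper_on L;
  short_act : {bilinear sl2 K -> L -> L};
  short_act_br : forall x y u, short_act (sl2_br x y) u =
    short_act x (short_act y u) - short_act y (short_act x u);
  short_act_even : forall x, even_map (short_act x);
  short_act_der : forall x u v, short_act x (lbr short_lie u v) =
    lbr short_lie (short_act x u) v + lbr short_lie u (short_act x v);
  short_act_form : short_form short_act
}.

Record shortLie (K : fieldType) := ShortLie {
  short_space :> superType K;
  short_str : shortLie_on short_space
}.

Record shortLie_hom (K : fieldType) (L L' : shortLie K) := ShortLieHom {
  short_map :> {linear L -> L'};
  short_map_even : even_map short_map;
  short_map_br : forall u v, short_map (lbr (short_str L) u v) =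
    lbr (short_str L') (short_map u) (short_map v);
  short_map_act : forall x u, short_map (short_act (short_str L) x u) =
    short_act (short_str L') x (short_map u)
}.

Reserved Notation "a · b" (at level 40, left associativity).
Reserved Notation "a • m" (at level 40, left associativity).
Reserved Notation "m ⋆ n" (at level 40, left associativity).

Record jordan (K : fieldType) := Jordan {
  jordan_space :> superType K;
  jmul : {bilinear jordan_space -> jordan_space -> jordan_space}
    where "a · b" := (jmul a b);
  jmul_even : even_map2 jmul;
  jmulC : forall i j a b, homog i a -> homog j b ->
    a · b = (-1) ^+ (i * j) *: (b · a);
  jmul_jordan : forall i j k l a b c d,
    homog i a -> homog j b -> homog k c -> homog l d ->
    (a · b) · (c · d)
    + (-1) ^+ (j * k) *: ((a · c) · (b · d))
    + (-1) ^+ (j * l + k * l) *: ((a · d) · (b · c))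
    = ((a · b) · c) · d
    + (-1) ^+ (j * k + j * l + k * l) *: (((a · d) · c) · b)
    + (-1) ^+ (i * j + i * k + i * l + k * l) *: (((b · d) · c) · a)
}.

Local Notation "a · b" := (jmul _ a b).

Record special (K : fieldType) (J : jordan K) := Special {
  special_space :> superType K;
  sact : {bilinear J -> special_space -> special_space}
    where "a • m" := (sact a m);
  sact_even : even_map2 sact;
  sact_special : forall i j a b m, homog i a -> homog j b ->
    (a · b) • m = 2^-1 *: (a • (b • m) + (-1) ^+ (i * j) *: (b • (a • m)))
}.

Local Notation "a • m" := (sact _ a m).

Record ternary (K : fieldType) := Ternary {
  tJ : jordan K;
  tM : special tJ;
  star : {bilinear tM -> tM -> tJ} where "m ⋆ n" := (star m n);
  tri : tM -> tM -> tM -> tM;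
  star_even : even_map2 star;
  starC : forall i j m n, homog i m -> homog j n ->
    m ⋆ n = - ((-1) ^+ (i * j) *: (n ⋆ m));
  tri_linear : trilinear tri;
  tri_even : even_map3 tri;
  sjt1 : forall l i j a m n, homog l a -> homog i m -> homog j n ->
    a · (m ⋆ n) =
      2^-1 *: ((a • m) ⋆ n + (-1) ^+ (l * i) *: (m ⋆ (a • n)));
  sjt2 : forall l i j k a m n s,
    homog l a -> homog i m -> homog j n -> homog k s ->
    a • tri m n s = tri (a • m) n s - (-1) ^+ (l * i) *: tri m (a • n) s
      + (-1) ^+ (l * (i + j)) *: tri m n (a • s);
  sjt3 : forall i j k m n s, homog i m -> homog j n -> homog k s ->
    tri m n s = (-1) ^+ (i * (j + k) + j * k) *: tri s n m
      - (-1) ^+ (j * k) *: ((m ⋆ s) • n);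
  sjt4 : forall i j m n s, homog i m -> homog j n ->
    tri m n s = (-1) ^+ (i * j) *: tri n m s + (m ⋆ n) • s;
  sjt5 : forall i j k l m n r s,
    homog i m -> homog j n -> homog k r -> homog l s ->
    tri m n r ⋆ s + (-1) ^+ (k * (i + j)) *: (r ⋆ tri m n s)
    = (-1) ^+ (j * (k + l)) *: (m ⋆ ((r ⋆ s) • n));
  sjt6 : forall i j k l p m n r s t,
    homog i m -> homog j n -> homog k r -> homog l s -> homog p t ->
    tri m n (tri r s t) = tri (tri m n r) s t
      + (-1) ^+ (k * (i + j) + i * j) *: tri r (tri n m s) t
      + (-1) ^+ ((i + j) * (k + l)) *: tri r s (tri m n t)
}.

Local Notation "m ⋆ n" := (star _ m n).

Record ternary_hom (K : fieldType) (A B : ternary K) := TernaryHom {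
  hom1 : {linear tJ A -> tJ B};
  hom2 : {linear tM A -> tM B};
  hom1_even : even_map hom1;
  hom2_even : even_map hom2;
  hom_jmul : forall a b, hom1 (a · b) = hom1 a · hom1 b;
  hom_sact : forall a m, hom2 (a • m) = hom1 a • hom2 m;
  hom_star : forall m n, hom1 (m ⋆ n) = hom2 m ⋆ hom2 n;
  hom_tri : forall m n r, hom2 (tri m n r) = tri (hom2 m) (hom2 n) (hom2 r)
}.

Section TAG.
Variables (K : fieldType) (A : ternary K).
Local Notation J := (tJ A).
Local Notation M := (tM A).
Implicit Types (i j k l : bool) (a b c d : J) (m n r s : M).

(* The endomorphisms <a, b> and partial_{m,n} of J + M, on each summand. The
   formulas are for homogeneous arguments: the booleans are the parities of the
   elements which follow, in the same order, as far as the formula needs them. *)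
Definition inner_J i j a b c : J := a · (b · c) - (-1) ^+ (i * j) *: (b · (a · c)).

Definition inner_M i j a b m : M :=
  4^-1 *: (a • (b • m) - (-1) ^+ (i * j) *: (b • (a • m))).

Definition partial_J i j k m n a : J :=
  2^-1 *: ((-1) ^+ (k * (i + j)) *: ((a • m) ⋆ n)
           - (-1) ^+ (k * j) *: (m ⋆ (a • n))).

Definition partial_M m n r : M := 2^-1 *: ((m ⋆ n) • r) - tri m n r.

Local Notation T := (tensor J J * tensor M M)%type.
Local Notation "a ⊗J b" := ((tens a b, 0) : T) (at level 38).
Local Notation "m ⊗M n" := ((0, tens m n) : T) (at level 38).

Inductive brel : T -> Prop :=
| brel_aa i j a b of homog i a & homog j b :
    brel (a ⊗J b + (-1) ^+ (i * j) *: (b ⊗J a))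
| brel_mm i j m n of homog i m & homog j n :
    brel (m ⊗M n - (-1) ^+ (i * j) *: (n ⊗M m))
| brel_aaa i j k a b c of homog i a & homog j b & homog k c :
    brel ((-1) ^+ (i * k) *: ((a · b) ⊗J c)
          + (-1) ^+ (i * j) *: ((b · c) ⊗J a)
          + (-1) ^+ (j * k) *: ((c · a) ⊗J b))
| brel_amm l i j a m n of homog l a & homog i m & homog j n :
    brel ((a • m) ⊗M n - (-1) ^+ (l * i) *: (m ⊗M (a • n))
          - (-1) ^+ (l * (i + j)) *: (2 *: ((m ⋆ n) ⊗J a)))
| brel_mmmm i j k l m n r s
    of homog i m & homog j n & homog k r & homog l s :
    brel (partial_M m n r ⊗M s
          + (-1) ^+ ((i + j) * k) *: (r ⊗M partial_M m n s)
          + (-1) ^+ ((i + j) * (k + l)) *: (partial_M r s m ⊗M n)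
          + (-1) ^+ ((k + l) * j) *: (m ⊗M partial_M r s n)).

Lemma partial_M_homog i j k m n r : homog i m -> homog j n -> homog k r ->
  homog (i (+) j (+) k) (partial_M m n r).
Proof.
move=> hm hn hr; apply: homogB; last exact: tri_even.
by apply/homogZ/sact_even => //; exact: star_even.
Qed.

Lemma brel_homog x : brel x -> exists i, homog i x.
Proof.
have hJ i j a b : homog i a -> homog j b -> homog (i (+) j) (a ⊗J b).
  by move=> ha hb; apply/homog_inl/homog_tens.
have hM i j m n : homog i m -> homog j n -> homog (i (+) j) (m ⊗M n).
  by move=> hm hn; apply/homog_inr/homog_tens.
case=> {x}.
- move=> i j a b ha hb; exists (i (+) j); apply/homogD/homogZ; first exact: hJ.
  by apply/(homog_cast (hJ _ _ _ _ hb ha)); rewrite addbC.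
- move=> i j m n hm hn; exists (i (+) j); apply/homogB/homogZ; first exact: hM.
  by apply/(homog_cast (hM _ _ _ _ hn hm)); rewrite addbC.
- move=> i j k a b c ha hb hc; exists (i (+) j (+) k).
  have h2 := jmul_even; apply/homogD/homogZ; first apply/homogD/homogZ.
  + by apply/homogZ/hJ => //; exact: h2.
  + by apply/(homog_cast (hJ _ _ _ _ (h2 _ _ _ _ _ _ hb hc) ha)); rewrite addbC addbA.
  + by apply/(homog_cast (hJ _ _ _ _ (h2 _ _ _ _ _ _ hc ha) hb)); case: i j k {ha hb hc} => [] [] [].
- move=> l i j a m n ha hm hn; exists (l (+) i (+) j).
  apply/homogB/homogZ/homogZ; first apply/homogB/homogZ.
  + by apply/hM => //; exact: sact_even.
  + by apply/(homog_cast (hM _ _ _ _ hm (sact_even ha hn))); case: i j l {ha hm hn} => [] [] [].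
  + by apply/(homog_cast (hJ _ _ _ _ (star_even hm hn) ha)); case: i j l {ha hm hn} => [] [] [].
- move=> i j k l m n r s hm hn hr hs; exists (i (+) j (+) k (+) l).
  have hd := partial_M_homog.
  apply/homogD/homogZ; first apply/homogD/homogZ; first apply/homogD/homogZ.
  + by apply/hM => //; exact: hd.
  + apply/(homog_cast (hM _ _ _ _ hr (hd _ _ _ _ _ _ hm hn hs))).
    by case: i j k l {hm hn hr hs} => [] [] [] [].
  + apply/(homog_cast (hM _ _ _ _ (hd _ _ _ _ _ _ hr hs hm) hn)).
    by case: i j k l {hm hn hr hs} => [] [] [] [].
  + apply/(homog_cast (hM _ _ _ _ hm (hd _ _ _ _ _ _ hr hs hn))).
    by case: i j k l {hm hn hr hs} => [] [] [] [].
Qed.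

Definition Bs : Type := quotient brel.
HB.instance Definition _ := GRing.Lmodule.on Bs.
HB.instance Definition _ := isSuper.Build K Bs
  (quotient_scomp_is_linear brel_homog) (quotient_scomp_scomp brel_homog)
  (quotient_scomp_sum brel_homog).

Definition brJ a b : Bs := qpi brel (a ⊗J b).
Definition brM m n : Bs := qpi brel (m ⊗M n).

Definition TAG : superType K :=
  (tensor (sl2 K) J * tensor (natrep K) M * Bs)%type.

Definition tagJ (x : sl2 K) a : TAG := (tens x a, 0, 0).
Definition tagM (v : natrep K) m : TAG := (0, tens v m, 0).
Definition tagB (z : Bs) : TAG := (0, 0, z).

(* That S is the structure of TAG(J, M): its bracket is determined by these
   values, bilinearity and super-anticommutativity. The element {z1 (x) z2} of
   B^s acts on B^s by {w1 (x) w2} |-> {D w1 (x) w2} + (-1)^(|D||w1|) {w1 (x) D w2}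
   with D the endomorphism attached to z1 (x) z2. *)
Record is_TAG (S : shortLie_on TAG) : Prop := IsTAG {
  tag_actJ : forall x y a, short_act S x (tagJ y a) = tagJ (sl2_br x y) a;
  tag_actM : forall x v m, short_act S x (tagM v m) = tagM (sl2_nat x v) m;
  tag_actB : forall x z, short_act S x (tagB z) = 0;
  tag_JJ : forall x y a b, lbr S (tagJ x a) (tagJ y b) =
    tagJ (sl2_br x y) (a · b) + (kappa x y / 2) *: tagB (brJ a b);
  tag_JM : forall x v a m,
    lbr S (tagJ x a) (tagM v m) = tagM (sl2_nat x v) (a • m);
  tag_MM : forall v w m n, lbr S (tagM v m) (tagM w n) =
    tagJ (odot v w) (m ⋆ n) + det2 v w *: tagB (brM m n);
  tag_innerJ : forall i j a b, homog i a -> homog j b -> forall x c,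
    lbr S (tagB (brJ a b)) (tagJ x c) = tagJ x (inner_J i j a b c);
  tag_innerM : forall i j a b, homog i a -> homog j b -> forall v r,
    lbr S (tagB (brJ a b)) (tagM v r) = tagM v (inner_M i j a b r);
  tag_inner_brJ : forall i j k a b c d,
    homog i a -> homog j b -> homog k c ->
    lbr S (tagB (brJ a b)) (tagB (brJ c d)) =
    tagB (brJ (inner_J i j a b c) d
          + (-1) ^+ ((i + j) * k) *: brJ c (inner_J i j a b d));
  tag_inner_brM : forall i j k a b r s,
    homog i a -> homog j b -> homog k r ->
    lbr S (tagB (brJ a b)) (tagB (brM r s)) =
    tagB (brM (inner_M i j a b r) s
          + (-1) ^+ ((i + j) * k) *: brM r (inner_M i j a b s));
  tag_partialJ : forall i j k m n c,
    homog i m -> homog j n -> homog k c -> forall x,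
    lbr S (tagB (brM m n)) (tagJ x c) = tagJ x (partial_J i j k m n c);
  tag_partialM : forall m n v r,
    lbr S (tagB (brM m n)) (tagM v r) = tagM v (partial_M m n r);
  tag_partial_brJ : forall i j k l m n c d,
    homog i m -> homog j n -> homog k c -> homog l d ->
    lbr S (tagB (brM m n)) (tagB (brJ c d)) =
    tagB (brJ (partial_J i j k m n c) d
          + (-1) ^+ ((i + j) * k) *: brJ c (partial_J i j l m n d));
  tag_partial_brM : forall i j k m n r s,
    homog i m -> homog j n -> homog k r ->
    lbr S (tagB (brM m n)) (tagB (brM r s)) =
    tagB (brM (partial_M m n r) s
          + (-1) ^+ ((i + j) * k) *: brM r (partial_M m n s))
}.

End TAG.

Record is_TAG_map (K : fieldType) (A B : ternary K) (eta : ternary_hom A B)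
    (F : TAG A -> TAG B) : Prop := IsTAGMap {
  tag_mapJ : forall x a, F (tagJ x a) = tagJ x (hom1 eta a);
  tag_mapM : forall v m, F (tagM v m) = tagM v (hom2 eta m);
  tag_map_brJ : forall a b, F (tagB (brJ a b)) = tagB (brJ (hom1 eta a) (hom1 eta b));
  tag_map_brM : forall m n, F (tagB (brM m n)) = tagB (brM (hom2 eta m) (hom2 eta n))
}.

Record category := Category {
  ob :> Type;
  hom : ob -> ob -> Type;
  idm : forall X, hom X X;
  compm : forall X Y Z, hom Y Z -> hom X Y -> hom X Z;
  compm_idl : forall X Y (f : hom X Y), compm (idm Y) f = f;
  compm_idr : forall X Y (f : hom X Y), compm f (idm X) = f;
  compmA : forall X Y Z W (f : hom Z W) (g : hom Y Z) (h : hom X Y),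
    compm f (compm g h) = compm (compm f g) h
}.

Definition is_functor (C D : category) (F0 : C -> D)
    (F1 : forall X Y, hom X Y -> hom (F0 X) (F0 Y)) : Prop :=
  (forall X, F1 X X (idm X) = idm (F0 X)) /\
  (forall X Y Z (g : hom Y Z) (f : hom X Y),
     F1 X Z (compm g f) = compm (F1 Y Z g) (F1 X Y f)).

Lemma linear_ext (K : fieldType) (U V : lmodType K) (f g : {linear U -> V}) :
  f =1 g -> f = g.
Proof.
case: f g => f [[cf1] [cf2]] [g [[cg1] [cg2]]] /= /funext fg.
rewrite -{}fg in cg1 cg2 *.
by rewrite (Prop_irrelevance cf1 cg1) (Prop_irrelevance cf2 cg2).
Qed.

Section Categories.
Variable K : fieldType.

Lemma ternary_hom_ext (A B : ternary K) (f g : ternary_hom A B) :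
  hom1 f =1 hom1 g -> hom2 f =1 hom2 g -> f = g.
Proof.
case: f g => [f1 f2 ? ? ? ? ? ?] [g1 g2 ? ? ? ? ? ?] /= /linear_ext e1 /linear_ext e2.
by subst g1 g2; congr TernaryHom; exact: Prop_irrelevance.
Qed.

Lemma shortLie_hom_ext (L L' : shortLie K) (f g : shortLie_hom L L') :
  short_map f =1 short_map g -> f = g.
Proof.
case: f g => [f ? ? ?] [g ? ? ?] /= /linear_ext e.
by subst g; congr ShortLieHom; exact: Prop_irrelevance.
Qed.

Definition ternary_id (A : ternary K) : ternary_hom A A.
Proof. by exists idfun idfun. Defined.

Definition ternary_comp (A B E : ternary K) (g : ternary_hom B E)
  (f : ternary_hom A B) : ternary_hom A E.
Proof.
exists (hom1 g \o hom1 f) (hom2 g \o hom2 f).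
- by move=> i a ha; do 2!apply: hom1_even.
- by move=> i m hm; do 2!apply: hom2_even.
- by move=> a b /=; rewrite !hom_jmul.
- by move=> a m /=; rewrite !hom_sact.
- by move=> m n /=; rewrite !hom_star.
- by move=> m n r /=; rewrite !hom_tri.
Defined.

Definition ternaryCat : category.
Proof.
by exists (ternary K) (@ternary_hom K) ternary_id ternary_comp => *;
  apply: ternary_hom_ext.
Defined.

Definition shortLie_id (L : shortLie K) : shortLie_hom L L.
Proof. by exists idfun. Defined.

Definition shortLie_comp (L L' L'' : shortLie K) (g : shortLie_hom L' L'')
  (f : shortLie_hom L L') : shortLie_hom L L''.
Proof.
exists (short_map g \o short_map f).
- by move=> i u hu; do 2!apply: short_map_even.
- by move=> u v /=; rewrite !short_map_br.
- by move=> x u /=; rewrite !short_map_act.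
Defined.

Definition shortLieCat : category.
Proof.
by exists (shortLie K) (@shortLie_hom K) shortLie_id shortLie_comp => *;
  apply: shortLie_hom_ext.
Defined.

End Categories.

(* Main.v *)
Require Import Defs.
From HB Require Import structures.
From Stdlib Require Import ZArith.
From mathcomp Require Import all_boot all_algebra reals complex.
From mathcomp Require Import sesquilinear boolp freeg ssrZ ring.

Set Implicit Arguments.
Unset Strict Implicit.
Unset Printing Implicit Defensive.

Import GRing.Theory Num.Theory.
Local Open Scope ring_scope.

Local Notation "a · b" := (jmul _ a b).
Local Notation "a • m" := (sact _ a m).
Local Notation "m ⋆ n" := (star _ m n).

(** TAG(J, M) is a Lie superalgebra because B^s(J, M) acts on J + M by
superderivations and because its defining relations are the identities that
the Jacobi identity requires of the remaining brackets.

The operators <a, b> and partial_{m,n} are superderivations of all four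
operations of the ternary superalgebra (superder_inner, superder_partial): each
rule is a linear combination of instances of the axioms. A superderivation D
satisfies [D, <a, b>] = <D a, b> + (-1)^(|D||a|) <a, D b>, and likewise for
partial_{m,n}. Three facts follow. The relations R^s act as zero on J and on M
(tag_rel_actJ, tag_rel_actM), so that B^s acts. A superderivation maps R^s into
itself (tag_rel_der), so that B^s acts on itself by [z, w] = D_z w, and this
bracket satisfies the Jacobi identity (actB_jacobi). The bracket is
super-anticommutative (skew_JJ, skew_JM, skew_MM): for two classes from
M (x) M this is the last family of relations, for the others it follows from
I_{a,b,c} and I_{a,m,n}.

On generators of sl_2 (x) J + V (x) M + B^s the Jacobi identity is symmetric in
its arguments, which leaves ten types. When an element of B^s occurs, it says
that this element acts by derivations. The other four types are reduced, by
identities of traceless 2 x 2 matrices such as [x, [y, z]] = 2 tr(xy) z -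
2 tr(xz) y, to the definitions of <a, b> and partial_{m,n}, the module axiom,
the first, third and fourth ternary axioms, and the relations I_{a,b,c} and
I_{a,m,n}.

Tensor products and B^s enter only through generation by homogeneous elements
and the universal property (is_tensor, presents). A formula that depends on
parities is stated for homogeneous arguments and extended by splitting into
components (gradext). Once the parities are fixed, all Koszul signs are
numbers, and each identity becomes the statement that one equation between
vectors follows linearly from others, which lin_solve decides by Gaussian
elimination.

A morphism of ternary superalgebras carries relations to relations and hence
induces a map on B^s, which commutes with the actions because the operators
are built from the operations. The functor laws hold because linear maps on
TAG(J, M) are determined by their values on generators (TAG_ext). *)

(** * Linear consequences of equations between vectors *)

Section LinearSolver.
Variable K : numFieldType.

Definition ZtoK (z : Z) : K := (int_of_Z z)%:~R.

Lemma ZtoKD x y : ZtoK (Z.add x y) = ZtoK x + ZtoK y.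
Proof. by rewrite /ZtoK -[Z.add x y]/(x + y)%R rmorphD intrD. Qed.

Lemma ZtoKM x y : ZtoK (Z.mul x y) = ZtoK x * ZtoK y.
Proof. by rewrite /ZtoK -[Z.mul x y]/(x * y)%R rmorphM intrM. Qed.

Lemma ZtoKN x : ZtoK (Z.opp x) = - ZtoK x.
Proof. by rewrite /ZtoK -[Z.opp x]/(- x)%R rmorphN intrN. Qed.

Lemma ZtoK0 : ZtoK Z0 = 0. Proof. by []. Qed.
Lemma ZtoK1 : ZtoK Z.one = 1. Proof. by []. Qed.

Lemma ZtoK_nat n : ZtoK (Z.of_nat n) = n%:R.
Proof.
elim: n => [|n IH]; first by [].
by rewrite Nat2Z.inj_succ -Z.add_1_l ZtoKD IH ZtoK1 mulrS.
Qed.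

Lemma ZtoK_neq0 x : Z.eqb x Z0 = false -> ZtoK x != 0.
Proof.
move=> /Z.eqb_neq x0; rewrite /ZtoK intr_eq0; apply/eqP => /(congr1 Z_of_int).
by rewrite int_of_ZK.
Qed.

Inductive scal :=
  | SOne | SSign of nat | SNat of nat | SInv of nat | SOpp of scal | SMul of scal & scal.

Fixpoint seval (s : scal) : K :=
  match s with
  | SOne => 1
  | SSign n => (-1) ^+ n
  | SNat n => n%:R
  | SInv n => n%:R^-1
  | SOpp s => - seval s
  | SMul s t => seval s * seval t
  end.

(** A numerator and a denominator; the inverse of 0 is 0, whence the case SInv 0. *)
Fixpoint sfrac (s : scal) : Z * Z :=
  match s with
  | SOne => (Z.one, Z.one)
  | SSign n => (if odd n then Zneg xH else Z.one, Z.one)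
  | SNat n => (Z.of_nat n, Z.one)
  | SInv n => if n is 0%N then (Z0, Z.one) else (Z.one, Z.of_nat n)
  | SOpp s => let (p, q) := sfrac s in (Z.opp p, q)
  | SMul s t => let (p, q) := sfrac s in let (p', q') := sfrac t in
      (Z.mul p p', Z.mul q q')
  end.

Lemma sfracP s : ZtoK (sfrac s).2 * seval s = ZtoK (sfrac s).1.
Proof.
elim: s => [|n|n|[|n]|s IH|s IHs t IHt] /=.
- by rewrite mulr1.
- by rewrite ZtoK1 mul1r -signr_odd; case: odd.
- by rewrite ZtoK1 mul1r ZtoK_nat.
- by rewrite invr0 mulr0.
- by rewrite -[Zpos _]/(Z.of_nat n.+1) ZtoK_nat divff // pnatr_eq0.
- by case: (sfrac s) IH => p q /= IH; rewrite ZtoKN mulrN IH.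
- case: (sfrac s) IHs => p q /= IHs; case: (sfrac t) IHt => p' q' /= IHt.
  by rewrite !ZtoKM -IHs -IHt mulrACA.
Qed.

Variable V : lmodType K.

Inductive lexp :=
  | LAtom of nat | LZero | LAdd of lexp & lexp | LOpp of lexp | LScale of scal & lexp.

Fixpoint leval (env : seq V) (e : lexp) : V :=
  match e with
  | LAtom n => nth 0 env n
  | LZero => 0
  | LAdd e f => leval env e + leval env f
  | LOpp e => - leval env e
  | LScale s e => seval s *: leval env e
  end.

Fixpoint veval (env : seq V) (v : seq Z) : V :=
  match v, env with
  | c :: v, x :: env => ZtoK c *: x + veval env v
  | _, _ => 0
  end.

Fixpoint vadd (v w : seq Z) : seq Z :=
  match v, w with
  | [::], _ => w
  | _, [::] => v
  | c :: v, d :: w => Z.add c d :: vadd v w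
  end.

Definition vscale (c : Z) (v : seq Z) := map (Z.mul c) v.

Lemma veval_nil (env : seq V) : veval env [::] = 0. Proof. by case: env. Qed.

Lemma vevalD env v w : veval env (vadd v w) = veval env v + veval env w.
Proof.
elim: v w env => [|c v IH] [|d w] [|x env] //=; rewrite ?addr0 ?add0r //.
by rewrite IH ZtoKD scalerDl addrACA.
Qed.

Lemma vevalZ env c v : veval env (vscale c v) = ZtoK c *: veval env v.
Proof.
elim: v env => [|d v IH] [|x env] //=; rewrite ?scaler0 //.
by rewrite IH ZtoKM scalerDr scalerA.
Qed.

Definition vatom n := ncons n Z0 [:: Z.one].

Lemma veval_atom env n : veval env (vatom n) = nth 0 env n.
Proof.
elim: n env => [|n IH] [|x env] //=; first by rewrite veval_nil addr0 scale1r.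
by rewrite IH ZtoK0 scale0r add0r.
Qed.

(** A common denominator and the integral coordinates of the numerator. *)
Fixpoint lnorm (e : lexp) : Z * seq Z :=
  match e with
  | LAtom n => (Z.one, vatom n)
  | LZero => (Z.one, [::])
  | LAdd e f => let (p, v) := lnorm e in let (q, w) := lnorm f in
      if Z.eqb p q then (p, vadd v w) else
      (Z.mul p q, vadd (vscale q v) (vscale p w))
  | LOpp e => let (p, v) := lnorm e in (p, vscale (Zneg xH) v)
  | LScale s e => let (p, v) := lnorm e in let (a, b) := sfrac s in
      (Z.mul b p, vscale a v)
  end.

Lemma lnormP env e : ZtoK (lnorm e).1 *: leval env e = veval env (lnorm e).2.
Proof.
elim: e => [n||e IHe f IHf|e IH|s e IH] /=.
- by rewrite veval_atom scale1r.
- by rewrite scaler0 veval_nil.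
- case: (lnorm e) IHe => p v /= IHe; case: (lnorm f) IHf => q w /= IHf.
  case: Z.eqb_spec => [pq|_] /=.
    by rewrite vevalD scalerDr IHe pq IHf.
  rewrite vevalD !vevalZ -IHe -IHf ZtoKM scalerDr !scalerA.
  by rewrite [ZtoK q * _]mulrC.
- by case: (lnorm e) IH => p v /= IH; rewrite vevalZ -IH scaleN1r scalerN.
- case: (lnorm e) IH => p v /= IH; have := sfracP s.
  case: (sfrac s) => a b /= Eab; rewrite vevalZ -Eab -IH !scalerA ZtoKM.
  by rewrite mulrAC.
Qed.

Fixpoint first_nz (n : nat) (v : seq Z) : option (nat * Z) :=
  match v with
  | [::] => None
  | c :: v => if Z.eqb c 0 then first_nz n.+1 v else Some (n, c)
  end.

Definition elim_step (r : nat * Z * seq Z) (v : seq Z) : seq Z :=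
  let: (n, p, w) := r in
  let c := nth Z0 v n in
  if Z.eqb c 0 || Z.eqb p 0 then v else vadd (vscale p v) (vscale (Z.opp c) w).

Definition reduce (rs : seq (nat * Z * seq Z)) (v : seq Z) : seq Z :=
  foldl (fun v r => elim_step r v) v rs.

Definition pivots (hs : seq (seq Z)) : seq (nat * Z * seq Z) :=
  foldl (fun rs h => let v := reduce rs h in
    if first_nz 0 v is Some np then rcons rs (np, v) else rs) [::] hs.

Definition vanish env (rs : seq (nat * Z * seq Z)) : Prop :=
  foldr (fun r P => veval env r.2 = 0 /\ P) True rs.

Lemma vanish_rcons env rs r : vanish env rs -> veval env r.2 = 0 ->
  vanish env (rcons rs r).
Proof. by elim: rs => [|r' rs IH] //= [h1 h2] h; split=> //; exact: IH. Qed.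

Lemma reduceP env rs v : vanish env rs ->
  veval env (reduce rs v) = 0 <-> veval env v = 0.
Proof.
elim: rs v => [|[[n p] w] rs IH] v //= [hw hrs].
have -> : veval env (reduce ((n, p, w) :: rs) v) =
  veval env (reduce rs (elim_step (n, p, w) v)) by [].
rewrite IH // /elim_step; case: ifP => // /norP[_ /negbTE/ZtoK_neq0 p0].
rewrite vevalD !vevalZ hw scaler0 addr0; split=> [/eqP|->]; last exact: scaler0.
by rewrite scaler_eq0 (negbTE p0) => /eqP.
Qed.

Lemma pivotsP env hs : foldr (fun h P => veval env h = 0 /\ P) True hs ->
  vanish env (pivots hs).
Proof.
rewrite /pivots; have : vanish env [::] by [].
elim: hs [::] => [|h hs IH] rs //= hrs [hh hhs]; apply: IH => //.
case: first_nz => // np; apply: vanish_rcons => //=.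
by apply/(reduceP _ hrs).
Qed.

Definition ldiff (e : lexp * lexp) := (lnorm (LAdd e.1 (LOpp e.2))).

Definition lcheck (hs : seq (lexp * lexp)) (g : lexp * lexp) : bool :=
  let: (p, v) := ldiff g in
  ~~ Z.eqb p 0 &&
  all (fun c => Z.eqb c 0) (reduce (pivots [seq (ldiff h).2 | h <- hs]) v).

(** Fraction-free elimination only forms integral combinations of vectors that
evaluate to zero. If a nonzero multiple of the goal reduces to the zero vector,
the goal vanishes, since integers other than 0 are invertible in K. *)
Theorem linear_solve env hs g : lcheck hs g ->
  foldr (fun h P => leval env h.1 = leval env h.2 -> P)
    (leval env g.1 = leval env g.2) hs.
Proof.
rewrite /lcheck; case E: (ldiff g) => [p v] /andP[/negbTE/ZtoK_neq0 p0 hv].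
have {}hv : veval env (reduce (pivots [seq (ldiff h).2 | h <- hs]) v) = 0.
  elim: (reduce _ v) env hv => [|c w IH] env' /=; first by rewrite veval_nil.
  case/andP=> /Z.eqb_eq -> hw; case: env' => // x env' /=.
  by rewrite ZtoK0 scale0r add0r IH.
suff: foldr (fun h P => veval env h = 0 /\ P) True [seq (ldiff h).2 | h <- hs] ->
    leval env g.1 = leval env g.2.
  elim: {hv} hs => [|h hs IH] /= ; first exact.
  move=> H hh; apply: IH => hhs; apply: H; split=> //.
  by rewrite /ldiff -lnormP /= hh subrr scaler0.
move=> /pivotsP /reduceP -/(_ v)[/(_ hv) + _].
have := lnormP env (LAdd g.1 (LOpp g.2)); rewrite -/(ldiff g) E /= => <- /eqP.
by rewrite scaler_eq0 (negbTE p0) subr_eq0 => /eqP.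
Qed.

End LinearSolver.

Ltac reify_scal c :=
  lazymatch c with
  | @GRing.one _ => constr:(SOne)
  | @GRing.exp _ (@Algebra.opp _ (@GRing.one _)) ?n =>
      constr:(SSign n)
  | @Algebra.natmul _ (@GRing.one _) ?n => constr:(SNat n)
  | @GRing.inv _ (@Algebra.natmul _ (@GRing.one _) ?n) => constr:(SInv n)
  | @Algebra.opp _ ?s => let s' := reify_scal s in constr:(SOpp s')
  | @GRing.mul _ ?s ?t =>
      let s' := reify_scal s in let t' := reify_scal t in constr:(SMul s' t')
  end.

(** Rewriting can leave one and the same operation with distinct, convertible
structure arguments, so that only the operands are compared syntactically. *)
Ltac same_atom x y :=
  first
  [ constr_eq x y
  | lazymatch x with
    | @Bilinear.sort _ _ _ _ _ _ ?f ?a ?b =>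
      lazymatch y with
      | @Bilinear.sort _ _ _ _ _ _ ?g ?c ?d => same_atom a c; same_atom b d; unify f g
      end
    | @GRing.Linear.sort _ _ _ _ ?f ?a =>
      lazymatch y with
      | @GRing.Linear.sort _ _ _ _ ?g ?b => same_atom a b; unify f g
      end
    | @tri _ _ ?a ?b ?c =>
      lazymatch y with
      | @tri _ _ ?d ?e ?f => same_atom a d; same_atom b e; same_atom c f
      end
    | @GRing.scale _ _ ?c ?a =>
      lazymatch y with @GRing.scale _ _ ?d ?b => constr_eq c d; same_atom a b end
    | ?f ?a => lazymatch y with ?g ?b => constr_eq f g; same_atom a b end
    end ].

Ltac lin_atom env x k :=
  let rec idx l n :=
    lazymatch l with
    | ?y :: ?l' => let r := match constr:(tt) with
                   | _ => let _ := match constr:(tt) with _ => same_atom x y end in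
                          constr:(Some n)
                   | _ => idx l' (S n) end in r
    | _ => constr:(@None nat)
    end in
  let r := idx env O in
  lazymatch r with
  | Some ?n => k env n
  | None => let n := eval lazy in (size env) in
            let env' := eval lazy beta iota delta [rcons] in (rcons env x) in k env' n
  end.

Ltac reify_lexp env e k :=
  lazymatch e with
  | @Algebra.zero _ => k env LZero
  | @Algebra.add _ ?a ?b =>
      reify_lexp env a ltac:(fun env a' =>
      reify_lexp env b ltac:(fun env b' => k env (LAdd a' b')))
  | @Algebra.opp _ ?a => reify_lexp env a ltac:(fun env a' => k env (LOpp a'))
  | @GRing.scale _ _ ?c ?a =>
      let s := match constr:(tt) with
               | _ => let c' := reify_scal c in constr:(Some c')
               | _ => constr:(@None scal)
               end in
      lazymatch s with
      | Some ?c' => reify_lexp env a ltac:(fun env a' => k env (LScale c' a'))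
      | None => lin_atom env e ltac:(fun env n => k env (LAtom n))
      end
  | _ => lin_atom env e ltac:(fun env n => k env (LAtom n))
  end.

Ltac reify_goal env hs g k :=
  lazymatch g with
  | (@eq _ ?a ?b) -> ?g' =>
      reify_lexp env a ltac:(fun env a' =>
      reify_lexp env b ltac:(fun env b' =>
        reify_goal env ((a', b') :: hs) g' k))
  | @eq _ ?a ?b =>
      reify_lexp env a ltac:(fun env a' =>
      reify_lexp env b ltac:(fun env b' => k env hs (a', b')))
  end.

(** Proves E_1 -> ... -> E_n -> E for equations between vectors of one module
over K. Signs and rational constants are scalars; a vector that is neither a
sum, an opposite nor such a multiple is an unknown. *)
Ltac lin_solve K :=
  lazymatch goal with
  | |- ?g =>
    let V := lazymatch g with
      | (@eq ?T _ _) -> _ => T | @eq ?T _ _ => T end in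
    reify_goal (@nil V) (@nil (lexp * lexp)) g ltac:(fun env hs gl =>
      let hs' := eval lazy beta iota delta [rev catrev] in (rev hs) in
      (* a failed check must not backtrack into the reification *)
      refine (@linear_solve K _ env hs' gl _);
      first [ vm_compute; reflexivity | fail 1000 "not a linear consequence" ])
  end.

(** * Linear and bilinear maps, parities *)

Section Linearity.
Variable K : fieldType.
Implicit Types (U V W X Y : lmodType K).

Lemma lin_id U : linear (fun u : U => u). Proof. by []. Qed.

Lemma lin_0 U V : linear (fun _ : U => 0 : V).
Proof. by move=> c u v; rewrite scaler0 addr0. Qed.

Lemma lin_D U V (f g : U -> V) : linear f -> linear g -> linear (fun u => f u + g u).
Proof. by move=> lf lg c u v; rewrite lf lg scalerDr addrACA. Qed.

Lemma lin_N U V (f : U -> V) : linear f -> linear (fun u => - f u).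
Proof. by move=> lf c u v; rewrite lf opprD scalerN. Qed.

Lemma lin_Z U V d (f : U -> V) : linear f -> linear (fun u => d *: f u).
Proof. by move=> lf c u v; rewrite lf scalerDr !scalerA mulrC. Qed.

Lemma lin_comp U V W (f : U -> V) (g : V -> W) :
  linear f -> linear g -> linear (fun u => g (f u)).
Proof. by move=> lf lg c u v; rewrite lf lg. Qed.

Lemma lin_map U V (g : {linear U -> V}) : linear g.
Proof. exact: linearP. Qed.

Lemma lin_bill U V W X (b : {bilinear V -> W -> X}) w (f : U -> V) :
  linear f -> linear (fun u => b (f u) w).
Proof. by move=> lf c u v; rewrite lf bilinPl. Qed.

Lemma lin_bilr U V W X (b : {bilinear V -> W -> X}) v (f : U -> W) :
  linear f -> linear (fun u => b v (f u)).
Proof. by move=> lf c u u'; rewrite lf bilinPr. Qed.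

Lemma lin_tri1 U V W X Y (t : V -> W -> X -> Y) w x (f : U -> V) :
  trilinear t -> linear f -> linear (fun u => t (f u) w x).
Proof. by case=> h _ _ lf c u v; rewrite lf h. Qed.

Lemma lin_tri2 U V W X Y (t : V -> W -> X -> Y) v x (f : U -> W) :
  trilinear t -> linear f -> linear (fun u => t v (f u) x).
Proof. by case=> _ h _ lf c u u'; rewrite lf h. Qed.

Lemma lin_tri3 U V W X Y (t : V -> W -> X -> Y) v w (f : U -> X) :
  trilinear t -> linear f -> linear (fun u => t v w (f u)).
Proof. by case=> _ _ h lf c u u'; rewrite lf h. Qed.

Lemma lin_scomp U (V : superType K) i (f : U -> V) :
  linear f -> linear (fun u => scomp i (f u)).
Proof. by move=> lf; apply: lin_comp (lf) _; exact: linearP. Qed.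

Lemma linear_rules U V (f : U -> V) : linear f ->
  (forall u v, f (u + v) = f u + f v) * (forall u, f (- u) = - f u) *
  (forall c u, f (c *: u) = c *: f u) * (f 0 = 0).
Proof.
move=> lf; have f0 : f 0 = 0.
  by have /esym/eqP := lf 1 0 0; rewrite scale1r addr0 -subr_eq0 scale1r addrK => /eqP.
have fZ c u : f (c *: u) = c *: f u by rewrite -[c *: u]addr0 lf f0 addr0.
split=> //; split=> // ; split=> u; last by rewrite -scaleN1r fZ scaleN1r.
by move=> v; rewrite -[u]scale1r lf !scale1r.
Qed.

End Linearity.

Ltac linearity :=
  repeat first
  [ exact: lin_id | exact: lin_0 | apply: lin_D | apply: lin_N | apply: lin_Z
  | apply: lin_scomp | assumption
  | apply: lin_bill | apply: lin_bilr
  | apply: (lin_tri1 _ _ (@tri_linear _ _)) | apply: (lin_tri2 _ _ (@tri_linear _ _))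
  | apply: (lin_tri3 _ _ (@tri_linear _ _)) ].

Section Expand.
Variables (K : fieldType).

Section Bil.
Variables (U V W : lmodType K) (f : {bilinear U -> V -> W}).
Lemma bilDl u u' v : f (u + u') v = f u v + f u' v. Proof. exact: linearDl. Qed.
Lemma bilNl u v : f (- u) v = - f u v. Proof. exact: linearNl. Qed.
Lemma bilZl c u v : f (c *: u) v = c *: f u v. Proof. exact: linearZl_LR. Qed.
Lemma bil0l v : f 0 v = 0. Proof. exact: linear0l. Qed.
Lemma bilDr u v v' : f u (v + v') = f u v + f u v'. Proof. exact: linearDr. Qed.
Lemma bilNr u v : f u (- v) = - f u v. Proof. exact: linearNr. Qed.
Lemma bilZr c u v : f u (c *: v) = c *: f u v. Proof. exact: linearZr. Qed.
Lemma bil0r u : f u 0 = 0. Proof. exact: linear0r. Qed.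
Definition bilE := (bilDl, bilNl, bilZl, bil0l, bilDr, bilNr, bilZr, bil0r).
End Bil.

Section Tri.
Variables (U V W X : lmodType K) (f : U -> V -> W -> X).
Hypothesis lf : trilinear f.
Let l1 v w : linear (fun u => f u v w). Proof. by case: lf. Qed.
Let l2 u w : linear (fun v => f u v w). Proof. by case: lf. Qed.
Let l3 u v : linear (f u v). Proof. by case: lf. Qed.
Let t10 v w : f 0 v w = 0.
Proof. by rewrite (linear_rules (l1 v w)). Qed.
Let t20 u w : f u 0 w = 0.
Proof. by rewrite (linear_rules (l2 u w)). Qed.
Let t30 u v : f u v 0 = 0.
Proof. by rewrite (linear_rules (l3 u v)). Qed.
Let t1Z c u v w : f (c *: u) v w = c *: f u v w.
Proof. by rewrite -[c *: u]addr0 l1 t10 addr0. Qed.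
Let t2Z c u v w : f u (c *: v) w = c *: f u v w.
Proof. by rewrite -[c *: v]addr0 l2 t20 addr0. Qed.
Let t3Z c u v w : f u v (c *: w) = c *: f u v w.
Proof. by rewrite -[c *: w]addr0 l3 t30 addr0. Qed.
Let t1D u u' v w : f (u + u') v w = f u v w + f u' v w.
Proof. by rewrite -[u]scale1r l1 !scale1r. Qed.
Let t2D u v v' w : f u (v + v') w = f u v w + f u v' w.
Proof. by rewrite -[v]scale1r l2 !scale1r. Qed.
Let t3D u v w w' : f u v (w + w') = f u v w + f u v w'.
Proof. by rewrite -[w]scale1r l3 !scale1r. Qed.
Let t1N u v w : f (- u) v w = - f u v w. Proof. by rewrite -scaleN1r t1Z scaleN1r. Qed.
Let t2N u v w : f u (- v) w = - f u v w. Proof. by rewrite -scaleN1r t2Z scaleN1r. Qed.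
Let t3N u v w : f u v (- w) = - f u v w. Proof. by rewrite -scaleN1r t3Z scaleN1r. Qed.
Definition trilE := (t1D, t2D, t3D, t1N, t2N, t3N, t1Z, t2Z, t3Z, t10, t20, t30).
End Tri.
End Expand.

Section Super.
Variable K : fieldType.

Definition bilin (U V W : lmodType K) (f : U -> V -> W) : Prop :=
  (forall v, linear (f^~ v)) /\ (forall u, linear (f u)).

Lemma homog0 (V : superType K) i : homog i (0 : V).
Proof. by rewrite /homog linear0. Qed.

Lemma homog_extl (U : superType K) (V : lmodType K) (f g : U -> V) :
  linear f -> linear g -> (forall i u, homog i u -> f u = g u) -> f =1 g.
Proof.
move=> lf lg fg u; rewrite -[u]scomp_sum.
rewrite (linear_rules lf) (linear_rules lg).
by rewrite !(fg _ _ (homog_scomp _ _)).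
Qed.

(** The linear extension of a formula that is given for homogeneous vectors in
terms of their parity. *)
Definition gradext (U : superType K) (V : lmodType K) (f : bool -> U -> V) u :=
  f false (scomp false u) + f true (scomp true u).

Lemma lin_grad (U : superType K) (V : lmodType K) (f : bool -> U -> V) :
  (forall i, linear (f i)) -> linear (gradext f).
Proof.
by move=> lf c u v; rewrite /gradext !linearP !lf scalerDr addrACA.
Qed.

Lemma gradE (U : superType K) (V : lmodType K) (f : bool -> U -> V) i u :
  (forall i, f i 0 = 0) -> homog i u -> gradext f u = f i u.
Proof.
move=> f0 hu; rewrite /gradext !(scomp_homog _ hu).
by case: i hu => _ /=; rewrite f0 ?addr0 ?add0r.
Qed.

Section Sext.
Variables (U V : superType K) (W : lmodType K) (f : bool -> bool -> U -> V -> W).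
Hypothesis bf : forall i j, bilin (f i j).

Definition sext u v := gradext (fun i u => gradext (fun j v => f i j u v) v) u.

Lemma sext_bilin : bilin sext.
Proof.
split=> [v|u].
  apply: lin_grad => i; rewrite /gradext; apply: lin_D.
    by case: (bf i false) => h _; exact: h.
  by case: (bf i true) => h _; exact: h.
rewrite /sext; apply: lin_D; apply: lin_grad => j.
  by case: (bf false j) => _ h; exact: h.
by case: (bf true j) => _ h; exact: h.
Qed.

Lemma sextE i j u v : homog i u -> homog j v -> sext u v = f i j u v.
Proof.
move=> hu hv.
have f0l k l w : f k l 0 w = 0 by case: (bf k l) => h _; rewrite (linear_rules (h w)).
have f0r k l w : f k l w 0 = 0 by case: (bf k l) => _ h; rewrite (linear_rules (h w)).
by rewrite /sext !(gradE _ hu, gradE _ hv) // => k; rewrite /gradext !f0l addr0.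
Qed.
End Sext.
End Super.

Section Structures.
Variable K : fieldType.

(** Universal properties yield functions with a proof of bilinearity; this puts
the structure on them. *)
Definition bilinear_of (U V W : lmodType K) (f : U -> V -> W) (_ : bilin f) := f.

Fact bilinear_of_subproof (U V W : lmodType K) (f : U -> V -> W) (h : bilin f) :
  bilinear_for (GRing.Scale.Law.clone _ _ *:%R _) (GRing.Scale.Law.clone _ _ *:%R _)
    (bilinear_of h).
Proof. by case: (h) => hl hr; split=> [v c u u'|u c v v']; [exact: hl|exact: hr]. Qed.

HB.instance Definition _ (U V W : lmodType K) (f : U -> V -> W) (h : bilin f) :=
  bilinear_isBilinear.Build K U V W *:%R *:%R (bilinear_of h) (bilinear_of_subproof h).

Definition linear_of (U V : lmodType K) (f : U -> V) (_ : linear f) := f.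

HB.instance Definition _ (U V : lmodType K) (f : U -> V) (h : linear f) :=
  GRing.isLinear.Build K U V *:%R (linear_of h) h.

Lemma bilinear_bilin (U V W : lmodType K) (f : {bilinear U -> V -> W}) : bilin f.
Proof. by split=> w c u v; [exact: bilinPl|exact: bilinPr]. Qed.

Lemma lin_bilin_l (Z U V W : lmodType K) (f : U -> V -> W) (p : Z -> U) v :
  bilin f -> linear p -> linear (fun z => f (p z) v).
Proof. by move=> bf lp; exact: (lin_comp lp (bf.1 v)). Qed.

Lemma lin_bilin_r (Z U V W : lmodType K) (f : U -> V -> W) (p : Z -> V) u :
  bilin f -> linear p -> linear (fun z => f u (p z)).
Proof. by move=> bf lp; exact: (lin_comp lp (bf.2 u)). Qed.

End Structures.

(** * The operators <a, b> and partial_{m,n} *)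

Section OpRules.
Variables (K : fieldType) (A : ternary K).
Local Notation J := (tJ A).
Local Notation M := (tM A).
Definition opE :=
  (bilE (@jmul _ J), bilE (@sact _ _ M), bilE (@star _ A), trilE (@tri_linear _ A)).

End OpRules.

Section Operators.
Variables (K : numFieldType) (A : ternary K).
Local Notation J := (tJ A).
Local Notation M := (tM A).
Local Notation hJ := jmul_even.
Local Notation hA := sact_even.
Local Notation hS := star_even.

(** The Jordan identities with a and with b in third place have the same left
side up to commutativity; equating their right sides gives the rule. *)
Lemma innerJ_mul i j k l (a b c d : J) :
  homog i a -> homog j b -> homog k c -> homog l d ->
  inner_J i j a b (c · d) =
    inner_J i j a b c · d + (-1) ^+ ((i (+) j) * k) *: (c · inner_J i j a b d).
Proof.
move=> ha hb hc hd; rewrite /inner_J.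
move: (jmul_jordan hb hc ha hd) (jmul_jordan ha hc hb hd).
rewrite (jmulC hb ha) (jmulC hc ha) (jmulC hc hb) ?(opE A).
rewrite (jmulC (hJ hb hc) ha) (jmulC (hJ ha hc) hb) (jmulC (hJ hb hd) ha)
  (jmulC (hJ hc hd) ha) (jmulC (hJ hc hd) hb) (jmulC (hJ ha hd) hb) ?(opE A).
rewrite (jmulC (hJ ha (hJ hb hd)) hc) (jmulC (hJ hb (hJ ha hd)) hc).
rewrite (jmulC (hJ ha (hJ hc hd)) hb) (jmulC (hJ hb (hJ hc hd)) ha).
rewrite (jmulC (hJ ha hd) (hJ hb hc)) (jmulC (hJ hb hd) (hJ ha hc)) ?(opE A).
by clear ha hb hc hd; case: i; case: j; case: k; case: l; lin_solve K.
Qed.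

(** On M, 4 <a, b> is the supercommutator of the actions of a and b, while a
product of J acts as half of an anticommutator; the rule is then an identity
between operators. *)
Lemma innerM_act i j k l (a b c : J) (m : M) :
  homog i a -> homog j b -> homog k c -> homog l m ->
  inner_M i j a b (c • m) =
    inner_J i j a b c • m + (-1) ^+ ((i (+) j) * k) *: (c • inner_M i j a b m).
Proof.
move=> ha hb hc hm; rewrite /inner_J /inner_M ?(opE A).
rewrite (sact_special _ ha (hJ hb hc)) (sact_special _ hb (hJ ha hc)).
rewrite !(sact_special _ hb hc) !(sact_special _ ha hc) !(opE A).
by clear ha hb hc hm; case: i; case: j; case: k; case: l; lin_solve K.
Qed.

(** By sjt1 multiplication by a acts on m ⋆ n as half of a derivation, and the
mixed terms cancel in the commutator of two such operators. *)
Lemma innerJ_star i j k l (a b : J) (m n : M) :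
  homog i a -> homog j b -> homog k m -> homog l n ->
  inner_J i j a b (m ⋆ n) =
    inner_M i j a b m ⋆ n + (-1) ^+ ((i (+) j) * k) *: (m ⋆ inner_M i j a b n).
Proof.
move=> ha hb hm hn; rewrite /inner_J /inner_M ?(opE A).
rewrite (sjt1 ha hm hn) (sjt1 hb hm hn) ?(opE A).
rewrite (sjt1 ha (hA hb hm) hn) (sjt1 ha hm (hA hb hn)).
rewrite (sjt1 hb (hA ha hm) hn) (sjt1 hb hm (hA ha hn)).
by clear ha hb hm hn; case: i; case: j; case: k; case: l; lin_solve K.
Qed.

(** As for m ⋆ n, with the alternating signs of sjt2: they are squared in the
terms where a and b meet the same factor. *)
Lemma innerM_tri i j k l p (a b : J) (m n s : M) :
  homog i a -> homog j b -> homog k m -> homog l n -> homog p s ->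
  inner_M i j a b (tri m n s) = tri (inner_M i j a b m) n s
    + (-1) ^+ ((i (+) j) * k) *: tri m (inner_M i j a b n) s
    + (-1) ^+ ((i (+) j) * (k (+) l)) *: tri m n (inner_M i j a b s).
Proof.
move=> ha hb hm hn hs; rewrite /inner_M ?(opE A).
rewrite (sjt2 ha hm hn hs) (sjt2 hb hm hn hs) ?(opE A).
rewrite (sjt2 ha (hA hb hm) hn hs) (sjt2 ha hm (hA hb hn) hs) (sjt2 ha hm hn (hA hb hs)).
rewrite (sjt2 hb (hA ha hm) hn hs) (sjt2 hb hm (hA ha hn) hs) (sjt2 hb hm hn (hA ha hs)).
by clear ha hb hm hn hs; case: i; case: j; case: k; case: l; case: p; lin_solve K.
Qed.

Lemma partialJ_mul i j k l (m n : M) (a b : J) :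
  homog i m -> homog j n -> homog k a -> homog l b ->
  partial_J i j (k (+) l) m n (a · b) =
    partial_J i j k m n a · b + (-1) ^+ ((i (+) j) * k) *: (a · partial_J i j l m n b).
Proof.
move=> hm hn ha hb; rewrite /partial_J.
rewrite !(sact_special _ ha hb) ?(opE A).
rewrite (jmulC (hS (hA ha hm) hn) hb) (jmulC (hS hm (hA ha hn)) hb).
rewrite (sjt1 ha (hA hb hm) hn) (sjt1 ha hm (hA hb hn)).
rewrite (sjt1 hb (hA ha hm) hn) (sjt1 hb hm (hA ha hn)).
by clear ha hb hm hn; case: i; case: j; case: k; case: l; lin_solve K.
Qed.

(** By sjt4 the rule sjt2 and its variant with m and n exchanged determine
(a m, n, r) - (m, a n, r) in terms of star products; inserted into sjt2 this
gives the rule. *)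
Lemma partialM_act i j k l (m n : M) (a : J) (r : M) :
  homog i m -> homog j n -> homog k a -> homog l r ->
  partial_M m n (a • r) =
    partial_J i j k m n a • r + (-1) ^+ ((i (+) j) * k) *: (a • partial_M m n r).
Proof.
move=> hm hn ha hr; rewrite /partial_J /partial_M ?(opE A).
move: (sjt2 ha hm hn hr) (sjt2 ha hn hm hr) (sjt4 (a • r) hm hn)
  (congr1 (fun x => a • x) (sjt4 r hm hn)) (sjt4 r (hA ha hm) hn)
  (sjt4 r hm (hA ha hn)).
rewrite ?(opE A).
by clear ha hm hn hr; case: i; case: j; case: k; case: l; lin_solve K.
Qed.

(** The triple products combine by sjt5; what remains is the product of m ⋆ n
and r ⋆ s, expanded by sjt1 in two ways. *)
Lemma partialJ_star i j k l (m n r s : M) :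
  homog i m -> homog j n -> homog k r -> homog l s ->
  partial_J i j (k (+) l) m n (r ⋆ s) =
    partial_M m n r ⋆ s + (-1) ^+ ((i (+) j) * k) *: (r ⋆ partial_M m n s).
Proof.
move=> hm hn hr hs; rewrite /partial_J /partial_M ?(opE A).
move: (sjt5 hm hn hr hs) (sjt1 (hS hr hs) hm hn) (sjt1 (hS hm hn) hr hs)
  (jmulC (hS hr hs) (hS hm hn)).
by clear hm hn hr hs; case: i; case: j; case: k; case: l; lin_solve K.
Qed.

(** In sjt6 the product (n, m, s) is turned into (m, n, s) by sjt4; the extra
term is the middle one of sjt2 for the element m ⋆ n of J. *)
Lemma partialM_tri i j k l p (m n r s t : M) :
  homog i m -> homog j n -> homog k r -> homog l s -> homog p t ->
  partial_M m n (tri r s t) = tri (partial_M m n r) s t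
    + (-1) ^+ ((i (+) j) * k) *: tri r (partial_M m n s) t
    + (-1) ^+ ((i (+) j) * (k (+) l)) *: tri r s (partial_M m n t).
Proof.
move=> hm hn hr hs ht; rewrite /partial_M ?(opE A).
move: (sjt6 hm hn hr hs ht) (sjt2 (hS hm hn) hr hs ht).
rewrite (sjt4 s hn hm) (starC hn hm) ?(opE A).
by clear hm hn hr hs ht; case: i; case: j; case: k; case: l; case: p; lin_solve K.
Qed.

(** This lemma and those up to partialMC say that the operators satisfy the
relations of B^s other than I_{m,n,r,s}. Here the reason is the Jordan identity
with d in third place. *)
Lemma innerJ_cyclic i j k l (a b c d : J) :
  homog i a -> homog j b -> homog k c -> homog l d ->
  (-1) ^+ (i * k) *: inner_J (i (+) j) k (a · b) c d
  + (-1) ^+ (i * j) *: inner_J (j (+) k) i (b · c) a d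
  + (-1) ^+ (j * k) *: inner_J (k (+) i) j (c · a) b d = 0.
Proof.
move=> ha hb hc hd; rewrite /inner_J.
move: (jmul_jordan ha hb hd hc).
rewrite (jmulC hd hc) (jmulC hc ha) ?(opE A).
rewrite (jmulC (hJ (hJ ha hb) hd) hc) (jmulC (hJ (hJ ha hc) hd) hb)
  (jmulC (hJ (hJ hb hc) hd) ha) (jmulC (hJ ha hd) (hJ hb hc)).
by clear ha hb hc hd; case: i; case: j; case: k; case: l; lin_solve K.
Qed.

Lemma innerM_cyclic i j k (a b c : J) (m : M) :
  homog i a -> homog j b -> homog k c ->
  (-1) ^+ (i * k) *: inner_M (i (+) j) k (a · b) c m
  + (-1) ^+ (i * j) *: inner_M (j (+) k) i (b · c) a m
  + (-1) ^+ (j * k) *: inner_M (k (+) i) j (c · a) b m = 0.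
Proof.
move=> ha hb hc; rewrite /inner_M.
rewrite !(sact_special _ ha hb) !(sact_special _ hb hc) !(sact_special _ hc ha) ?(opE A).
by clear ha hb hc; case: i; case: j; case: k; lin_solve K.
Qed.

Lemma partialJ_balanced l i j k (a : J) (m n : M) (c : J) :
  homog l a -> homog i m -> homog j n -> homog k c ->
  partial_J (l (+) i) j k (a • m) n c
  - (-1) ^+ (l * i) *: partial_J i (l (+) j) k m (a • n) c
  - (-1) ^+ (l * (i + j)) *: (2 *: inner_J (i (+) j) l (m ⋆ n) a c) = 0.
Proof.
move=> ha hm hn hc; rewrite /partial_J /inner_J.
rewrite (jmulC (hS hm hn) (hJ ha hc)) (jmulC (hS hm hn) hc) ?(opE A).
rewrite (sjt1 (hJ ha hc) hm hn) (sjt1 hc hm hn) !(sact_special _ ha hc) ?(opE A).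
rewrite (sjt1 ha (hA hc hm) hn) (sjt1 ha hm (hA hc hn)).
by clear ha hm hn hc; case: i; case: j; case: k; case: l; lin_solve K.
Qed.

(** Both sjt2 and the derivation rule partialM_act move the action of a across
the operator; the relation is their difference. *)
Lemma partialM_balanced l i j k (a : J) (m n r : M) :
  homog l a -> homog i m -> homog j n -> homog k r ->
  partial_M (a • m) n r
  - (-1) ^+ (l * i) *: partial_M m (a • n) r
  - (-1) ^+ (l * (i + j)) *: (2 *: inner_M (i (+) j) l (m ⋆ n) a r) = 0.
Proof.
move=> ha hm hn hr; rewrite /partial_M /inner_M.
move: (sjt2 ha hm hn hr) (partialM_act hm hn ha hr).
rewrite /partial_J /partial_M ?(opE A).
by clear ha hm hn hr; case: i; case: j; case: k; case: l; lin_solve K.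
Qed.

Lemma innerJC i j (a b c : J) :
  inner_J i j a b c + (-1) ^+ (i * j) *: inner_J j i b a c = 0.
Proof. rewrite /inner_J; case: i; case: j; lin_solve K. Qed.

Lemma innerMC i j (a b : J) (m : M) :
  inner_M i j a b m + (-1) ^+ (i * j) *: inner_M j i b a m = 0.
Proof. rewrite /inner_M; case: i; case: j; lin_solve K. Qed.

Lemma partialJC i j k (m n : M) (a : J) : homog i m -> homog j n -> homog k a ->
  partial_J i j k m n a - (-1) ^+ (i * j) *: partial_J j i k n m a = 0.
Proof.
move=> hm hn ha; rewrite /partial_J (starC hn (hA ha hm)) (starC (hA ha hn) hm).
by clear ha hm hn; case: i; case: j; case: k; lin_solve K.
Qed.

Lemma partialMC i j (m n r : M) : homog i m -> homog j n ->
  partial_M m n r - (-1) ^+ (i * j) *: partial_M n m r = 0.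
Proof.
move=> hm hn; rewrite /partial_M; move: (sjt4 r hm hn).
rewrite (starC hn hm) ?(opE A).
by clear hm hn; case: i; case: j; lin_solve K.
Qed.

Lemma innerJ_homog i j k (a b c : J) : homog i a -> homog j b -> homog k c ->
  homog (i (+) j (+) k) (inner_J i j a b c).
Proof.
move=> ha hb hc; apply: homogB; last apply: homogZ.
  by apply: (homog_cast (hJ ha (hJ hb hc))); rewrite addbA.
by apply: (homog_cast (hJ hb (hJ ha hc))); rewrite addbCA addbA.
Qed.

Lemma innerM_homog i j k (a b : J) (m : M) : homog i a -> homog j b -> homog k m ->
  homog (i (+) j (+) k) (inner_M i j a b m).
Proof.
move=> ha hb hm; apply: homogZ; apply: homogB; last apply: homogZ.
  by apply: (homog_cast (hA ha (hA hb hm))); rewrite addbA.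
by apply: (homog_cast (hA hb (hA ha hm))); rewrite addbCA addbA.
Qed.

Lemma partialJ_homog i j k (m n : M) (a : J) : homog i m -> homog j n -> homog k a ->
  homog (i (+) j (+) k) (partial_J i j k m n a).
Proof.
move=> hm hn ha; apply: homogZ; apply: homogB; apply: homogZ.
  by apply: (homog_cast (hS (hA ha hm) hn)); rewrite [RHS]addbC addbA.
by apply: (homog_cast (hS hm (hA ha hn))); rewrite -addbA [k (+) j]addbC.
Qed.

End Operators.

(** * Superderivations *)

Section Derivations.
Variables (K : numFieldType) (A : ternary K).
Local Notation J := (tJ A).
Local Notation M := (tM A).
Local Notation hJ := jmul_even.
Local Notation hS := star_even.

Record superder (p : bool) (dJ : J -> J) (dM : M -> M) : Prop := Superder {
  der_linJ : linear dJ;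
  der_linM : linear dM;
  der_homogJ : forall i a, homog i a -> homog (p (+) i) (dJ a);
  der_homogM : forall i m, homog i m -> homog (p (+) i) (dM m);
  der_mul : forall i j a b, homog i a -> homog j b ->
    dJ (a · b) = dJ a · b + (-1) ^+ (p * i) *: (a · dJ b);
  der_act : forall i j a m, homog i a -> homog j m ->
    dM (a • m) = dJ a • m + (-1) ^+ (p * i) *: (a • dM m);
  der_star : forall i j m n, homog i m -> homog j n ->
    dJ (m ⋆ n) = dM m ⋆ n + (-1) ^+ (p * i) *: (m ⋆ dM n);
  der_tri : forall i j k m n s, homog i m -> homog j n -> homog k s ->
    dM (tri m n s) = tri (dM m) n s + (-1) ^+ (p * i) *: tri m (dM n) s
      + (-1) ^+ (p * (i (+) j)) *: tri m n (dM s)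
}.

Lemma superder0 p : superder p (fun=> 0) (fun=> 0).
Proof.
split; try exact: lin_0; try (by move=> *; rewrite /homog linear0).
all: by move=> *; rewrite ?(opE A) ?scaler0 ?addr0.
Qed.

Lemma superderP p c dJ dM dJ' dM' : superder p dJ dM -> superder p dJ' dM' ->
  superder p (fun a => c *: dJ a + dJ' a) (fun m => c *: dM m + dM' m).
Proof.
case=> h1 h2 h3 h4 h5 h6 h7 h8 [g1 g2 g3 g4 g5 g6 g7 g8]; split.
- by move=> d u v; rewrite h1 g1 !scalerDr !scalerA mulrC addrACA.
- by move=> d u v; rewrite h2 g2 !scalerDr !scalerA mulrC addrACA.
- by move=> i a ha; apply/homogD/g3/ha/homogZ/h3.
- by move=> i a ha; apply/homogD/g4/ha/homogZ/h4.
- move=> i j a b ha hb; rewrite (h5 _ _ _ _ ha hb) (g5 _ _ _ _ ha hb) ?(opE A).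
  by rewrite !scalerDr !scalerA mulrC addrACA.
- move=> i j a b ha hb; rewrite (h6 _ _ _ _ ha hb) (g6 _ _ _ _ ha hb) ?(opE A).
  by rewrite !scalerDr !scalerA mulrC addrACA.
- move=> i j a b ha hb; rewrite (h7 _ _ _ _ ha hb) (g7 _ _ _ _ ha hb) ?(opE A).
  by rewrite !scalerDr !scalerA mulrC addrACA.
- move=> i j k a b s ha hb hs.
  rewrite (h8 _ _ _ _ _ _ ha hb hs) (g8 _ _ _ _ _ _ ha hb hs) ?(opE A).
  rewrite !scalerDr !scalerA !(mulrC c).
  by rewrite addrACA [X in X + _ = _]addrACA.
Qed.

Lemma superder_inner i j a b : homog i a -> homog j b ->
  superder (i (+) j) (inner_J i j a b) (inner_M i j a b).
Proof.
move=> ha hb; split.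
- by rewrite /inner_J; linearity.
- by rewrite /inner_M; linearity.
- by move=> k c; exact: innerJ_homog ha hb.
- by move=> k c; exact: innerM_homog ha hb.
- by move=> k l c d hc hd; exact: innerJ_mul ha hb hc hd.
- by move=> k l c d hc hd; exact: innerM_act ha hb hc hd.
- by move=> k l c d hc hd; exact: innerJ_star ha hb hc hd.
- by move=> k l p m n s hm hn hs; exact: innerM_tri ha hb hm hn hs.
Qed.

(** On J the formula for partial_{m,n} depends on the parity of the argument. *)
Definition partialJ i j m n (a : J) : J :=
  partial_J i j false m n (scomp false a) + partial_J i j true m n (scomp true a).

Lemma partialJE i j k m n a : homog k a -> partialJ i j m n a = partial_J i j k m n a.
Proof.
move=> ha; rewrite /partialJ !(scomp_homog _ ha) /partial_J.
by case: k ha => _ /=; rewrite ?(opE A) !scaler0 subr0 scaler0 ?addr0 ?add0r.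
Qed.

Lemma superder_partial i j m n : homog i m -> homog j n ->
  superder (i (+) j) (partialJ i j m n) (partial_M m n).
Proof.
move=> hm hn; split.
- by rewrite /partialJ /partial_J; linearity.
- by rewrite /partial_M; linearity.
- move=> k a ha; rewrite (partialJE _ _ _ _ ha); exact: partialJ_homog hm hn ha.
- by move=> k c; exact: partial_M_homog hm hn.
- move=> k l a b ha hb; rewrite (partialJE _ _ _ _ (hJ ha hb)).
  by rewrite (partialJE _ _ _ _ ha) (partialJE _ _ _ _ hb); exact: partialJ_mul hm hn ha hb.
- move=> k l a r ha hr.
  by rewrite (partialJE _ _ _ _ ha); exact: partialM_act hm hn ha hr.
- move=> k l r s hr hs; rewrite (partialJE _ _ _ _ (hS hr hs)).
  exact: partialJ_star hm hn hr hs.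
- by move=> k l p r s t hr hs ht; exact: partialM_tri hm hn hr hs ht.
Qed.
End Derivations.

Section Commutators.
Variables (K : numFieldType) (A : ternary K).
Local Notation J := (tJ A).
Local Notation M := (tM A).
Local Notation hJ := jmul_even.
Local Notation hA := sact_even.
Local Notation hS := star_even.
Variables (p : bool) (dJ : J -> J) (dM : M -> M).
Hypothesis D : superder p dJ dM.
Let dE := (linear_rules (der_linJ D), linear_rules (der_linM D)).
Let dhJ := der_homogJ D.
Let dhM := der_homogM D.

(** [D, <a, b>] = <D a, b> + (-1)^(|D||a|) <a, D b>, since <a, b> is built from
operations of which D is a derivation. The next three lemmas have the same
reason. *)
Lemma der_innerJ i j k (a b c : J) : homog i a -> homog j b -> homog k c ->
  dJ (inner_J i j a b c) = inner_J (p (+) i) j (dJ a) b c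
    + (-1) ^+ (p * i) *: inner_J i (p (+) j) a (dJ b) c
    + (-1) ^+ (p * (i (+) j)) *: inner_J i j a b (dJ c).
Proof.
move=> ha hb hc; rewrite /inner_J !dE.
rewrite (der_mul D ha (hJ hb hc)) (der_mul D hb (hJ ha hc)).
rewrite (der_mul D ha hc) (der_mul D hb hc) ?(opE A).
by clear ha hb hc; case: (p); case: i; case: j; case: k; lin_solve K.
Qed.

Lemma der_innerM i j k (a b : J) (m : M) : homog i a -> homog j b -> homog k m ->
  dM (inner_M i j a b m) = inner_M (p (+) i) j (dJ a) b m
    + (-1) ^+ (p * i) *: inner_M i (p (+) j) a (dJ b) m
    + (-1) ^+ (p * (i (+) j)) *: inner_M i j a b (dM m).
Proof.
move=> ha hb hm; rewrite /inner_M !dE.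
rewrite (der_act D ha (hA hb hm)) (der_act D hb (hA ha hm)).
rewrite (der_act D ha hm) (der_act D hb hm) ?(opE A).
by clear ha hb hm; case: (p); case: i; case: j; case: k; lin_solve K.
Qed.

Lemma der_partialJ i j k (m n : M) (c : J) : homog i m -> homog j n -> homog k c ->
  dJ (partial_J i j k m n c) = partial_J (p (+) i) j k (dM m) n c
    + (-1) ^+ (p * i) *: partial_J i (p (+) j) k m (dM n) c
    + (-1) ^+ (p * (i (+) j)) *: partial_J i j (p (+) k) m n (dJ c).
Proof.
move=> hm hn hc; rewrite /partial_J !dE.
rewrite (der_star D (hA hc hm) hn) (der_star D hm (hA hc hn)).
rewrite (der_act D hc hm) (der_act D hc hn) ?(opE A).
by clear hm hn hc; case: (p); case: i; case: j; case: k; lin_solve K.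
Qed.

Lemma der_partialM i j k (m n r : M) : homog i m -> homog j n -> homog k r ->
  dM (partial_M m n r) = partial_M (dM m) n r
    + (-1) ^+ (p * i) *: partial_M m (dM n) r
    + (-1) ^+ (p * (i (+) j)) *: partial_M m n (dM r).
Proof.
move=> hm hn hr; rewrite /partial_M !dE.
rewrite (der_act D (hS hm hn) hr) (der_star D hm hn) (der_tri D hm hn hr) ?(opE A).
by clear hm hn hr; case: (p); case: i; case: j; case: k; lin_solve K.
Qed.

End Commutators.

(** * The relations defining B^s *)

Section Relations.
Variables (K : numFieldType) (A : ternary K).
Local Notation J := (tJ A).
Local Notation M := (tM A).
Local Notation hJ := jmul_even.
Local Notation hA := sact_even.
Local Notation hS := star_even.

(** The bilinear maps subject to these conditions are those induced by the
linear maps on B^s(J, M). *)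
Record tag_rel (W : lmodType K) (fJ : J -> J -> W) (fM : M -> M -> W) : Prop := TagRel {
  rel_J : forall i j a b, homog i a -> homog j b ->
    fJ a b + (-1) ^+ (i * j) *: fJ b a = 0;
  rel_M : forall i j m n, homog i m -> homog j n ->
    fM m n - (-1) ^+ (i * j) *: fM n m = 0;
  rel_JJJ : forall i j k a b c, homog i a -> homog j b -> homog k c ->
    (-1) ^+ (i * k) *: fJ (a · b) c + (-1) ^+ (i * j) *: fJ (b · c) a
    + (-1) ^+ (j * k) *: fJ (c · a) b = 0;
  rel_JMM : forall l i j a m n, homog l a -> homog i m -> homog j n ->
    fM (a • m) n - (-1) ^+ (l * i) *: fM m (a • n)
    - (-1) ^+ (l * (i + j)) *: (2 *: fJ (m ⋆ n) a) = 0;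
  rel_MMMM : forall i j k l m n r s,
    homog i m -> homog j n -> homog k r -> homog l s ->
    fM (partial_M m n r) s + (-1) ^+ ((i + j) * k) *: fM r (partial_M m n s)
    + (-1) ^+ ((i + j) * (k + l)) *: fM (partial_M r s m) n
    + (-1) ^+ ((k + l) * j) *: fM m (partial_M r s n) = 0
}.

Variables (B : lmodType K) (bJ : {bilinear J -> J -> B}) (bM : {bilinear M -> M -> B}).
Hypothesis rB : tag_rel bJ bM.
Let bE := (bilE bJ, bilE bM).

Section Der.
Variables (p : bool) (dJ : J -> J) (dM : M -> M).
Hypothesis D : superder p dJ dM.
Let dhJ := der_homogJ D.
Let dhM := der_homogM D.

(** D applied to a relation is the sum of the relations obtained by applying D
to one argument at a time; for I_{m,n,r,s} this is where the commutator of D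
with partial_{m,n} comes in. *)
Lemma tag_rel_der (fJ : J -> J -> B) (fM : M -> M -> B) :
  (forall i a b, homog i a -> fJ a b = bJ (dJ a) b + (-1) ^+ (p * i) *: bJ a (dJ b)) ->
  (forall i m n, homog i m -> fM m n = bM (dM m) n + (-1) ^+ (p * i) *: bM m (dM n)) ->
  tag_rel fJ fM.
Proof.
move=> fJE fME; split.
- move=> i j a b ha hb; rewrite (fJE _ _ _ ha) (fJE _ _ _ hb).
  move: (rel_J rB (dhJ ha) hb) (rel_J rB ha (dhJ hb)).
  by clear ha hb; case: (p); case: i; case: j; lin_solve K.
- move=> i j m n hm hn; rewrite (fME _ _ _ hm) (fME _ _ _ hn).
  move: (rel_M rB (dhM hm) hn) (rel_M rB hm (dhM hn)).
  by clear hm hn; case: (p); case: i; case: j; lin_solve K.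
- move=> i j k a b c ha hb hc.
  rewrite (fJE _ _ _ (hJ ha hb)) (fJE _ _ _ (hJ hb hc)) (fJE _ _ _ (hJ hc ha)).
  rewrite (der_mul D ha hb) (der_mul D hb hc) (der_mul D hc ha) ?bE.
  move: (rel_JJJ rB (dhJ ha) hb hc) (rel_JJJ rB ha (dhJ hb) hc) (rel_JJJ rB ha hb (dhJ hc)).
  by clear ha hb hc; case: (p); case: i; case: j; case: k; lin_solve K.
- move=> l i j a m n ha hm hn.
  rewrite (fME _ _ _ (hA ha hm)) (fME _ _ _ hm) (fJE _ _ _ (hS hm hn)).
  rewrite (der_act D ha hm) (der_act D ha hn) (der_star D hm hn) ?bE.
  move: (rel_JMM rB (dhJ ha) hm hn) (rel_JMM rB ha (dhM hm) hn) (rel_JMM rB ha hm (dhM hn)).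
  by clear ha hm hn; case: (p); case: i; case: j; case: l; lin_solve K.
- move=> i j k l m n r s hm hn hr hs.
  rewrite (fME _ _ _ (partial_M_homog hm hn hr)) (fME _ _ _ hr).
  rewrite (fME _ _ _ (partial_M_homog hr hs hm)) (fME _ _ _ hm).
  rewrite (der_partialM D hm hn hr) (der_partialM D hm hn hs).
  rewrite (der_partialM D hr hs hm) (der_partialM D hr hs hn).
  move: (rel_MMMM rB (dhM hm) hn hr hs) (rel_MMMM rB hm (dhM hn) hr hs)
    (rel_MMMM rB hm hn (dhM hr) hs) (rel_MMMM rB hm hn hr (dhM hs)).
  move: (@partial_M K A) => P; rewrite ?bE.
  by clear hm hn hr hs; case: (p); case: i; case: j; case: k; case: l; lin_solve K.
Qed.
End Der.

(** I_{m,n,r,s} acts as zero because the commutator of partial_{m,n} and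
partial_{r,s} can be computed by letting either act on the indices of the
other. *)
Lemma tag_rel_actJ l (d : J) (fJ : J -> J -> J) (fM : M -> M -> J) : homog l d ->
  (forall i j a b, homog i a -> homog j b -> fJ a b = inner_J i j a b d) ->
  (forall i j m n, homog i m -> homog j n -> fM m n = partial_J i j l m n d) ->
  tag_rel fJ fM.
Proof.
move=> hd fJE fME; split.
- by move=> i j a b ha hb; rewrite (fJE _ _ _ _ ha hb) (fJE _ _ _ _ hb ha) innerJC.
- by move=> i j m n hm hn; rewrite (fME _ _ _ _ hm hn) (fME _ _ _ _ hn hm) partialJC.
- move=> i j k a b c ha hb hc.
  rewrite (fJE _ _ _ _ (hJ ha hb) hc) (fJE _ _ _ _ (hJ hb hc) ha).
  by rewrite (fJE _ _ _ _ (hJ hc ha) hb) (innerJ_cyclic ha hb hc hd).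
- move=> k i j a m n ha hm hn.
  rewrite (fME _ _ _ _ (hA ha hm) hn) (fME _ _ _ _ hm (hA ha hn)).
  by rewrite (fJE _ _ _ _ (hS hm hn) ha) (partialJ_balanced ha hm hn hd).
- move=> i j k q m n r s hm hn hr hs.
  have h1 := partial_M_homog hm hn; have h2 := partial_M_homog hr hs.
  rewrite (fME _ _ _ _ (h1 _ _ hr) hs) (fME _ _ _ _ hr (h1 _ _ hs)).
  rewrite (fME _ _ _ _ (h2 _ _ hm) hn) (fME _ _ _ _ hm (h2 _ _ hn)).
  move: (der_partialJ (superder_partial hm hn) hr hs hd).
  move: (der_partialJ (superder_partial hr hs) hm hn hd).
  rewrite !(partialJE _ _ _ _ (partialJ_homog hm hn hd)).
  rewrite !(partialJE _ _ _ _ (partialJ_homog hr hs hd)) !(partialJE _ _ _ _ hd).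
  clear h1 h2 hm hn hr hs hd fJE fME.
  by case: i; case: j; case: k; case: q; case: l; lin_solve K.
Qed.

Lemma tag_rel_actM (t : M) (fJ : J -> J -> M) (fM : M -> M -> M) l : homog l t ->
  (forall i j a b, homog i a -> homog j b -> fJ a b = inner_M i j a b t) ->
  (forall m n, fM m n = partial_M m n t) ->
  tag_rel fJ fM.
Proof.
move=> ht fJE fME; split.
- by move=> i j a b ha hb; rewrite (fJE _ _ _ _ ha hb) (fJE _ _ _ _ hb ha) innerMC.
- by move=> i j m n hm hn; rewrite !fME (partialMC _ hm hn).
- move=> i j k a b c ha hb hc.
  rewrite (fJE _ _ _ _ (hJ ha hb) hc) (fJE _ _ _ _ (hJ hb hc) ha).
  by rewrite (fJE _ _ _ _ (hJ hc ha) hb) (innerM_cyclic _ ha hb hc).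
- move=> k i j a m n ha hm hn.
  by rewrite !fME (fJE _ _ _ _ (hS hm hn) ha) (partialM_balanced ha hm hn ht).
- move=> i j k q m n r s hm hn hr hs; rewrite !fME.
  move: (der_partialM (superder_partial hm hn) hr hs ht).
  move: (der_partialM (superder_partial hr hs) hm hn ht).
  by clear hm hn hr hs ht fJE fME; case: i; case: j; case: k; case: q; case: l; lin_solve K.
Qed.

(** Modulo the relations {a(bc) (x) d} = - {(bc)d (x) a} - {da (x) bc}. Applied
to the four terms on the left this produces the right side, and the classes
with a product in both slots cancel. *)
Lemma skew_JJ i j k l (a b c d : J) :
  homog i a -> homog j b -> homog k c -> homog l d ->
  bJ (inner_J i j a b c) d + (-1) ^+ ((i (+) j) * k) *: bJ c (inner_J i j a b d)
  = - ((-1) ^+ ((i (+) j) * (k (+) l)) *: (bJ (inner_J k l c d a) b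
       + (-1) ^+ ((k (+) l) * i) *: bJ a (inner_J k l c d b))).
Proof.
move=> ha hb hc hd; rewrite /inner_J.
move: (rel_JJJ rB ha (hJ hb hc) hd) (rel_JJJ rB hb (hJ ha hc) hd)
  (rel_JJJ rB ha (hJ hb hd) hc) (rel_JJJ rB hb (hJ ha hd) hc)
  (rel_J rB hc (hJ ha (hJ hb hd))) (rel_J rB hc (hJ hb (hJ ha hd)))
  (rel_J rB (hJ ha hc) (hJ hb hd)) (rel_J rB (hJ hb hc) (hJ ha hd))
  (rel_J rB ha (hJ hc (hJ hb hd))) (rel_J rB ha (hJ hd (hJ hb hc))).
rewrite (jmulC hd ha) (jmulC hd hb) (jmulC hc ha) (jmulC hc hb).
rewrite (jmulC (hJ hb hc) hd) (jmulC (hJ ha hc) hd) (jmulC (hJ hb hd) hc)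
  (jmulC (hJ ha hd) hc) ?(opE A) ?bE.
by clear ha hb hc hd; case: i; case: j; case: k; case: l; lin_solve K.
Qed.

Lemma skew_JM i j k l (a b : J) (m n : M) :
  homog i a -> homog j b -> homog k m -> homog l n ->
  bM (inner_M i j a b m) n + (-1) ^+ ((i (+) j) * k) *: bM m (inner_M i j a b n)
  = - ((-1) ^+ ((i (+) j) * (k (+) l)) *: (bJ (partial_J k l i m n a) b
       + (-1) ^+ ((k (+) l) * i) *: bJ a (partial_J k l j m n b))).
Proof.
move=> ha hb hm hn; rewrite /inner_M /partial_J.
move: (rel_JMM rB ha (hA hb hm) hn) (rel_JMM rB hb (hA ha hm) hn)
  (rel_JMM rB ha hm (hA hb hn)) (rel_JMM rB hb hm (hA ha hn))
  (rel_J rB ha (hS (hA hb hm) hn)) (rel_J rB ha (hS hm (hA hb hn))).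
rewrite ?bE.
by clear ha hb hm hn; case: i; case: j; case: k; case: l; lin_solve K.
Qed.

(** Up to signs this is the relation I_{m,n,r,s}. *)
Lemma skew_MM i j k l (m n r s : M) :
  homog i m -> homog j n -> homog k r -> homog l s ->
  bM (partial_M m n r) s + (-1) ^+ ((i (+) j) * k) *: bM r (partial_M m n s)
  = - ((-1) ^+ ((i (+) j) * (k (+) l)) *: (bM (partial_M r s m) n
       + (-1) ^+ ((k (+) l) * i) *: bM m (partial_M r s n))).
Proof.
move=> hm hn hr hs; move: (rel_MMMM rB hm hn hr hs).
by clear hm hn hr hs; case: i; case: j; case: k; case: l; lin_solve K.
Qed.

End Relations.

(** * The action of B^s *)

Section Center.
Variables (K : numFieldType) (A : ternary K).
Local Notation J := (tJ A).
Local Notation M := (tM A).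

(** B^s(J, M) by generators and relations: a target for maps subject to the
relations that is spanned by their values and through which all others
factor. *)
Record presents (B : superType K) (bJ : {bilinear J -> J -> B})
    (bM : {bilinear M -> M -> B}) : Prop := Presents {
  pres_rel : tag_rel bJ bM;
  pres_evenJ : even_map2 bJ;
  pres_evenM : even_map2 bM;
  pres_ind : forall P : B -> Prop, P 0 ->
    (forall c u v, P u -> P v -> P (c *: u + v)) ->
    (forall i j a b, homog i a -> homog j b -> P (bJ a b)) ->
    (forall i j m n, homog i m -> homog j n -> P (bM m n)) -> forall z, P z;
  pres_lift : forall (W : lmodType K) (fJ : J -> J -> W) (fM : M -> M -> W),
    bilin fJ -> bilin fM -> tag_rel fJ fM ->
    exists F : B -> W, [/\ linear F, forall a b, F (bJ a b) = fJ a b &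
      forall m n, F (bM m n) = fM m n]
}.

Variables (B : superType K) (bJ : {bilinear J -> J -> B}) (bM : {bilinear M -> M -> B}).
Hypothesis prB : presents bJ bM.
Let rB := pres_rel prB.

Lemma pres_homog_ind p (P : B -> Prop) : P 0 ->
  (forall c u v, P u -> P v -> P (c *: u + v)) ->
  (forall i j a b, homog i a -> homog j b -> i (+) j = p -> P (bJ a b)) ->
  (forall i j m n, homog i m -> homog j n -> i (+) j = p -> P (bM m n)) ->
  forall z, homog p z -> P z.
Proof.
move=> P0 PD PJ PM z <-; move: z; apply: (pres_ind prB).
- by rewrite linear0.
- by move=> c u v Pu Pv; rewrite linearP; exact: PD.
- move=> i j a b ha hb; rewrite (scomp_homog _ (pres_evenJ prB ha hb)).
  by case: eqP => // h; apply: PJ ha hb _.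
- move=> i j m n hm hn; rewrite (scomp_homog _ (pres_evenM prB hm hn)).
  by case: eqP => // h; apply: PM hm hn _.
Qed.

(** For homogeneous c the evaluation of the operators at c satisfies the
relations, hence factors through B; the maps for the two components of c are
added. Linearity in c is inherited from the generators of B. *)
Lemma actJ_exists : exists act : B -> J -> J, [/\ bilin act,
  forall i j a b c, homog i a -> homog j b -> act (bJ a b) c = inner_J i j a b c &
  forall i j k m n c, homog i m -> homog j n -> homog k c ->
    act (bM m n) c = partial_J i j k m n c].
Proof.
have E (kc : bool * J) : exists F : B -> J, homog kc.1 kc.2 -> [/\ linear F,
    forall i j a b, homog i a -> homog j b -> F (bJ a b) = inner_J i j a b kc.2 &
    forall i j m n, homog i m -> homog j n -> F (bM m n) = partial_J i j kc.1 m n kc.2].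
  have [hc|hc] := pselect (homog kc.1 kc.2); last by exists (fun=> 0).
  case: kc hc => k c /= hc.
  have bI i j : bilin (fun a b => inner_J i j a b c).
    by split=> ?; rewrite /inner_J; linearity.
  have bP i j : bilin (fun m n => partial_J i j k m n c).
    by split=> ?; rewrite /partial_J; linearity.
  have [] := pres_lift prB (sext_bilin bI) (sext_bilin bP).
    apply: (tag_rel_actJ hc) => i j.
      by move=> a b ha hb; rewrite (sextE bI ha hb).
    by move=> m n hm hn; rewrite (sextE bP hm hn).
  move=> F [lF FJ FM]; exists F => _; split=> //.
    by move=> i j a b ha hb; rewrite FJ (sextE bI ha hb).
  by move=> i j m n hm hn; rewrite FM (sextE bP hm hn).
have [F FP] := choice E; pose G k c := F (k, scomp k c).
have {FP} GP k c : [/\ linear (G k c),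
    forall i j a b, homog i a -> homog j b ->
      G k c (bJ a b) = inner_J i j a b (scomp k c) &
    forall i j m n, homog i m -> homog j n ->
      G k c (bM m n) = partial_J i j k m n (scomp k c)].
  exact: FP (k, scomp k c) (homog_scomp _ _).
pose act z c := G false c z + G true c z.
have actl c : linear (act^~ c).
  by apply: lin_D; case: (GP false c); case: (GP true c).
have actJ i j a b c : homog i a -> homog j b -> act (bJ a b) c = inner_J i j a b c.
  move=> ha hb; rewrite /act; have [_ h0 _] := GP false c; have [_ h1 _] := GP true c.
  rewrite (h0 _ _ _ _ ha hb) (h1 _ _ _ _ ha hb).
  have lI : linear (inner_J i j a b) by rewrite /inner_J; linearity.
  by rewrite -(linear_rules lI) scomp_sum.
have actM i j m n c : homog i m -> homog j n -> act (bM m n) c = partialJ i j m n c.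
  move=> hm hn; rewrite /act; have [_ _ h0] := GP false c; have [_ _ h1] := GP true c.
  by rewrite (h0 _ _ _ _ hm hn) (h1 _ _ _ _ hm hn).
exists act; split=> //; last first.
  by move=> i j k m n c hm hn hc; rewrite (actM _ _ _ _ _ hm hn) (partialJE _ _ _ _ hc).
split=> //; apply: (pres_ind prB).
- move=> c u v; rewrite !(linear_rules (actl _)); by rewrite scaler0 addr0.
- move=> c u v lu lv d a b; rewrite !actl; exact: (lin_D (lin_Z c lu) lv d a b).
- move=> i j a b ha hb c u v; rewrite !(actJ _ _ _ _ _ ha hb).
  by move: c u v; rewrite /inner_J; linearity.
- move=> i j a b ha hb c u v; rewrite !(actM _ _ _ _ _ ha hb).
  by move: c u v; rewrite /partialJ /partial_J; linearity.
Qed.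

Lemma actM_exists : exists act : B -> M -> M, [/\ bilin act,
  forall i j a b r, homog i a -> homog j b -> act (bJ a b) r = inner_M i j a b r &
  forall m n r, act (bM m n) r = partial_M m n r].
Proof.
have E (kr : bool * M) : exists F : B -> M, homog kr.1 kr.2 -> [/\ linear F,
    forall i j a b, homog i a -> homog j b -> F (bJ a b) = inner_M i j a b kr.2 &
    forall m n, F (bM m n) = partial_M m n kr.2].
  have [hr|hr] := pselect (homog kr.1 kr.2); last by exists (fun=> 0).
  case: kr hr => k r /= hr.
  have bI i j : bilin (fun a b => inner_M i j a b r).
    by split=> ?; rewrite /inner_M; linearity.
  have bP : bilin (fun m n => partial_M m n r).
    by split=> ?; rewrite /partial_M; linearity.
  have [] := pres_lift prB (sext_bilin bI) bP.
    by apply: (tag_rel_actM hr) => // i j a b ha hb; rewrite (sextE bI ha hb).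
  move=> F [lF FJ FM]; exists F => _; split=> //.
  by move=> i j a b ha hb; rewrite FJ (sextE bI ha hb).
have [F FP] := choice E; pose G k c := F (k, scomp k c).
have {FP} GP k r : [/\ linear (G k r),
    forall i j a b, homog i a -> homog j b ->
      G k r (bJ a b) = inner_M i j a b (scomp k r) &
    forall m n, G k r (bM m n) = partial_M m n (scomp k r)].
  exact: FP (k, scomp k r) (homog_scomp _ _).
pose act z r := G false r z + G true r z.
have actl r : linear (act^~ r).
  by apply: lin_D; case: (GP false r); case: (GP true r).
have actJ i j a b r : homog i a -> homog j b -> act (bJ a b) r = inner_M i j a b r.
  move=> ha hb; rewrite /act; have [_ h0 _] := GP false r; have [_ h1 _] := GP true r.
  rewrite (h0 _ _ _ _ ha hb) (h1 _ _ _ _ ha hb).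
  have lI : linear (inner_M i j a b) by rewrite /inner_M; linearity.
  by rewrite -(linear_rules lI) scomp_sum.
have actM m n r : act (bM m n) r = partial_M m n r.
  rewrite /act; have [_ _ ->] := GP false r; have [_ _ ->] := GP true r.
  have lI : linear (partial_M m n) by rewrite /partial_M; linearity.
  by rewrite -(linear_rules lI) scomp_sum.
exists act; split=> //; split=> //; apply: (pres_ind prB).
- move=> c u v; rewrite !(linear_rules (actl _)); by rewrite scaler0 addr0.
- move=> c u v lu lv d a b; rewrite !actl; exact: (lin_D (lin_Z c lu) lv d a b).
- move=> i j a b ha hb c u v; rewrite !(actJ _ _ _ _ _ ha hb).
  by move: c u v; rewrite /inner_M; linearity.
- move=> i j a b ha hb c u v; rewrite !actM.
  by move: c u v; rewrite /partial_M; linearity.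
Qed.

Section Action.
Variables (actJ : B -> J -> J) (actM : B -> M -> M).
Hypothesis actJ_bilin : bilin actJ.
Hypothesis actM_bilin : bilin actM.
Hypothesis actJ_J : forall i j a b c, homog i a -> homog j b ->
  actJ (bJ a b) c = inner_J i j a b c.
Hypothesis actJ_M : forall i j k m n c, homog i m -> homog j n -> homog k c ->
  actJ (bM m n) c = partial_J i j k m n c.
Hypothesis actM_J : forall i j a b r, homog i a -> homog j b ->
  actM (bJ a b) r = inner_M i j a b r.
Hypothesis actM_M : forall m n r, actM (bM m n) r = partial_M m n r.

Let lJl a := linear_rules (actJ_bilin.1 a).
Let lJr z := linear_rules (actJ_bilin.2 z).
Let lMl a := linear_rules (actM_bilin.1 a).
Let lMr z := linear_rules (actM_bilin.2 z).

(** The superderivations of parity p form a space that contains the operators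
of the generators of parity p. *)
Lemma superder_act p z : homog p z -> superder p (actJ z) (actM z).
Proof.
move: z; apply: pres_homog_ind => [|c u v Du Dv|i j a b ha hb <-|i j m n hm hn <-].
- have -> : actJ 0 = fun=> 0 by apply/funext => a; rewrite lJl.
  have -> : actM 0 = fun=> 0 by apply/funext => a; rewrite lMl.
  exact: superder0.
- have -> : actJ (c *: u + v) = fun a => c *: actJ u a + actJ v a.
    by apply/funext => a; rewrite !lJl.
  have -> : actM (c *: u + v) = fun a => c *: actM u a + actM v a.
    by apply/funext => a; rewrite !lMl.
  exact: superderP.
- have -> : actJ (bJ a b) = inner_J i j a b by apply/funext => c; exact: actJ_J.
  have -> : actM (bJ a b) = inner_M i j a b by apply/funext => c; exact: actM_J.
  exact: superder_inner.
- have -> : actM (bM m n) = partial_M m n by apply/funext => c; exact: actM_M.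
  have -> : actJ (bM m n) = partialJ i j m n; last exact: superder_partial.
  apply/funext; apply: homog_extl; first exact: actJ_bilin.2.
    by rewrite /partialJ /partial_J; linearity.
  by move=> k c hc; rewrite (actJ_M hm hn hc) (partialJE _ _ _ _ hc).
Qed.

(** For z of parity p the operator of z is a superderivation, so that its
extension to pairs satisfies the relations by tag_rel_der. *)
Lemma actB_exists : exists act : B -> B -> B, [/\ bilin act,
  forall p k z c d, homog p z -> homog k c -> act z (bJ c d) =
    bJ (actJ z c) d + (-1) ^+ (p * k) *: bJ c (actJ z d) &
  forall p k z r s, homog p z -> homog k r -> act z (bM r s) =
    bM (actM z r) s + (-1) ^+ (p * k) *: bM r (actM z s)].
Proof.
have E (pz : bool * B) : exists F : B -> B, homog pz.1 pz.2 -> [/\ linear F,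
    forall k c d, homog k c -> F (bJ c d) =
      bJ (actJ pz.2 c) d + (-1) ^+ (pz.1 * k) *: bJ c (actJ pz.2 d) &
    forall k r s, homog k r -> F (bM r s) =
      bM (actM pz.2 r) s + (-1) ^+ (pz.1 * k) *: bM r (actM pz.2 s)].
  have [hz|hz] := pselect (homog pz.1 pz.2); last by exists (fun=> 0).
  case: pz hz => p z /= hz; have Dz := superder_act hz.
  pose fJ k c d := bJ (actJ z c) d + (-1) ^+ (p * k) *: bJ c (actJ z d).
  pose fM k r s := bM (actM z r) s + (-1) ^+ (p * k) *: bM r (actM z s).
  have bfJ k : bilin (fJ k).
    by split=> w; rewrite /fJ; linearity; exact: der_linJ Dz.
  have bfM k : bilin (fM k).
    by split=> w; rewrite /fM; linearity; exact: der_linM Dz.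
  have fJE k c d : homog k c -> gradext (fun k c => fJ k c d) c = fJ k c d.
    by apply: gradE => l; rewrite (linear_rules ((bfJ l).1 d)).
  have fME k r s : homog k r -> gradext (fun k r => fM k r s) r = fM k r s.
    by apply: gradE => l; rewrite (linear_rules ((bfM l).1 s)).
  have [||//|F [lF FJ FM]] := pres_lift prB
      (fJ := fun c d => gradext (fun k c => fJ k c d) c)
      (fM := fun r s => gradext (fun k r => fM k r s) r).
  - split=> w; first by apply: lin_grad => k; case: (bfJ k).
    by apply: lin_D; case: (bfJ false); case: (bfJ true).
  - split=> w; first by apply: lin_grad => k; case: (bfM k).
    by apply: lin_D; case: (bfM false); case: (bfM true).
  - by apply: (tag_rel_der rB Dz) => i u v; [exact: fJE|exact: fME].
  exists F => _; split=> // k u v hu; first by rewrite FJ (fJE _ _ _ hu).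
  by rewrite FM (fME _ _ _ hu).
have [F FP] := choice E; pose G p z := F (p, z).
have {FP} GP p z : homog p z -> [/\ linear (G p z),
    forall k c d, homog k c -> G p z (bJ c d) =
      bJ (actJ z c) d + (-1) ^+ (p * k) *: bJ c (actJ z d) &
    forall k r s, homog k r -> G p z (bM r s) =
      bM (actM z r) s + (-1) ^+ (p * k) *: bM r (actM z s)].
  exact: FP (p, z).
pose act z := fun w => gradext (fun p z => G p z w) z.
have act_lin z : linear (act z).
  apply: lin_D; first by case: (GP _ _ (homog_scomp false z)).
  by case: (GP _ _ (homog_scomp true z)).
have aJ k z c d : homog k c -> act z (bJ c d) =
    gradext (fun p z => bJ (actJ z c) d + (-1) ^+ (p * k) *: bJ c (actJ z d)) z.
  move=> hc; rewrite /act /gradext; have [_ h0 _] := GP _ _ (homog_scomp false z).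
  by have [_ h1 _] := GP _ _ (homog_scomp true z); rewrite (h0 _ _ _ hc) (h1 _ _ _ hc).
have aM k z r s : homog k r -> act z (bM r s) =
    gradext (fun p z => bM (actM z r) s + (-1) ^+ (p * k) *: bM r (actM z s)) z.
  move=> hr; rewrite /act /gradext; have [_ _ h0] := GP _ _ (homog_scomp false z).
  by have [_ _ h1] := GP _ _ (homog_scomp true z); rewrite (h0 _ _ _ hr) (h1 _ _ _ hr).
exists act; split.
- split=> // w; move: w; apply: (pres_ind prB).
  + move=> c u v; rewrite !(linear_rules (act_lin _)); by rewrite scaler0 addr0.
  + move=> c u v lu lv d a b; rewrite !act_lin; exact: (lin_D (lin_Z c lu) lv d a b).
  + move=> i j a b ha hb c u v; rewrite !(aJ _ _ _ _ ha).
    by move: c u v; apply: lin_grad => p; linearity; exact: actJ_bilin.1.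
  + move=> i j a b ha hb c u v; rewrite !(aM _ _ _ _ ha).
    by move: c u v; apply: lin_grad => p; linearity; exact: actM_bilin.1.
- move=> p k z c d hz hc; rewrite (aJ _ _ _ _ hc).
  rewrite (gradE (f := fun p z => _ + (-1) ^+ (p * k) *: bJ c (actJ z d)) _ hz) // => l.
  by rewrite !lJl bil0l bil0r scaler0 addr0.
- move=> p k z c d hz hc; rewrite (aM _ _ _ _ hc).
  rewrite (gradE (f := fun p z => _ + (-1) ^+ (p * k) *: bM c (actM z d)) _ hz) // => l.
  by rewrite !lMl bil0l bil0r scaler0 addr0.
Qed.

Section ActionB.
Variable actB : B -> B -> B.
Hypothesis actB_bilin : bilin actB.
Hypothesis actB_J : forall p k z c d, homog p z -> homog k c -> actB z (bJ c d) =
    bJ (actJ z c) d + (-1) ^+ (p * k) *: bJ c (actJ z d).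
Hypothesis actB_M : forall p k z r s, homog p z -> homog k r -> actB z (bM r s) =
    bM (actM z r) s + (-1) ^+ (p * k) *: bM r (actM z s).

Let lBl a := linear_rules (actB_bilin.1 a).
Let lBr z := linear_rules (actB_bilin.2 z).

Lemma actB_even : even_map2 actB.
Proof.
move=> p q z w hz; move: w; have D := superder_act hz.
apply: pres_homog_ind => [|c u v hu hv|i j a b ha hb <-|i j m n hm hn <-].
- by rewrite lBr; exact: homog0.
- by rewrite !lBr; apply: homogD hv; exact: homogZ.
- rewrite (actB_J _ hz ha); apply: homogD; last apply: homogZ.
    by apply: (homog_cast (pres_evenJ prB (der_homogJ D ha) hb)); rewrite addbA.
  by apply: (homog_cast (pres_evenJ prB ha (der_homogJ D hb))); rewrite addbCA.
- rewrite (actB_M _ hz hm); apply: homogD; last apply: homogZ.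
    by apply: (homog_cast (pres_evenM prB (der_homogM D hm) hn)); rewrite addbA.
  by apply: (homog_cast (pres_evenM prB hm (der_homogM D hn))); rewrite addbCA.
Qed.

(** For a generator w this is the commutator formula of der_innerJ or der_partialJ. *)
Lemma actJ_comm p q z w c : homog p z -> homog q w ->
  actJ z (actJ w c) = actJ (actB z w) c + (-1) ^+ (p * q) *: actJ w (actJ z c).
Proof.
move=> hz hw; move: c; apply: homog_extl.
- by apply: lin_comp; exact: actJ_bilin.2.
- apply: lin_D; first exact: actJ_bilin.2.
  by apply: lin_Z; apply: lin_comp; exact: actJ_bilin.2.
have D := superder_act hz; move=> k c hc; have hzc := der_homogJ D hc.
move: w hw.
apply: pres_homog_ind => [|d u v hu hv|i j a b ha hb <-|i j m n hm hn <-].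
- by rewrite lBr !lJl lJr scaler0 addr0.
- rewrite !lBr !lJl !lJr hu hv !scalerDr !scalerA mulrC; exact: addrACA.
- rewrite (actB_J _ hz ha) !lJl (actJ_J _ ha hb) (der_innerJ D ha hb hc).
  rewrite (actJ_J _ (der_homogJ D ha) hb) (actJ_J _ ha (der_homogJ D hb)).
  by rewrite (actJ_J _ ha hb).
- rewrite (actB_M _ hz hm) !lJl (actJ_M hm hn hc) (der_partialJ D hm hn hc).
  rewrite (actJ_M (der_homogM D hm) hn hc) (actJ_M hm (der_homogM D hn) hc).
  by rewrite (actJ_M hm hn hzc).
Qed.

Lemma actM_comm p q z w r : homog p z -> homog q w ->
  actM z (actM w r) = actM (actB z w) r + (-1) ^+ (p * q) *: actM w (actM z r).
Proof.
move=> hz hw; move: r; apply: homog_extl.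
- by apply: lin_comp; exact: actM_bilin.2.
- apply: lin_D; first exact: actM_bilin.2.
  by apply: lin_Z; apply: lin_comp; exact: actM_bilin.2.
have D := superder_act hz; move=> k c hc; move: w hw.
apply: pres_homog_ind => [|d u v hu hv|i j a b ha hb <-|i j m n hm hn <-].
- by rewrite lBr !lMl lMr scaler0 addr0.
- rewrite !lBr !lMl !lMr hu hv !scalerDr !scalerA mulrC; exact: addrACA.
- rewrite (actB_J _ hz ha) !lMl (actM_J _ ha hb) (der_innerM D ha hb hc).
  rewrite (actM_J _ (der_homogJ D ha) hb) (actM_J _ ha (der_homogJ D hb)).
  by rewrite (actM_J _ ha hb).
- by rewrite (actB_M _ hz hm) !lMl !actM_M (der_partialM D hm hn hc).
Qed.

(** On a generator u both sides are computed from the actions on J and M, where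
the identity is actJ_comm or actM_comm. *)
Lemma actB_jacobi p q z w u : homog p z -> homog q w ->
  actB z (actB w u) = actB (actB z w) u + (-1) ^+ (p * q) *: actB w (actB z u).
Proof.
move=> hz hw; have Dz := superder_act hz; have Dw := superder_act hw.
move: u; apply: (pres_ind prB) => [|d u v hu hv|i j a b ha hb|i j m n hm hn].
- by rewrite !lBr scaler0 addr0.
- rewrite !lBr hu hv !scalerDr !scalerA mulrC; exact: addrACA.
- rewrite (actB_J _ hw ha) (actB_J _ hz ha) (actB_J _ (actB_even hz hw) ha) !lBr.
  rewrite (actB_J _ hz (der_homogJ Dw ha)) (actB_J _ hz ha).
  rewrite (actB_J _ hw (der_homogJ Dz ha)) (actB_J _ hw ha).
  rewrite !(actJ_comm _ hz hw) !bilE.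
  by clear ha hb hz hw; case: p Dz => _; case: q Dw => _; case: i; lin_solve K.
- rewrite (actB_M _ hw hm) (actB_M _ hz hm) (actB_M _ (actB_even hz hw) hm) !lBr.
  rewrite (actB_M _ hz (der_homogM Dw hm)) (actB_M _ hz hm).
  rewrite (actB_M _ hw (der_homogM Dz hm)) (actB_M _ hw hm).
  rewrite !(actM_comm _ hz hw) !bilE.
  by clear hm hn hz hw; case: p Dz => _; case: q Dw => _; case: i; lin_solve K.
Qed.

Lemma actB_skew p q z w : homog p z -> homog q w ->
  actB z w = - ((-1) ^+ (p * q) *: actB w z).
Proof.
move=> hz hw; move: z hz w hw.
have P0 (z w : B) c : w = 0 -> z = 0 -> w = - (c *: z).
  by move=> -> ->; rewrite scaler0 oppr0.
have PD (s c : K) (u v u' v' : B) : u = - (s *: u') -> v = - (s *: v') ->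
    c *: u + v = - (s *: (c *: u' + v')).
  by move=> -> ->; rewrite scalerDr opprD scalerN !scalerA mulrC.
apply: pres_homog_ind => [|c u v hu hv|i j a b ha hb <-|i j m n hm hn <-] w hw.
- by apply: P0; rewrite ?lBl ?lBr.
- by rewrite !lBl !lBr; apply: PD; [exact: hu|exact: hv].
- have hz := pres_evenJ prB ha hb; move: w hw.
  apply: pres_homog_ind => [|c u v hu hv|k l c d hc hd <-|k l m n hm hn <-].
  + by apply: P0; rewrite ?lBl ?lBr.
  + by rewrite !lBl !lBr; exact: PD.
  + rewrite (actB_J _ hz hc) !(actJ_J _ ha hb) (actB_J _ (pres_evenJ prB hc hd) ha).
    by rewrite !(actJ_J _ hc hd) (skew_JJ rB ha hb hc hd).
  + rewrite (actB_M _ hz hm) !(actM_J _ ha hb) (actB_J _ (pres_evenM prB hm hn) ha).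
    by rewrite (actJ_M hm hn ha) (actJ_M hm hn hb) (skew_JM rB ha hb hm hn).
- have hz := pres_evenM prB hm hn; move: w hw.
  apply: pres_homog_ind => [|c u v hu hv|k l c d hc hd <-|k l r s hr hs <-].
  + by apply: P0; rewrite ?lBl ?lBr.
  + by rewrite !lBl !lBr; exact: PD.
  + rewrite (actB_J _ hz hc) (actJ_M hm hn hc) (actJ_M hm hn hd).
    rewrite (actB_M _ (pres_evenJ prB hc hd) hm) !(actM_J _ hc hd).
    move: (skew_JM rB hc hd hm hn).
    by clear; case: i; case: j; case: k; case: l; lin_solve K.
  + rewrite (actB_M _ hz hr) !actM_M (actB_M _ (pres_evenM prB hr hs) hm) !actM_M.
    exact: (skew_MM rB hm hn hr hs).
Qed.
End ActionB.
End Action.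

(** The part of the structure of TAG(J, M) that does not involve sl_2: the
operators of the elements of B on J and M, and the bracket actB of B. *)
Record center_action (actJ : B -> J -> J) (actM : B -> M -> M) (actB : B -> B -> B)
    : Prop := CenterAction {
  act_bilinJ : bilin actJ;
  act_bilinM : bilin actM;
  act_bilinB : bilin actB;
  act_superder : forall p z, homog p z -> superder p (actJ z) (actM z);
  act_JJ : forall i j a b c, homog i a -> homog j b ->
    actJ (bJ a b) c = inner_J i j a b c;
  act_JM : forall i j a b r, homog i a -> homog j b ->
    actM (bJ a b) r = inner_M i j a b r;
  act_MJ : forall i j k m n c, homog i m -> homog j n -> homog k c ->
    actJ (bM m n) c = partial_J i j k m n c;
  act_MM : forall m n r, actM (bM m n) r = partial_M m n r;
  act_BJ : forall p k z c d, homog p z -> homog k c -> actB z (bJ c d) =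
    bJ (actJ z c) d + (-1) ^+ (p * k) *: bJ c (actJ z d);
  act_BM : forall p k z r s, homog p z -> homog k r -> actB z (bM r s) =
    bM (actM z r) s + (-1) ^+ (p * k) *: bM r (actM z s);
  act_evenB : even_map2 actB;
  act_skew : forall p q z w, homog p z -> homog q w ->
    actB z w = - ((-1) ^+ (p * q) *: actB w z);
  act_commJ : forall p q z w c, homog p z -> homog q w ->
    actJ z (actJ w c) = actJ (actB z w) c + (-1) ^+ (p * q) *: actJ w (actJ z c);
  act_commM : forall p q z w r, homog p z -> homog q w ->
    actM z (actM w r) = actM (actB z w) r + (-1) ^+ (p * q) *: actM w (actM z r);
  act_jacobi : forall p q z w u, homog p z -> homog q w ->
    actB z (actB w u) = actB (actB z w) u + (-1) ^+ (p * q) *: actB w (actB z u)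
}.

Lemma center_action_exists : exists actJ actM actB, center_action actJ actM actB.
Proof.
have [actJ [bJJ aJJ aJM]] := actJ_exists.
have [actM [bMM aMJ aMM]] := actM_exists.
have [actB [bBB aBJ aBM]] := actB_exists bJJ bMM aJJ aJM aMJ aMM.
exists actJ, actM, actB; split=> //.
- eapply superder_act; eassumption.
- eapply actB_even; eassumption.
- eapply actB_skew; eassumption.
- eapply actJ_comm; eassumption.
- eapply actM_comm; eassumption.
- eapply actB_jacobi; eassumption.
Qed.

End Center.

(** * Identities of sl_2 and its natural representation *)

Section Sl2.
Variable K : numFieldType.
Implicit Types (x y z : sl2 K) (u v w : natrep K).

Lemma ord2E (P : 'I_2 -> Prop) : P 0 -> P 1 -> forall i, P i.
Proof.
move=> P0 P1 [[|[|//]] hi].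
  by rewrite (_ : Ordinal _ = 0) //; apply/val_inj.
by rewrite (_ : Ordinal _ = 1) //; apply/val_inj.
Qed.

Lemma mul2E m n (X : 'M[K]_(m, 2)) (Y : 'M[K]_(2, n)) i j :
  (X *m Y) i j = X i 0 * Y 0 j + X i 1 * Y 1 j.
Proof.
by rewrite mxE big_ord_recl big_ord1 (_ : fintype.lift _ _ = 1) //; apply/val_inj.
Qed.

Lemma tr2E (X : 'M[K]_2) : \tr X = X 0 0 + X 1 1.
Proof.
by rewrite /mxtrace big_ord_recl big_ord1 (_ : fintype.lift _ _ = 1) //; apply/val_inj.
Qed.

Lemma sl2_tr x : x 1 1 = - x 0 0.
Proof.
by have := sl2_mxP x; rewrite unfold_in tr2E addrC addr_eq0 => /eqP.
Qed.

Lemma sl2_ext x y : x 0 0 = y 0 0 -> x 0 1 = y 0 1 -> x 1 0 = y 1 0 -> x = y.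
Proof.
move=> h0 h1 h2; apply/val_inj/matrixP => i j.
by move: j; apply: ord2E; move: i; apply: ord2E => //; rewrite /= !sl2_tr h0.
Qed.

Lemma natrep_ext v w : v 0 0 = w 0 0 -> v 1 0 = w 1 0 -> v = w.
Proof.
move=> h0 h1; apply/matrixP => i j; rewrite [j]ord1.
by move: i; apply: ord2E.
Qed.

Lemma det2E v w : det2 v w = v 0 0 * w 1 0 - v 1 0 * w 0 0.
Proof.
have h0 (i : 'I_2) : (row_mx v w : 'M[K]_2) i 0 = v i 0.
  by rewrite mxE; case: splitP => // j _; rewrite [j]ord1.
have h1 (i : 'I_2) : (row_mx v w : 'M[K]_2) i 1 = w i 0.
  by rewrite mxE; case: splitP => [[] [] //|j _]; rewrite [j]ord1.
have e1 : fintype.lift 0 0 = 1 :> 'I_2 by apply/val_inj.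
have e0 : fintype.lift 1 0 = 0 :> 'I_2 by apply/val_inj.
rewrite /det2 (expand_det_row _ 0) big_ord_recl big_ord1 e1 h0 h1.
have minor (X : 'M[K]_2) i j :
    row' i (col' j X) 0 0 = X (fintype.lift i 0) (fintype.lift j 0).
  by rewrite !mxE.
rewrite /cofactor !det_mx11 !minor e0 e1 h1 h0 /=.
by rewrite expr0 expr1 mul1r mulN1r mulrN [w 0 0 * _]mulrC.
Qed.

Lemma sl2E : (forall x y i j, (x + y) i j = x i j + y i j) *
  (forall x i j, (- x) i j = - x i j) * (forall c x i j, (c *: x) i j = c * x i j).
Proof. by split=> *; [split=> *|]; rewrite !mxE. Qed.

Lemma natE : (forall v w i j, (v + w) i j = v i j + w i j) *
  (forall v i j, (- v) i j = - v i j) * (forall c v i j, (c *: v) i j = c * v i j).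
Proof. by split=> *; [split=> *|]; rewrite !mxE. Qed.

Lemma brE x y i j : sl2_br x y i j =
  x i 0 * y 0 j + x i 1 * y 1 j - (y i 0 * x 0 j + y i 1 * x 1 j).
Proof. by rewrite /sl2_br /= mxE mul2E mxE mul2E. Qed.

Lemma sl2_natE x v i j : sl2_nat x v i j = x i 0 * v 0 j + x i 1 * v 1 j.
Proof. by rewrite /sl2_nat mul2E. Qed.

Lemma kappaE x y : kappa x y = 8 * (x 0 0 * y 0 0) + 4 * (x 0 1 * y 1 0 + x 1 0 * y 0 1).
Proof. rewrite /kappa tr2E !mul2E !sl2_tr; ring. Qed.

Lemma odotE v w : (odot v w 0 0 = - ((v 0 0 * w 1 0 + v 1 0 * w 0 0) / 2)) *
 (odot v w 0 1 = v 0 0 * w 0 0) * (odot v w 1 0 = - (v 1 0 * w 1 0)).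
Proof.
rewrite /odot !sl2E /sl2_e /sl2_f /sl2_h /= !mxE /=.
by split; [split|]; ring.
Qed.

Definition sl2_simp := (sl2E, natE, brE, sl2_natE, kappaE, odotE, det2E, sl2_tr).

(** For traceless 2 x 2 matrices xy + yx = tr(xy), and kappa is 4 times the trace form. *)
Lemma sl2_br_br x y z :
  sl2_br x (sl2_br y z) = (kappa x y / 2) *: z - (kappa x z / 2) *: y.
Proof. by apply: sl2_ext; rewrite ?sl2_simp; field. Qed.

Lemma sl2_brC x y : sl2_br x y = - sl2_br y x.
Proof. by apply: sl2_ext; rewrite ?sl2_simp; ring. Qed.

Lemma kappaC x y : kappa x y = kappa y x.
Proof. by rewrite ?sl2_simp; ring. Qed.

Lemma kappa_br x y z : kappa (sl2_br x y) z = kappa x (sl2_br y z).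
Proof. by rewrite ?sl2_simp; ring. Qed.

Lemma kappa_brC x y z : kappa y (sl2_br x z) = - kappa x (sl2_br y z).
Proof. by rewrite ?sl2_simp; ring. Qed.

(** xy = [x, y] / 2 + tr(xy) / 2. *)
Lemma sl2_nat_nat x y v : sl2_nat x (sl2_nat y v) =
  2^-1 *: sl2_nat (sl2_br x y) v + 4^-1 *: ((kappa x y / 2) *: v).
Proof. by apply: natrep_ext; rewrite ?sl2_simp; field. Qed.

Lemma odotC v w : odot v w = odot w v.
Proof. by apply: sl2_ext; rewrite ?sl2_simp; ring. Qed.

Lemma sl2_br_odot x v w :
  sl2_br x (odot v w) = odot (sl2_nat x v) w + odot v (sl2_nat x w).
Proof. by apply: sl2_ext; rewrite ?sl2_simp; field. Qed.

(** The difference of both odot terms is skew in v and w, hence a multiple of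
det(v, w). *)
Lemma odot_nat x v w :
  odot v (sl2_nat x w) = odot (sl2_nat x v) w + det2 v w *: x.
Proof. by apply: sl2_ext; rewrite ?sl2_simp; field. Qed.

Lemma det2C v w : det2 v w = - det2 w v.
Proof. by rewrite ?sl2_simp; ring. Qed.

Lemma det2_nat x v w : det2 v (sl2_nat x w) = - det2 (sl2_nat x v) w.
Proof. by rewrite ?sl2_simp; ring. Qed.

Lemma kappa_odot x v w : kappa x (odot v w) = - 4 * det2 (sl2_nat x v) w.
Proof. by rewrite ?sl2_simp; field. Qed.

Lemma sl2_nat_odot u v w : sl2_nat (odot v w) u =
  2^-1 *: (det2 v u *: w) + 2^-1 *: (det2 w u *: v).
Proof. by apply: natrep_ext; rewrite ?sl2_simp; field. Qed.

(** Cramer's rule for three vectors of a plane. *)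
Lemma det2_cyclic u v w : det2 v w *: u = det2 u w *: v - det2 u v *: w.
Proof. by apply: natrep_ext; rewrite ?sl2_simp; ring. Qed.

Lemma sl2_br_bilin : bilin (@sl2_br K).
Proof. by split=> ? c ? ?; apply: sl2_ext; rewrite ?sl2_simp; ring. Qed.

Lemma sl2_nat_bilin : bilin (@sl2_nat K).
Proof. by split=> ? c ? ?; apply: natrep_ext; rewrite ?sl2_simp; ring. Qed.

Lemma odot_bilin : bilin (@odot K).
Proof. by split=> ? c ? ?; apply: sl2_ext; rewrite ?sl2_simp; field. Qed.

Lemma kappaP c x y z : kappa (c *: x + y) z = c * kappa x z + kappa y z.
Proof. by rewrite ?sl2_simp; ring. Qed.

Lemma det2P c u v w : det2 (c *: u + v) w = c * det2 u w + det2 v w.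
Proof. by rewrite ?sl2_simp; ring. Qed.

End Sl2.

(** * The super Jacobi identity *)

Section Lie.
Variables (K : numFieldType) (A : ternary K).
Local Notation J := (tJ A).
Local Notation M := (tM A).
Local Notation hJ := jmul_even.
Local Notation hA := sact_even.
Local Notation hS := star_even.
Variables (B : superType K) (bJ : {bilinear J -> J -> B}) (bM : {bilinear M -> M -> B}).
Hypothesis prB : presents bJ bM.
Variables (actJ : B -> J -> J) (actM : B -> M -> M) (actB : B -> B -> B).
Hypothesis cB : center_action bJ bM actJ actM actB.
Variables (L : superType K) (gJ : {bilinear sl2 K -> J -> L})
  (gM : {bilinear natrep K -> M -> L}) (gB : {linear B -> L}).

Record generated_by : Prop := GeneratedBy {
  gen_homogJ : forall i x a, homog i a -> homog i (gJ x a);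
  gen_homogM : forall i v m, homog i m -> homog i (gM v m);
  gen_homogB : forall i z, homog i z -> homog i (gB z);
  gen_ind : forall P : L -> Prop, P 0 ->
    (forall c u v, P u -> P v -> P (c *: u + v)) ->
    (forall i x a, homog i a -> P (gJ x a)) ->
    (forall i v m, homog i m -> P (gM v m)) ->
    (forall i z, homog i z -> P (gB z)) -> forall u, P u
}.
Hypothesis grL : generated_by.
Let ghJ := gen_homogJ grL.
Let ghM := gen_homogM grL.
Let ghB := gen_homogB grL.

Lemma gen_homog_ind p (P : L -> Prop) : P 0 ->
  (forall c u v, P u -> P v -> P (c *: u + v)) ->
  (forall x a, homog p a -> P (gJ x a)) ->
  (forall v m, homog p m -> P (gM v m)) ->
  (forall z, homog p z -> P (gB z)) -> forall u, homog p u -> P u.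
Proof.
move=> P0 PD PJ PM PB u <-; move: u; apply: (gen_ind grL).
- by rewrite linear0.
- by move=> c u v Pu Pv; rewrite linearP; exact: PD.
- move=> i x a ha; rewrite (scomp_homog _ (ghJ x ha)).
  by case: eqP ha => // <- ha; exact: PJ.
- move=> i x a ha; rewrite (scomp_homog _ (ghM x ha)).
  by case: eqP ha => // <- ha; exact: PM.
- by move=> i x ha; rewrite (scomp_homog _ (ghB ha)); case: eqP ha => // <- ha; exact: PB.
Qed.

(** The brackets of generators of TAG(J, M). The last three fields express
super-anticommutativity between different summands. *)
Record bracket_on (br : L -> L -> L) : Prop := BracketOn {
  br_bilin : bilin br;
  br_JJ : forall x y a b, br (gJ x a) (gJ y b) =
    gJ (sl2_br x y) (a · b) + (kappa x y / 2) *: gB (bJ a b);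
  br_JM : forall x v a m, br (gJ x a) (gM v m) = gM (sl2_nat x v) (a • m);
  br_MM : forall v w m n, br (gM v m) (gM w n) =
    gJ (odot v w) (m ⋆ n) + det2 v w *: gB (bM m n);
  br_BJ : forall z x a, br (gB z) (gJ x a) = gJ x (actJ z a);
  br_BM : forall z v m, br (gB z) (gM v m) = gM v (actM z m);
  br_BB : forall z w, br (gB z) (gB w) = gB (actB z w);
  br_MJ : forall i j x v a m, homog i a -> homog j m ->
    br (gM v m) (gJ x a) = - ((-1) ^+ (j * i) *: gM (sl2_nat x v) (a • m));
  br_JB : forall p i z x a, homog p z -> homog i a ->
    br (gJ x a) (gB z) = - ((-1) ^+ (i * p) *: gJ x (actJ z a));
  br_MB : forall p i z v m, homog p z -> homog i m ->
    br (gM v m) (gB z) = - ((-1) ^+ (i * p) *: gM v (actM z m))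
}.

Variable br : L -> L -> L.
Hypothesis brP : bracket_on br.
Let brl x := linear_rules ((br_bilin brP).1 x).
Let brr x := linear_rules ((br_bilin brP).2 x).
Let gE := (bilE gJ, bilE gM, linear_rules (lin_map gB)).
Let bE := (bilE bJ, bilE bM).

Lemma br_even : even_map2 br.
Proof.
move=> i j x y hx; move: y; move: x hx.
apply: gen_homog_ind => [|c u v hu hv|x a ha|x m hm|z hz] y hy.
- by rewrite brl; exact: homog0.
- by rewrite !brl; apply: homogD; [apply/homogZ/hu|apply/hv].
all: move: y hy; apply: gen_homog_ind => [|c u v hu hv|y b hb|y n hn|w hw];
  rewrite ?brr; try exact: homog0; try by apply: homogD => //; exact: homogZ.
- rewrite (br_JJ brP); apply: homogD; first exact/ghJ/hJ.
  exact/homogZ/ghB/(pres_evenJ prB).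
- by rewrite (br_JM brP); exact/ghM/hA.
- rewrite (br_JB brP _ hw ha); apply/homogN/homogZ/ghJ; rewrite addbC.
  exact: (der_homogJ (act_superder cB hw)).
- rewrite (br_MJ brP _ _ hb hm); apply/homogN/homogZ/ghM; rewrite addbC.
  exact: hA.
- rewrite (br_MM brP); apply: homogD; first exact/ghJ/hS.
  exact/homogZ/ghB/(pres_evenM prB).
- rewrite (br_MB brP _ hw hm); apply/homogN/homogZ/ghM; rewrite addbC.
  exact: (der_homogM (act_superder cB hw)).
- rewrite (br_BJ brP); exact/ghJ/(der_homogJ (act_superder cB hz)).
- rewrite (br_BM brP); exact/ghM/(der_homogM (act_superder cB hz)).
- by rewrite (br_BB brP); exact/ghB/(act_evenB cB).
Qed.

Let rel := pres_rel prB.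

Lemma br_skew i j x y : homog i x -> homog j y ->
  br x y = - ((-1) ^+ (i * j) *: br y x).
Proof.
have P0 (z w : L) c : w = 0 -> z = 0 -> w = - (c *: z).
  by move=> -> ->; rewrite scaler0 oppr0.
have PD (s c : K) (u v u' v' : L) : u = - (s *: u') -> v = - (s *: v') ->
    c *: u + v = - (s *: (c *: u' + v')).
  by move=> -> ->; rewrite scalerDr opprD scalerN !scalerA mulrC.
have PN s (u v : L) : u = - ((-1) ^+ s *: v) -> v = - ((-1) ^+ s *: u).
  by move=> ->; rewrite scalerN opprK scalerA -expr2 sqrr_sign scale1r.
move=> hx; move: y; move: x hx.
apply: gen_homog_ind => [|c u v hu hv|x a ha|x m hm|z hz] y hy.
- by apply: P0; rewrite ?brl ?brr.
- by rewrite !brl !brr; apply: PD; [exact: hu|exact: hv].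
all: move: y hy; apply: gen_homog_ind => [|c u v hu hv|y b hb|y n hn|w hw].
all: try by (apply: P0; rewrite ?brl ?brr).
all: try by (rewrite !brl !brr; exact: PD).
- rewrite !(br_JJ brP) (sl2_brC x) (kappaC x) (jmulC ha hb) !gE.
  move: (congr1 gB (rel_J rel ha hb)); rewrite !gE => /eqP.
  rewrite addr_eq0 => /eqP ->; rewrite !scalerDr !scalerN opprD; congr (_ + _).
  by rewrite !scalerA mulrC.
- by rewrite (br_JM brP) mulnC; apply: PN; rewrite (br_MJ brP _ _ ha hn).
- by rewrite (br_JB brP _ hw ha) (br_BJ brP).
- by rewrite (br_MJ brP _ _ hb hm) (br_JM brP).
- rewrite !(br_MM brP) odotC (det2C x) (starC hm hn); move: (odot y x) => P; rewrite !gE.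
  move: (congr1 gB (rel_M rel hm hn)); rewrite !gE => /eqP.
  rewrite subr_eq0 => /eqP ->; rewrite scalerDr opprD; congr (_ + _).
  by rewrite scaleNr !scalerA mulrC.
- by rewrite (br_MB brP _ hw hm) (br_BM brP).
- by rewrite (br_BJ brP) mulnC; apply: PN; rewrite (br_JB brP _ hz hb).
- by rewrite (br_BM brP) mulnC; apply: PN; rewrite (br_MB brP _ hz hn).
- by rewrite !(br_BB brP) (act_skew cB hz hw) !gE.
Qed.

Definition jacobi_at i j x y z :=
  br x (br y z) = br (br x y) z + (-1) ^+ (i * j) *: br y (br x z).

(** Super-anticommutativity makes the Jacobi identity symmetric in its
arguments; it is then enough to treat generators in the order B, J, M. *)
Lemma jacobi_swap12 i j x y z : homog i x -> homog j y ->
  jacobi_at i j x y z -> jacobi_at j i y x z.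
Proof.
rewrite /jacobi_at => hx hy H; move: (congr1 (br^~ z) (br_skew hx hy)) H.
rewrite /= !brl.
by clear hx hy; case: i; case: j; lin_solve K.
Qed.

Lemma jacobi_swap23 i j k x y z : homog i x -> homog j y -> homog k z ->
  jacobi_at i j x y z -> jacobi_at i k x z y.
Proof.
rewrite /jacobi_at => hx hy hz H.
move: (congr1 (br x) (br_skew hy hz)) H (br_skew hy (br_even hx hz))
  (br_skew hz (br_even hx hy)).
rewrite /= !brr.
by clear hx hy hz; case: i; case: j; case: k; lin_solve K.
Qed.

(* Moves the scalars that depend on sl_2 inside, next to the generators. *)
Let pull (V : lmodType K) (c d : K) (v : V) : c *: (d *: v) = d *: (c *: v).
Proof. by rewrite !scalerA mulrC. Qed.

Lemma jacobi_BBJ i j z w x a : homog i z -> homog j w ->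
  jacobi_at i j (gB z) (gB w) (gJ x a).
Proof.
move=> hz hw; rewrite /jacobi_at !(br_BJ brP) (br_BB brP) (br_BJ brP).
by rewrite (act_commJ cB _ hz hw) !gE.
Qed.

Lemma jacobi_BBM i j z w v m : homog i z -> homog j w ->
  jacobi_at i j (gB z) (gB w) (gM v m).
Proof.
move=> hz hw; rewrite /jacobi_at !(br_BM brP) (br_BB brP) (br_BM brP).
by rewrite (act_commM cB _ hz hw) !gE.
Qed.

Lemma jacobi_BBB i j z w u : homog i z -> homog j w ->
  jacobi_at i j (gB z) (gB w) (gB u).
Proof.
move=> hz hw; rewrite /jacobi_at !(br_BB brP).
by rewrite (act_jacobi cB _ hz hw) !gE.
Qed.

Lemma jacobi_BJJ i j k z x y a b : homog i z -> homog j a -> homog k b ->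
  jacobi_at i j (gB z) (gJ x a) (gJ y b).
Proof.
move=> hz ha hb; rewrite /jacobi_at (br_JJ brP) brr brr (br_BB brP) !(br_BJ brP).
rewrite !(br_JJ brP) (act_BJ cB _ hz ha) (der_mul (act_superder cB hz) ha hb).
rewrite !gE; move: (kappa x y / 2) => c; rewrite !scalerDr !(pull c).
by clear hz ha hb; case: i; case: j; lin_solve K.
Qed.

Lemma jacobi_BJM i j k z x v a m : homog i z -> homog j a -> homog k m ->
  jacobi_at i j (gB z) (gJ x a) (gM v m).
Proof.
move=> hz ha hm; rewrite /jacobi_at (br_JM brP) (br_BJ brP) !(br_BM brP) !(br_JM brP).
by rewrite (der_act (act_superder cB hz) ha hm) !gE.
Qed.

Lemma jacobi_BMM i j k z v w m n : homog i z -> homog j m -> homog k n ->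
  jacobi_at i j (gB z) (gM v m) (gM w n).
Proof.
move=> hz hm hn; rewrite /jacobi_at (br_MM brP) brr brr (br_BB brP) !(br_BM brP).
rewrite (br_BJ brP) !(br_MM brP) (act_BM cB _ hz hm) (der_star (act_superder cB hz) hm hn).
move: (odot v w) => P; rewrite !gE; move: (det2 v w) => c; rewrite !scalerDr !(pull c).
by clear hz hm hn; case: i; case: j; lin_solve K.
Qed.

(** By sl2_br_br the coefficients of x, y and z are the definitions of the three
operators <b, c>, <a, c> and <a, b>; the component in B is a multiple of
I_{a,b,c} by the invariance of kappa. *)
Lemma jacobi_JJJ i j k x y z a b c : homog i a -> homog j b -> homog k c ->
  jacobi_at i j (gJ x a) (gJ y b) (gJ z c).
Proof.
move=> ha hb hc; rewrite /jacobi_at !(br_JJ brP) !brr !brl !(br_JJ brP).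
rewrite (br_JB brP _ (pres_evenJ prB hb hc) ha) (br_JB brP _ (pres_evenJ prB ha hc) hb).
rewrite (br_BJ brP) (act_JJ cB _ ha hb) (act_JJ cB _ hb hc) (act_JJ cB _ ha hc).
rewrite kappa_br (kappa_brC x) (sl2_brC (sl2_br x y) z) !sl2_br_br.
rewrite (kappaC z x) (kappaC z y) (kappaC y x) mulNr scaleNr /inner_J.
rewrite (jmulC (hJ ha hb) hc) (jmulC hc ha) (jmulC hb ha) (jmulC hc hb) ?(opE A) !gE.
have scaled (u : B) : u = 0 -> (kappa x (sl2_br y z) / 2) *: gB u = 0.
  by move=> ->; rewrite linear0 scaler0.
move: (scaled _ (rel_JJJ rel ha hb hc)) (scaled _ (rel_J rel ha (hJ hb hc)))
  (scaled _ (rel_J rel hb (hJ ha hc))) => {scaled}.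
rewrite (jmulC hc ha) ?bE !gE.
move: (kappa x y / 2) (kappa x z / 2) (kappa y z / 2) (kappa x _ / 2) => c1 c2 c3 c4.
rewrite !(scalerDr, scalerN, scaler0) !(pull c1) !(pull c2) !(pull c3) !(pull c4).
by clear ha hb hc; case: i; case: j; case: k; lin_solve K.
Qed.

(** By sl2_nat_nat the identity splits into the module axiom, with coefficient
[x, y], and the definition of <a, b> on M, with coefficient kappa(x, y). *)
Lemma jacobi_JJM i j k x y v a b m : homog i a -> homog j b -> homog k m ->
  jacobi_at i j (gJ x a) (gJ y b) (gM v m).
Proof.
move=> ha hb hm; rewrite /jacobi_at (br_JJ brP) !(br_JM brP) brl !(br_JM brP).
rewrite brl (br_BM brP) (act_JM cB _ ha hb) (sact_special _ ha hb).
rewrite !sl2_nat_nat (sl2_brC y x) (kappaC y x) (linear_rules ((sl2_nat_bilin K).1 v)).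
rewrite /inner_M ?(opE A) !gE.
move: (kappa x y / 2) => c1.
rewrite !(scalerDr, scalerN) !(pull c1).
by clear ha hb hm; case: i; case: j; lin_solve K.
Qed.

(** The component in sl_2 (x) J splits into sjt1 and the definition of
partial_{m,n} on J, with coefficient det(v, w) x; the component in B is
I_{a,m,n}. *)
Lemma jacobi_JMM i j k x v w a m n : homog i a -> homog j m -> homog k n ->
  jacobi_at i j (gJ x a) (gM v m) (gM w n).
Proof.
move=> ha hm hn; rewrite /jacobi_at (br_MM brP) !(br_JM brP) !brr !(br_JJ brP).
rewrite (br_JB brP _ (pres_evenM prB hm hn) ha) !(br_MM brP) (act_MJ cB hm hn ha).
rewrite sl2_br_odot kappa_odot odot_nat det2_nat (sjt1 ha hm hn) /partial_J.
have -> : - 4 * det2 (sl2_nat x v) w / 2 = - (2 * det2 (sl2_nat x v) w) by field.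
have scaled (u : B) : u = 0 -> det2 (sl2_nat x v) w *: gB u = 0.
  by move=> ->; rewrite linear0 scaler0.
move: (scaled _ (rel_JMM rel ha hm hn)) (scaled _ (rel_J rel ha (hS hm hn))) => {scaled}.
move: (odot _ w) (det2 (sl2_nat x v) w) (det2 v w) => P c1 c2.
rewrite ?(opE A) ?bE !gE !scaleNr -?scalerA.
rewrite !(scalerDr, scalerN) !(pull c1) !(pull c2).
by clear ha hm hn; case: i; case: j; case: k; lin_solve K.
Qed.

(** Once u is eliminated, the coefficients of v and of w are identities between
star terms and triple products that follow from sjt3 and sjt4. *)
Lemma jacobi_MMM i j k u v w m n r : homog i m -> homog j n -> homog k r ->
  jacobi_at i j (gM u m) (gM v n) (gM w r).
Proof.
move=> hm hn hr; rewrite /jacobi_at !(br_MM brP) !brr !brl !(br_JM brP).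
rewrite (br_MJ brP _ _ (hS hn hr) hm) (br_MJ brP _ _ (hS hm hr) hn).
rewrite (br_MB brP _ (pres_evenM prB hn hr) hm) (br_MB brP _ (pres_evenM prB hm hr) hn).
rewrite (br_BM brP) !(act_MM cB) !sl2_nat_odot.
rewrite (det2C w v) (det2C v u) (det2C w u).
have e X : det2 v w *: gM u X = det2 u w *: gM v X - det2 u v *: gM w X.
  by rewrite -!bilZl det2_cyclic bilDl bilNl.
have scaled (X Y : M) : X = Y -> (det2 u w *: gM v X = det2 u w *: gM v Y) *
    (det2 u v *: gM w X = det2 u v *: gM w Y) by move=> ->.
have [a1 a2] := scaled _ _ (sjt3 hm hn hr).
have [b1 b2] := scaled _ _ (sjt4 m hr hn).
have [c1 c2] := scaled _ _ (sjt3 hn hr hm).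
move: a1 a2 b1 b2 c1 c2 e; rewrite /partial_M (starC hr hn) (starC hn hm) ?(opE A) !gE.
move: (det2 u v) (det2 u w) (det2 v w) => d1 d2 d3.
rewrite ?scaleNr !(scalerDr, scalerN, scaleNr) !(pull d1) !(pull d2) !(pull d3).
move=> + + + + + + e.
rewrite !e !(scalerDr, scalerN, scaleNr).
by clear scaled hm hn hr e; case: i; case: j; case: k; lin_solve K.
Qed.

Lemma jacobi_lin1 i j c u v y z : jacobi_at i j u y z -> jacobi_at i j v y z ->
  jacobi_at i j (c *: u + v) y z.
Proof.
rewrite /jacobi_at !brl !brr => -> ->.
by rewrite !scalerDr (pull c) addrACA.
Qed.

Lemma jacobi_lin2 i j c x u v z : jacobi_at i j x u z -> jacobi_at i j x v z ->
  jacobi_at i j x (c *: u + v) z.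
Proof.
rewrite /jacobi_at !brl !brr !brl => -> ->.
by rewrite !scalerDr (pull c) addrACA.
Qed.

Lemma jacobi_lin3 i j c x y u v : jacobi_at i j x y u -> jacobi_at i j x y v ->
  jacobi_at i j x y (c *: u + v).
Proof.
rewrite /jacobi_at !brr => -> ->.
by rewrite !scalerDr (pull c) addrACA.
Qed.

Ltac sorted_jacobi :=
  first [ eapply jacobi_BBB | eapply jacobi_BBJ | eapply jacobi_BBM
  | eapply jacobi_BJJ | eapply jacobi_BJM | eapply jacobi_BMM
  | eapply jacobi_JJJ | eapply jacobi_JJM | eapply jacobi_JMM | eapply jacobi_MMM ];
  eassumption.
Ltac swap12 := eapply jacobi_swap12; [eassumption | eassumption | ].
Ltac swap23 := eapply jacobi_swap23; [eassumption | eassumption | eassumption | ].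

Theorem br_jacobi i j x y z : homog i x -> homog j y -> jacobi_at i j x y z.
Proof.
have zero1 i' j' y' z' : jacobi_at i' j' 0 y' z'.
  by rewrite /jacobi_at ?brl ?brr ?brl ?brr scaler0 addr0.
have zero2 i' j' x' z' : jacobi_at i' j' x' 0 z'.
  by rewrite /jacobi_at ?brl ?brr ?brl ?brr scaler0 addr0.
have zero3 i' j' x' y' : jacobi_at i' j' x' y' 0.
  by rewrite /jacobi_at !brr scaler0 addr0.
move=> hx; move: y; move: x hx.
apply: gen_homog_ind => [|c u v hu hv|x a ha|x m hm|d hd] y hy; first exact: zero1.
  by apply: jacobi_lin1; [exact: hu|exact: hv].
all: [> have hx := ghJ x ha | have hx := ghM x hm | have hx := ghB hd].
all: move: y hy; apply: gen_homog_ind => [|c u v hu hv|y b hb|y n hn|e he];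
  [exact: zero2 | exact: jacobi_lin2 | have hy := ghJ y hb | have hy := ghM y hn
  | have hy := ghB he].
all: move: z; apply: (gen_ind grL) => [|c u v hu hv|k z c hc|k z r hr|k f hf];
  [exact: zero3 | exact: jacobi_lin3 | have hz := ghJ z hc | have hz := ghM z hr
  | have hz := ghB hf].
(* At most three transpositions sort the types of the generators. *)
all: first [ sorted_jacobi | swap12; sorted_jacobi | swap23; sorted_jacobi
  | swap12; swap23; sorted_jacobi | swap23; swap12; sorted_jacobi
  | swap12; swap23; swap12; sorted_jacobi ].
Qed.

Record sl2_action (act : sl2 K -> L -> L) : Prop := Sl2Action {
  sl2_act_bilin : bilin act;
  sl2_actJ : forall x y a, act x (gJ y a) = gJ (sl2_br x y) a;
  sl2_actM : forall x v m, act x (gM v m) = gM (sl2_nat x v) m;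
  sl2_actB : forall x z, act x (gB z) = 0
}.

Variable act : sl2 K -> L -> L.
Hypothesis actP : sl2_action act.
Let actl x := linear_rules ((sl2_act_bilin actP).1 x).
Let actr x := linear_rules ((sl2_act_bilin actP).2 x).

Lemma sl2_act_even x : even_map (act x).
Proof.
move=> i; apply: gen_homog_ind => [|c u v hu hv|y a ha|v m hm|z hz].
- by rewrite actr; exact: homog0.
- by rewrite !actr; apply: homogD => //; exact: homogZ.
- by rewrite (sl2_actJ actP); exact: ghJ.
- by rewrite (sl2_actM actP); exact: ghM.
- by rewrite (sl2_actB actP); exact: homog0.
Qed.

Lemma sl2_act_br x y u : act (sl2_br x y) u = act x (act y u) - act y (act x u).
Proof.
move: u; apply: (gen_ind grL) => [|c u v hu hv|i z a _|i v m _|i z _].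
- by rewrite !actr subr0.
- by rewrite !actr hu hv scalerBr opprD addrACA.
- rewrite !(sl2_actJ actP) (sl2_brC (sl2_br x y)) !sl2_br_br (kappaC z x) (kappaC z y).
  rewrite (kappaC y x) !gE.
  move: (kappa _ _ / 2) (kappa _ _ / 2) (kappa _ _ / 2) => c1 c2 c3.
  by lin_solve K.
- rewrite !(sl2_actM actP) !sl2_nat_nat (sl2_brC y x) (kappaC y x).
  rewrite (linear_rules ((sl2_nat_bilin K).1 v)) !gE.
  move: (kappa _ _ / 2) => c1; lin_solve K.
- by rewrite !(sl2_actB actP) !actr subr0.
Qed.

Lemma sl2_act_der x u w : act x (br u w) = br (act x u) w + br u (act x w).
Proof.
move: w; move: u; apply: (gen_ind grL) => [|c u v hu hv|i y a ha|i v m hm|i z hz] w.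
- by rewrite !(brl, actr) addr0.
- by rewrite !(brl, actr) hu hv scalerDr addrACA.
all: move: w; apply: (gen_ind grL) => [|d u u' hu hu'|j y' b hb|j v' n hn|j z' hz'].
all: try by rewrite !(brr, actr) addr0.
all: try by rewrite !(brr, actr) hu hu' scalerDr addrACA.
- rewrite !(sl2_actJ actP) !(br_JJ brP) !actr (sl2_actJ actP) (sl2_actB actP) scaler0.
  rewrite kappa_br kappa_brC (sl2_brC (sl2_br x y)) !sl2_br_br (kappaC y' x) (kappaC y' y).
  rewrite (kappaC y x) mulNr scaleNr !gE.
  move: (kappa _ _ / 2) (kappa _ _ / 2) (kappa _ _ / 2) (kappa _ _ / 2) => c1 c2 c3 c4.
  by lin_solve K.
- rewrite !(sl2_actJ actP) !(sl2_actM actP) !(br_JM brP) (sl2_actM actP) !sl2_nat_nat.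
  rewrite (sl2_brC y x) (kappaC y x) (linear_rules ((sl2_nat_bilin K).1 v')) !gE.
  move: (kappa _ _ / 2) => c1; lin_solve K.
- rewrite (br_JB brP _ hz' ha) (sl2_actB actP) !actr !(sl2_actJ actP) brr addr0.
  by rewrite (br_JB brP _ hz' ha).
- rewrite (br_MJ brP _ _ hb hm) !actr !(sl2_actM actP) (sl2_actJ actP).
  rewrite !(br_MJ brP _ _ hb hm) !sl2_nat_nat.
  rewrite (sl2_brC y' x) (kappaC y' x) (linear_rules ((sl2_nat_bilin K).1 v)) !gE.
  rewrite !(scalerDr, scalerN); move: (kappa _ _ / 2) => c1; rewrite ?(pull c1).
  by clear hm hb; case: i; case: j; lin_solve K.
- rewrite !(br_MM brP) !actr (sl2_actJ actP) (sl2_actB actP) !(sl2_actM actP) scaler0.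
  rewrite !(br_MM brP) sl2_br_odot det2_nat scaleNr.
  move: (odot _ v') (odot v _) => P Q; rewrite !gE; move: (det2 _ _) => c1.
  by lin_solve K.
- rewrite (br_MB brP _ hz' hm) (sl2_actB actP) !actr !(sl2_actM actP) brr addr0.
  by rewrite (br_MB brP _ hz' hm).
- by rewrite (br_BJ brP) (sl2_actB actP) !(sl2_actJ actP) (br_BJ brP) brl add0r.
- by rewrite (br_BM brP) (sl2_actB actP) !(sl2_actM actP) (br_BM brP) brl add0r.
- by rewrite (br_BB brP) !(sl2_actB actP) brl brr addr0.
Qed.
End Lie.

(** * Existence of the bracket *)

Section TensorSpec.
Variable K : fieldType.

(** The universal property of the tensor product, with generation by
homogeneous pure tensors. *)
Record is_tensor (U V T : superType K) (t : {bilinear U -> V -> T}) : Prop := IsTensor {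
  ten_even : even_map2 t;
  ten_ind : forall P : T -> Prop, P 0 ->
    (forall c u v, P u -> P v -> P (c *: u + v)) ->
    (forall i j u v, homog i u -> homog j v -> P (t u v)) -> forall x, P x;
  ten_lift : forall (W : lmodType K) (f : U -> V -> W), bilin f ->
    exists2 F : T -> W, linear F & forall u v, F (t u v) = f u v
}.

Lemma ten_lift1 (U V T : superType K) (t : {bilinear U -> V -> T}) (Z W : lmodType K)
    (g : Z -> U -> V -> W) : is_tensor t ->
  (forall z, bilin (g z)) -> (forall u v, linear (fun z => g z u v)) ->
  exists2 G : Z -> T -> W, bilin G & forall z u v, G z (t u v) = g z u v.
Proof.
move=> tT bg lg; have E z : exists F : T -> W, linear F /\ forall u v, F (t u v) = g z u v.
  by have [F lF FE] := ten_lift tT (bg z); exists F.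
have [G GP] := choice E; exists G => [|z]; last by case: (GP z).
have lG z : linear (G z) by case: (GP z).
have GE z u v : G z (t u v) = g z u v by case: (GP z).
split=> //; apply: (ten_ind tT) => [c u v|c u v hu hv d z z'|i j u v _ _ c z z'].
- by rewrite !(linear_rules (lG _)) scaler0 addr0.
- by rewrite !lG hu hv !scalerDr !scalerA mulrC addrACA.
- by rewrite !GE lg.
Qed.

(** One lifts in the last two variables, then in the first two; linearity
survives the first step because T' is spanned by pure tensors. *)
Lemma ten_lift2 (U V T U' V' T' : superType K) (t : {bilinear U -> V -> T})
    (t' : {bilinear U' -> V' -> T'}) (W : lmodType K) (g : U -> V -> U' -> V' -> W) :
  is_tensor t -> is_tensor t' ->
  (forall u v, bilin (g u v)) -> (forall u' v', bilin (fun u v => g u v u' v')) ->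
  exists2 G : T -> T' -> W, bilin G &
    forall u v u' v', G (t u v) (t' u' v') = g u v u' v'.
Proof.
move=> tT tT' bg bg'.
have E (p : U * V) : exists F : T' -> W, linear F /\ forall u v, F (t' u v) = g p.1 p.2 u v.
  by have [F lF FE] := ten_lift tT' (bg p.1 p.2); exists F.
have [F FP] := choice E; pose G s u v := F (u, v) s.
have lG u v : linear (fun s => G s u v) by have [h _] := FP (u, v); exact: h.
have GE u v u' v' : G (t' u' v') u v = g u v u' v' by have [_ h] := FP (u, v); exact: h.
have bG s : bilin (G s).
  move: s; apply: (ten_ind tT') => [|c s s' hs hs'|i j u' v' _ _].
  - by split=> ? c ? ?; rewrite !(linear_rules (lG _ _)) scaler0 addr0.
  - split=> w d u u'; rewrite !lG.
      by rewrite (hs.1 w) (hs'.1 w) !scalerDr !scalerA mulrC addrACA.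
    by rewrite (hs.2 w) (hs'.2 w) !scalerDr !scalerA mulrC addrACA.
  - have [h1 h2] := bg' u' v'.
    by split=> w d u u''; rewrite !GE; [exact: h1|exact: h2].
have [H [H1 H2] HE] := ten_lift1 tT bG lG; exists (fun s s' => H s' s).
  by split; [exact: H2 | exact: H1].
by move=> u v u' v'; rewrite HE.
Qed.
End TensorSpec.

Ltac biadditive bf l r :=
  first [ exact: (lin_bilin_l _ bf l) | exact: (lin_bilin_r _ bf r) ].

Ltac pair_eq :=
  congr (_, _); [congr (_, _)|];
  rewrite /= ?(scaler0, oppr0, subr0, addr0, add0r, sub0r).

Section Assemble.
Variables (K : numFieldType) (A : ternary K).
Local Notation J := (tJ A).
Local Notation M := (tM A).
Variables (T1 T2 B : superType K) (t1 : {bilinear sl2 K -> J -> T1})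
  (t2 : {bilinear natrep K -> M -> T2}).
Hypothesis tT1 : is_tensor t1.
Hypothesis tT2 : is_tensor t2.
Variables (bJ : {bilinear J -> J -> B}) (bM : {bilinear M -> M -> B}).
Hypothesis prB : presents bJ bM.
Local Notation L := (T1 * T2 * B)%type.

Definition injJ (x : sl2 K) (a : J) : L := (t1 x a, 0, 0).
Definition injM (v : natrep K) (m : M) : L := (0, t2 v m, 0).
Definition injB (z : B) : L := (0, 0, z).

Lemma injJ_bilin : bilin injJ.
Proof.
split=> w c u v; rewrite /injJ ?bilinPl ?bilinPr; congr (_, _);
  rewrite /= ?scaler0 ?addr0 //; congr (_, _); by rewrite /= ?scaler0 ?addr0.
Qed.
Lemma injM_bilin : bilin injM.
Proof.
split=> w c u v; rewrite /injM ?bilinPl ?bilinPr; congr (_, _);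
  rewrite /= ?scaler0 ?addr0 //; congr (_, _); by rewrite /= ?scaler0 ?addr0.
Qed.
Lemma injB_linear : linear injB.
Proof.
move=> c u v; rewrite /injB; congr (_, _);
  rewrite /= ?scaler0 ?addr0 //; congr (_, _); by rewrite /= ?scaler0 ?addr0.
Qed.

Definition genJ : {bilinear sl2 K -> J -> L} := bilinear_of injJ_bilin.
Definition genM : {bilinear natrep K -> M -> L} := bilinear_of injM_bilin.
Definition genB : {linear B -> L} := linear_of injB_linear.

Lemma generated_sum : generated_by genJ genM genB.
Proof.
split.
- move=> i x a ha; apply/homog_inl/homog_inl.
  exact: (homog_cast (ten_even tT1 (erefl x : homog false x) ha)).
- move=> i v m hm; apply/homog_inl/homog_inr.
  exact: (homog_cast (ten_even tT2 (erefl v : homog false v) hm)).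
- by move=> i z hz; apply/homog_inr.
- move=> P P0 PD PJ PM PB [[s t] z].
  have PA u v : P u -> P v -> P (u + v) by rewrite -{2}[u]scale1r; exact: PD.
  have -> : ((s, t), z) = (((s, 0) , 0) : L) + (((0, t), 0) : L) + (((0, 0), z) : L).
    by pair_eq.
  apply: (PA); first apply: (PA).
  + move: s; apply: (ten_ind tT1) => // [c u v Pu Pv|j i x a _ ha]; last exact: PJ ha.
    have -> : (c *: u + v, 0, 0) = c *: (((u, 0), 0) : L) + (((v, 0), 0) : L).
      by pair_eq.
    exact: PD.
  + move: t; apply: (ten_ind tT2) => // [c u v Pu Pv|j i x a _ ha]; last exact: PM ha.
    have -> : (0, c *: u + v, 0) = c *: (((0, u), 0) : L) + (((0, v), 0) : L).
      by pair_eq.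
    exact: PD.
  + rewrite -[z]scomp_sum -[(_, _)]/(genB _) linearD.
    by apply: PA; apply: PB (homog_scomp _ _).
Qed.

(** The map f with its arguments exchanged, with the Koszul sign. *)
Definition flip (U V : superType K) (W : lmodType K) (f : U -> V -> W) : V -> U -> W :=
  sext (fun i j v u => (-1) ^+ (i * j) *: f u v).

Lemma flip_pre_bilin (U V W : lmodType K) (f : U -> V -> W) (c : K) : bilin f ->
  bilin (fun v u => c *: f u v).
Proof. by case=> hl hr; split=> w; apply: lin_Z; [exact: hr|exact: hl]. Qed.

Lemma flip_bilin (U V : superType K) (W : lmodType K) (f : U -> V -> W) :
  bilin f -> bilin (flip f).
Proof. by move=> bf; apply: sext_bilin => i j; exact: flip_pre_bilin. Qed.

Lemma flipE (U V : superType K) (W : lmodType K) (f : U -> V -> W) i j u v :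
  bilin f -> homog i u -> homog j v -> flip f v u = (-1) ^+ (j * i) *: f u v.
Proof.
move=> bf hu hv; rewrite /flip (sextE _ hv hu) // => k l; exact: flip_pre_bilin.
Qed.

Lemma lin_pair (U V W : lmodType K) (f : U -> V) (g : U -> W) :
  linear f -> linear g -> linear (fun u => (f u, g u)).
Proof. by move=> lf lg c u v; rewrite lf lg. Qed.

(** Every component of the bracket is lifted from the tensor factors. A bracket
of two different summands is lifted in one order and flipped in the other,
which makes it super-anticommutative by construction. *)
Lemma bracket_exists actJ actM actB : center_action bJ bM actJ actM actB ->
  exists br, bracket_on bJ bM actJ actM actB genJ genM genB br.
Proof.
move=> cB; have bsl := sl2_br_bilin K; have bnat := sl2_nat_bilin K.
have bod := odot_bilin K.
have bact := act_bilinJ cB; have bactM := act_bilinM cB; have bactB := act_bilinB cB.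
have [JJ bJJ JJE] : exists2 G : T1 -> T1 -> T1, bilin G &
    forall x a y b, G (t1 x a) (t1 y b) = t1 (sl2_br x y) (a · b).
  apply: (ten_lift2 (g := fun x a y b => t1 (sl2_br x y) (a · b))) => // x a.
    by split=> y; [apply: lin_bill; exact: bsl.2 | linearity].
  by split=> y; [apply: lin_bill; exact: bsl.1 | linearity].
have [JJB bJJB JJBE] : exists2 G : T1 -> T1 -> B, bilin G &
    forall x a y b, G (t1 x a) (t1 y b) = (kappa x y / 2) *: bJ a b.
  apply: (ten_lift2 (g := fun x a y b => (kappa x y / 2) *: bJ a b)) => // x a.
    split=> y; last by linearity.
    move=> c u v; rewrite kappaC kappaP !(kappaC _ x) mulrDl -mulrA.
    by rewrite scalerDl scalerA.
  split=> y; last by linearity.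
  by move=> c u v; rewrite kappaP mulrDl -mulrA scalerDl scalerA.
have [JM bJM JME] : exists2 G : T1 -> T2 -> T2, bilin G &
    forall x a v m, G (t1 x a) (t2 v m) = t2 (sl2_nat x v) (a • m).
  apply: (ten_lift2 (g := fun x a v m => t2 (sl2_nat x v) (a • m))) => // x a.
    by split=> y; [apply: lin_bill; exact: bnat.2 | linearity].
  by split=> y; [apply: lin_bill; exact: bnat.1 | linearity].
have [MM bMM MME] : exists2 G : T2 -> T2 -> T1, bilin G &
    forall v m w n, G (t2 v m) (t2 w n) = t1 (odot v w) (m ⋆ n).
  apply: (ten_lift2 (g := fun v m w n => t1 (odot v w) (m ⋆ n))) => // x a.
    by split=> y; [apply: lin_bill; exact: bod.2 | linearity].
  by split=> y; [apply: lin_bill; exact: bod.1 | linearity].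
have [MMB bMMB MMBE] : exists2 G : T2 -> T2 -> B, bilin G &
    forall v m w n, G (t2 v m) (t2 w n) = det2 v w *: bM m n.
  apply: (ten_lift2 (g := fun v m w n => det2 v w *: bM m n)) => // x a.
    split=> y; last by linearity.
    move=> c u v; rewrite det2C det2P !(det2C x) opprD scalerDl -mulrN.
    by rewrite scalerA.
  split=> y; last by linearity.
  by move=> c u v; rewrite det2P scalerDl scalerA.
have [BJ bBJ BJE] : exists2 G : B -> T1 -> T1, bilin G &
    forall z x a, G z (t1 x a) = t1 x (actJ z a).
  apply: (ten_lift1 (g := fun z x a => t1 x (actJ z a))) => // [z|x a].
    by split=> y; linearity; exact: bact.2.
  by linearity; exact: bact.1.
have [BM bBM BME] : exists2 G : B -> T2 -> T2, bilin G &
    forall z v m, G z (t2 v m) = t2 v (actM z m).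
  apply: (ten_lift1 (g := fun z x a => t2 x (actM z a))) => // [z|x a].
    by split=> y; linearity; exact: bactM.2.
  by linearity; exact: bactM.1.
pose br (u v : L) : L :=
 (JJ u.1.1 v.1.1 + MM u.1.2 v.1.2 + BJ u.2 v.1.1 - flip BJ u.1.1 v.2,
  JM u.1.1 v.1.2 - flip JM u.1.2 v.1.1 + BM u.2 v.1.2 - flip BM u.1.2 v.2,
  JJB u.1.1 v.1.1 + MMB u.1.2 v.1.2 + actB u.2 v.2).
have bfJ := flip_bilin bBJ; have bfM := flip_bilin bBM; have bfJM := flip_bilin bJM.
have zero (U V W : lmodType K) (f : U -> V -> W) : bilin f ->
    (forall u, f u 0 = 0) * (forall v, f 0 v = 0).
  by move=> [hl hr]; split=> u; [rewrite (linear_rules (hr u))|rewrite (linear_rules (hl u))].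
have z0 := (zero _ _ _ _ bJJ, zero _ _ _ _ bJJB, zero _ _ _ _ bJM, zero _ _ _ _ bMM,
  zero _ _ _ _ bMMB, zero _ _ _ _ bBJ, zero _ _ _ _ bBM, zero _ _ _ _ bfJ,
  zero _ _ _ _ bfM, zero _ _ _ _ bfJM, zero _ _ _ _ bactB).
have lin1 : linear (fun u : L => u.1.1) by [].
have lin2 : linear (fun u : L => u.1.2) by [].
have lin3 : linear (fun u : L => u.2) by [].
exists br; split.
- split=> w; rewrite /br; apply: lin_pair; [apply: lin_pair| |apply: lin_pair|];
    repeat first [ biadditive bfJ lin1 lin3 | biadditive bfM lin2 lin3
    | biadditive bfJM lin2 lin1 | apply: lin_D | apply: lin_N
    | biadditive bJJ lin1 lin1 | biadditive bJJB lin1 lin1 | biadditive bJM lin1 lin2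
    | biadditive bMM lin2 lin2 | biadditive bMMB lin2 lin2 | biadditive bBJ lin3 lin1
    | biadditive bBM lin3 lin2 | biadditive bactB lin3 lin3 ].
- by move=> x y a b; rewrite /br /= JJE JJBE !z0 /=; pair_eq.
- by move=> x v a m; rewrite /br /= JME !z0 /=; pair_eq.
- by move=> v w m n; rewrite /br /= MME MMBE !z0 /=; pair_eq.
- by move=> z x a; rewrite /br /= BJE !z0 /=; pair_eq.
- by move=> z v m; rewrite /br /= BME !z0 /=; pair_eq.
- by move=> z w; rewrite /br /= !z0 /=; pair_eq.
- move=> i j x v a m ha hm.
  have hx : homog i (t1 x a) := ten_even tT1 (erefl x : homog false x) ha.
  have hv : homog j (t2 v m) := ten_even tT2 (erefl v : homog false v) hm.
  by rewrite /br /= (flipE bJM hx hv) JME !z0 /=; pair_eq.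
- move=> p i z x a hz ha.
  have hx : homog i (t1 x a) := ten_even tT1 (erefl x : homog false x) ha.
  by rewrite /br /= (flipE bBJ hz hx) BJE !z0 /=; pair_eq.
- move=> p i z v m hz hm.
  have hv : homog i (t2 v m) := ten_even tT2 (erefl v : homog false v) hm.
  by rewrite /br /= (flipE bBM hz hv) BME !z0 /=; pair_eq.
Qed.

Lemma sl2_action_exists : exists act, sl2_action genJ genM genB act.
Proof.
have bsl := sl2_br_bilin K; have bnat := sl2_nat_bilin K.
have [F1 bF1 F1E] : exists2 G : sl2 K -> T1 -> T1, bilin G &
    forall z x a, G z (t1 x a) = t1 (sl2_br z x) a.
  apply: (ten_lift1 (g := fun z x a => t1 (sl2_br z x) a)) => // [z|x a].
    by split=> y; [apply: lin_bill; exact: bsl.2 | linearity].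
  by apply: lin_bill; exact: bsl.1.
have [F2 bF2 F2E] : exists2 G : sl2 K -> T2 -> T2, bilin G &
    forall z x a, G z (t2 x a) = t2 (sl2_nat z x) a.
  apply: (ten_lift1 (g := fun z x a => t2 (sl2_nat z x) a)) => // [z|x a].
    by split=> y; [apply: lin_bill; exact: bnat.2 | linearity].
  by apply: lin_bill; exact: bnat.1.
have lin1 : linear (fun u : L => u.1.1) by [].
have lin2 : linear (fun u : L => u.1.2) by [].
exists (fun x u => (F1 x u.1.1, F2 x u.1.2, 0)); split.
- split=> w; apply: lin_pair; [apply: lin_pair| |apply: lin_pair|];
    first [ exact: lin_0 | biadditive bF1 (@lin_id K (sl2 K)) lin1
    | biadditive bF2 (@lin_id K (sl2 K)) lin2 ].
- by move=> x y a /=; rewrite F1E (linear_rules (bF2.2 x)).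
- by move=> x y a /=; rewrite F2E (linear_rules (bF1.2 x)).
- by move=> x z /=; rewrite (linear_rules (bF1.2 x)) (linear_rules (bF2.2 x)).
Qed.

(** The direct sum is given a name, so that its superspace structure is the same
for all the maps below whatever the summands are. *)
Definition sum_super : superType K := L.
Definition sumJ : {bilinear sl2 K -> J -> sum_super} := genJ.
Definition sumM : {bilinear natrep K -> M -> sum_super} := genM.
Definition sumB : {linear B -> sum_super} := genB.

Lemma sum_generated : generated_by sumJ sumM sumB.
Proof. exact: generated_sum. Qed.

(** The operators of B are recorded with the bracket: they give its values on B,
on which the naturality of the bracket depends. *)
Definition TAG_operations (br : sum_super -> sum_super -> sum_super)
    (act : sl2 K -> sum_super -> sum_super) : Prop :=
  exists actJ actM actB, [/\ center_action bJ bM actJ actM actB,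
    bracket_on bJ bM actJ actM actB sumJ sumM sumB br &
    sl2_action sumJ sumM sumB act].

Lemma TAG_operations_exist : exists br act, TAG_operations br act.
Proof.
have [actJ [actM [actB cB]]] := center_action_exists prB.
have [br brP] := bracket_exists cB; have [act actP] := sl2_action_exists.
by exists br, act, actJ, actM, actB.
Qed.
End Assemble.

(** * Tensor products and B^s *)

Section TensorProduct.
Variable K : fieldType.

Lemma tensor_ind (U V : superType K) (P : tensor U V -> Prop) : P 0 ->
  (forall c u v, P u -> P v -> P (c *: u + v)) ->
  (forall i j u v, homog i u -> homog j v -> P (tens u v)) -> forall x, P x.
Proof.
move=> P0 PD Pt x; have PA u v : P u -> P v -> P (u + v).
  by rewrite -{2}[u]scale1r; exact: PD.
have PZ c u : P u -> P (c *: u) by rewrite -[c *: u]addr0 => Pu; exact: PD.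
have {}Pt u v : P (tens u v).
  rewrite -[u]scomp_sum -[v]scomp_sum !bilDl !bilDr.
  by do 2!apply: (PA); apply: Pt; exact: homog_scomp.
rewrite -[x]qreprK -(freeg_sumE (qrepr x)) linear_sum.
apply: (big_ind P) => // -[u v] _ /=.
have -> : [freeg [:: (coeff (u, v) (qrepr x), (u, v))]]
    = coeff (u, v) (qrepr x) *: pure u v.
  by apply/eqP/freeg_eqP => z; rewrite coeffZ !coeffU mul1r.
by rewrite linearZ; apply: PZ; exact: Pt.
Qed.

Definition tensor_super (U V : superType K) : superType K := tensor U V.

Definition tens_bilinear (U V : superType K) : {bilinear U -> V -> tensor_super U V} :=
  @tens K U V.

Lemma tensor_spec (U V : superType K) : is_tensor (tens_bilinear U V).
Proof.
split.
- by move=> i j u v; exact: homog_tens.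
- exact: tensor_ind.
- move=> W f bf; exists (tlift (bilinear_of bf)); first exact: tlift_is_linear.
  by move=> u v; rewrite tlift_tens.
Qed.

End TensorProduct.

Section CenterQuotient.
Variables (K : numFieldType) (A : ternary K).
Local Notation J := (tJ A).
Local Notation M := (tM A).
Local Notation T := (tensor J J * tensor M M)%type.

Section Through.
Variables (W : lmodType K) (q : T -> W).
Hypothesis lq : linear q.
Let qE := linear_rules lq.

Lemma brel_tag_rel : (forall x, brel (A := A) x -> q x = 0) ->
  tag_rel (fun a b => q (tens a b, 0)) (fun m n => q (0, tens m n)).
Proof.
move=> q0; split.
- by move=> i j a b ha hb; rewrite -(q0 _ (brel_aa ha hb)) !qE.
- by move=> i j m n hm hn; rewrite -(q0 _ (brel_mm hm hn)) !qE.
- by move=> i j k a b c ha hb hc; rewrite -(q0 _ (brel_aaa ha hb hc)) !qE.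
- by move=> l i j a m n ha hm hn; rewrite -(q0 _ (brel_amm ha hm hn)) !qE.
- by move=> i j k l m n r s hm hn hr hs; rewrite -(q0 _ (brel_mmmm hm hn hr hs)) !qE.
Qed.

Lemma tag_rel_brel : tag_rel (fun a b => q (tens a b, 0)) (fun m n => q (0, tens m n)) ->
  forall x, brel (A := A) x -> q x = 0.
Proof.
move=> R x [i j a b ha hb|i j m n hm hn|i j k a b c ha hb hc|l i j a m n ha hm hn|
  i j k l m n r s hm hn hr hs]; rewrite !qE.
- exact: (rel_J R ha hb).
- exact: (rel_M R hm hn).
- exact: (rel_JJJ R ha hb hc).
- exact: (rel_JMM R ha hm hn).
- exact: (rel_MMMM R hm hn hr hs).
Qed.
End Through.

Lemma inl_linear (U V : lmodType K) : linear (fun u : U => (u, 0) : U * V).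
Proof. by move=> c u v; congr pair; rewrite /= scaler0 addr0. Qed.

Lemma inr_linear (U V : lmodType K) : linear (fun v : V => (0, v) : U * V).
Proof. by move=> c u v; congr pair; rewrite /= scaler0 addr0. Qed.

Lemma brJ_bilin : bilin (@brJ K A).
Proof.
split=> w.
  apply: (lin_comp (g := fun t => qpi (@brel K A) (t, 0))).
    exact: (bilinear_bilin (@tens K J J)).1.
  exact: (lin_comp (@inl_linear _ _) (@qpi_is_linear _ _ _)).
apply: (lin_comp (g := fun t => qpi (@brel K A) (t, 0))).
  exact: (bilinear_bilin (@tens K J J)).2.
exact: (lin_comp (@inl_linear _ _) (@qpi_is_linear _ _ _)).
Qed.

Lemma brM_bilin : bilin (@brM K A).
Proof.
split=> w.
  apply: (lin_comp (g := fun t => qpi (@brel K A) (0, t))).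
    exact: (bilinear_bilin (@tens K M M)).1.
  exact: (lin_comp (@inr_linear _ _) (@qpi_is_linear _ _ _)).
apply: (lin_comp (g := fun t => qpi (@brel K A) (0, t))).
  exact: (bilinear_bilin (@tens K M M)).2.
exact: (lin_comp (@inr_linear _ _) (@qpi_is_linear _ _ _)).
Qed.

Definition Bs_super : superType K := Bs A.
Definition Bs_J : {bilinear J -> J -> Bs_super} := bilinear_of brJ_bilin.
Definition Bs_M : {bilinear M -> M -> Bs_super} := bilinear_of brM_bilin.

Lemma Bs_presents : presents Bs_J Bs_M.
Proof.
split.
- have q0 x : brel (A := A) x -> qpi (@brel K A) x = 0.
    move=> hx; rewrite -(linear0 (qpi (@brel K A))); apply/qpi_eq.
    by rewrite subr0; exact: spanned_gen.
  exact: (brel_tag_rel (@qpi_is_linear _ _ _) q0).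
- move=> i j a b ha hb.
  have h : homog (i (+) j) ((tens a b, 0) : T) by apply/homog_inl/homog_tens.
  have e := quotient_scomp_pi (@brel_homog K A) (i (+) j) (tens a b, 0).
  by rewrite h in e; exact: e.
- move=> i j a b ha hb.
  have h : homog (i (+) j) ((0, tens a b) : T) by apply/homog_inr/homog_tens.
  have e := quotient_scomp_pi (@brel_homog K A) (i (+) j) (0, tens a b).
  by rewrite h in e; exact: e.
- move=> P P0 PD PJ PM z; rewrite -[z]qreprK; case: (qrepr z) => s t.
  have lq := @qpi_is_linear _ _ (@brel K A).
  have lJ := lin_comp (@inl_linear (tensor J J) (tensor M M)) lq.
  have lM := lin_comp (@inr_linear (tensor J J) (tensor M M)) lq.
  have -> : (s, t) = 1 *: ((s, 0) : T) + (0, t).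
    by rewrite scale1r; congr pair; rewrite /= ?addr0 ?add0r.
  rewrite (@qpi_is_linear _ _ (@brel K A)); apply: (PD).
    move: s; apply: tensor_ind => [|c u v Pu Pv|i j a b ha hb].
    + by rewrite (linear_rules lJ).
    + by rewrite lJ; exact: (PD).
    + exact: (PJ i j).
  move: t; apply: tensor_ind => [|c u v Pu Pv|i j a b ha hb].
  + by rewrite (linear_rules lM).
  + by rewrite lM; exact: PD.
  + exact: (PM i j).
- move=> W fJ fM bfJ bfM R.
  pose f (t : T) := tlift (bilinear_of bfJ) t.1 + tlift (bilinear_of bfM) t.2.
  have lf : linear f.
    by move=> c u v; rewrite /f !linearP scalerDr addrACA.
  have fJE a b : f (tens a b, 0) = fJ a b by rewrite /f /= linear0 addr0 tlift_tens.
  have fME m n : f (0, tens m n) = fM m n by rewrite /f /= linear0 add0r tlift_tens.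
  have f0 x : brel (A := A) x -> linear_of lf x = 0.
    apply: (tag_rel_brel lf).
    have -> : (fun a b => f (tens a b, 0)) = fJ by apply/funext => a; apply/funext => b.
    by have -> : (fun m n => f (0, tens m n)) = fM by apply/funext => a; apply/funext => b.
  exists (qlift (linear_of lf)); split; first exact: qlift_is_linear.
    by move=> a b; rewrite [LHS](qlift_pi f0) -fJE.
  by move=> a b; rewrite [LHS](qlift_pi f0) -fME.
Qed.
End CenterQuotient.

(** * Functoriality *)

Section Functoriality.
Variables (K : numFieldType) (A A' : ternary K) (eta : ternary_hom A A').
Local Notation h1 := (hom1 eta).
Local Notation h2 := (hom2 eta).
Let e1 : (forall u v, h1 (u + v) = h1 u + h1 v) * (forall u, h1 (- u) = - h1 u) *
  (forall c u, h1 (c *: u) = c *: h1 u) * (h1 0 = 0) := linear_rules (lin_map h1).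
Let e2 : (forall u v, h2 (u + v) = h2 u + h2 v) * (forall u, h2 (- u) = - h2 u) *
  (forall c u, h2 (c *: u) = c *: h2 u) * (h2 0 = 0) := linear_rules (lin_map h2).

Lemma hom_innerJ i j a b c : h1 (inner_J i j a b c) = inner_J i j (h1 a) (h1 b) (h1 c).
Proof. by rewrite /inner_J !e1 !hom_jmul. Qed.

Lemma hom_innerM i j a b m : h2 (inner_M i j a b m) = inner_M i j (h1 a) (h1 b) (h2 m).
Proof. by rewrite /inner_M !e2 !hom_sact. Qed.

Lemma hom_partialJ i j k m n a :
  h1 (partial_J i j k m n a) = partial_J i j k (h2 m) (h2 n) (h1 a).
Proof. by rewrite /partial_J !e1 !hom_star !hom_sact. Qed.

Lemma hom_partialM m n r : h2 (partial_M m n r) = partial_M (h2 m) (h2 n) (h2 r).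
Proof. by rewrite /partial_M !e2 !hom_sact hom_star hom_tri. Qed.

Variables (B B' : superType K)
  (bJ : {bilinear tJ A -> tJ A -> B}) (bM : {bilinear tM A -> tM A -> B})
  (bJ' : {bilinear tJ A' -> tJ A' -> B'}) (bM' : {bilinear tM A' -> tM A' -> B'}).
Hypotheses (prB : presents bJ bM) (prB' : presents bJ' bM').

(** A morphism carries each relation to the relation between the images. *)
Lemma center_map_exists : exists phi : B -> B', [/\ linear phi,
  forall a b, phi (bJ a b) = bJ' (h1 a) (h1 b) &
  forall m n, phi (bM m n) = bM' (h2 m) (h2 n)].
Proof.
have R := pres_rel prB'.
apply: (pres_lift prB).
- by split=> w; [apply: lin_bill|apply: lin_bilr]; exact: linearP.
- by split=> w; [apply: lin_bill|apply: lin_bilr]; exact: linearP.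
split.
- move=> i j a b ha hb; exact: (rel_J R (hom1_even eta ha) (hom1_even eta hb)).
- move=> i j m n hm hn; exact: (rel_M R (hom2_even eta hm) (hom2_even eta hn)).
- move=> i j k a b c ha hb hc; rewrite !hom_jmul.
  exact: (rel_JJJ R (hom1_even eta ha) (hom1_even eta hb) (hom1_even eta hc)).
- move=> l i j a m n ha hm hn; rewrite !hom_sact hom_star.
  exact: (rel_JMM R (hom1_even eta ha) (hom2_even eta hm) (hom2_even eta hn)).
- move=> i j k l m n r s hm hn hr hs; rewrite !hom_partialM.
  exact: (rel_MMMM R (hom2_even eta hm) (hom2_even eta hn) (hom2_even eta hr)
    (hom2_even eta hs)).
Qed.

Variables (actJ : B -> tJ A -> tJ A) (actM : B -> tM A -> tM A) (actB : B -> B -> B).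
Variables (actJ' : B' -> tJ A' -> tJ A') (actM' : B' -> tM A' -> tM A')
  (actB' : B' -> B' -> B').
Hypotheses (cB : center_action bJ bM actJ actM actB)
  (cB' : center_action bJ' bM' actJ' actM' actB').
Variable phi : B -> B'.
Hypotheses (lphi : linear phi)
  (phiJ : forall a b, phi (bJ a b) = bJ' (h1 a) (h1 b))
  (phiM : forall m n, phi (bM m n) = bM' (h2 m) (h2 n)).
Let ep := linear_rules lphi.
Let aJl a := linear_rules ((act_bilinJ cB).1 a).
Let aMl a := linear_rules ((act_bilinM cB).1 a).
Let aBr a := linear_rules ((act_bilinB cB).2 a).
Let aJl' a := linear_rules ((act_bilinJ cB').1 a).
Let aMl' a := linear_rules ((act_bilinM cB').1 a).
Let aBr' a := linear_rules ((act_bilinB cB').2 a).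

Lemma center_map_even : even_map phi.
Proof.
move=> p; apply: (pres_homog_ind prB) => [|c u v hu hv|i j a b ha hb <-|i j m n hm hn <-].
- by rewrite ep; exact: homog0.
- by rewrite !ep; apply: homogD => //; exact: homogZ.
- by rewrite phiJ; exact: (pres_evenJ prB' (hom1_even eta ha) (hom1_even eta hb)).
- by rewrite phiM; exact: (pres_evenM prB' (hom2_even eta hm) (hom2_even eta hn)).
Qed.

Lemma center_map_actJ z a : h1 (actJ z a) = actJ' (phi z) (h1 a).
Proof.
move: z a; apply: (pres_ind prB) => [|c u v hu hv|i j a b ha hb|i j m n hm hn] d.
- by rewrite ep aJl aJl' e1.
- by rewrite !ep !aJl !e1 hu hv !aJl'.
- rewrite phiJ (act_JJ cB _ ha hb) hom_innerJ.
  by rewrite (act_JJ cB' _ (hom1_even eta ha) (hom1_even eta hb)).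
- rewrite phiM; move: d; apply: homog_extl.
  + by apply: (lin_comp (g := h1)); [exact: (act_bilinJ cB).2|exact: linearP].
  + by apply: (lin_comp (f := h1)); [exact: linearP|exact: (act_bilinJ cB').2].
  move=> k d hd; rewrite (act_MJ cB hm hn hd) hom_partialJ.
  by rewrite (act_MJ cB' (hom2_even eta hm) (hom2_even eta hn) (hom1_even eta hd)).
Qed.

Lemma center_map_actM z m : h2 (actM z m) = actM' (phi z) (h2 m).
Proof.
move: z m; apply: (pres_ind prB) => [|c u v hu hv|i j a b ha hb|i j m n hm hn] d.
- by rewrite ep aMl aMl' e2.
- by rewrite !ep !aMl !e2 hu hv !aMl'.
- rewrite phiJ (act_JM cB _ ha hb) hom_innerM.
  by rewrite (act_JM cB' _ (hom1_even eta ha) (hom1_even eta hb)).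
- by rewrite phiM (act_MM cB) hom_partialM (act_MM cB').
Qed.

Lemma center_map_actB z w : phi (actB z w) = actB' (phi z) (phi w).
Proof.
move: z; apply: homog_extl.
- exact: (lin_comp ((act_bilinB cB).1 w) lphi).
- exact: (lin_comp lphi ((act_bilinB cB').1 (phi w))).
move=> p z hz; have hz' := center_map_even hz; move: w.
apply: (pres_ind prB) => [|c u v hu hv|i j a b ha hb|i j m n hm hn].
- by rewrite ep aBr aBr' ep.
- by rewrite !ep !aBr !ep hu hv !aBr'.
- rewrite phiJ (act_BJ cB _ hz ha) (act_BJ cB' _ hz' (hom1_even eta ha)).
  by rewrite !ep !phiJ !center_map_actJ.
- rewrite phiM (act_BM cB _ hz hm) (act_BM cB' _ hz' (hom2_even eta hm)).
  by rewrite !ep !phiM !center_map_actM.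
Qed.

Variables (L L' : superType K) (gJ : {bilinear sl2 K -> tJ A -> L})
  (gM : {bilinear natrep K -> tM A -> L}) (gB : {linear B -> L})
  (gJ' : {bilinear sl2 K -> tJ A' -> L'})
  (gM' : {bilinear natrep K -> tM A' -> L'}) (gB' : {linear B' -> L'}).
Hypotheses (grL : generated_by gJ gM gB) (grL' : generated_by gJ' gM' gB').
Variable F : L -> L'.
Hypotheses (lF : linear F) (FJ : forall x a, F (gJ x a) = gJ' x (h1 a))
  (FM : forall v m, F (gM v m) = gM' v (h2 m)) (FB : forall z, F (gB z) = gB' (phi z)).
Let eF := linear_rules lF.

Lemma map_even : even_map F.
Proof.
move=> i; apply: (gen_homog_ind grL) => [|c u v hu hv|x a ha|v m hm|z hz].
- by rewrite eF; exact: homog0.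
- by rewrite !eF; apply: homogD => //; exact: homogZ.
- by rewrite FJ; apply: (gen_homogJ grL'); exact: (hom1_even eta).
- by rewrite FM; apply: (gen_homogM grL'); exact: (hom2_even eta).
- by rewrite FB; apply: (gen_homogB grL'); exact: center_map_even.
Qed.

Variables (br : L -> L -> L) (br' : L' -> L' -> L').
Hypotheses (brP : bracket_on bJ bM actJ actM actB gJ gM gB br)
  (brP' : bracket_on bJ' bM' actJ' actM' actB' gJ' gM' gB' br').
Let brl x := linear_rules ((br_bilin brP).1 x).
Let brr x := linear_rules ((br_bilin brP).2 x).
Let brl' x := linear_rules ((br_bilin brP').1 x).
Let brr' x := linear_rules ((br_bilin brP').2 x).

Lemma map_br u w : F (br u w) = br' (F u) (F w).
Proof.
have k1 := @hom1_even _ _ _ eta; have k2 := @hom2_even _ _ _ eta.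
have k3 := center_map_even.
move: w; move: u; apply: (gen_ind grL) => [|c u v hu hv|i y a ha|i v m hm|i z hz] w.
- by rewrite brl eF brl'.
- by rewrite !brl !eF hu hv !brl'.
all: move: w; apply: (gen_ind grL) => [|d u u' hu hu'|j y' b hb|j v' n hn|j z' hz'].
all: try by rewrite brr eF brr'.
all: try by rewrite !brr !eF hu hu' !brr'.
all: rewrite ?(FJ, FM, FB).
- by rewrite (br_JJ brP) (br_JJ brP') !eF FJ FB phiJ hom_jmul.
- by rewrite (br_JM brP) (br_JM brP') FM hom_sact.
- rewrite (br_JB brP _ hz' ha) (br_JB brP' _ (k3 _ _ hz') (k1 _ _ ha)) !eF FJ.
  by rewrite center_map_actJ.
- rewrite (br_MJ brP _ _ hb hm) (br_MJ brP' _ _ (k1 _ _ hb) (k2 _ _ hm)) !eF FM.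
  by rewrite hom_sact.
- by rewrite (br_MM brP) (br_MM brP') !eF FJ FB phiM hom_star.
- rewrite (br_MB brP _ hz' hm) (br_MB brP' _ (k3 _ _ hz') (k2 _ _ hm)) !eF FM.
  by rewrite center_map_actM.
- by rewrite (br_BJ brP) (br_BJ brP') FJ center_map_actJ.
- by rewrite (br_BM brP) (br_BM brP') FM center_map_actM.
- by rewrite (br_BB brP) (br_BB brP') FB center_map_actB.
Qed.

Variables (act : sl2 K -> L -> L) (act' : sl2 K -> L' -> L').
Hypotheses (actP : sl2_action gJ gM gB act) (actP' : sl2_action gJ' gM' gB' act').

Lemma map_act x u : F (act x u) = act' x (F u).
Proof.
have ar := linear_rules ((sl2_act_bilin actP).2 x).
have ar' := linear_rules ((sl2_act_bilin actP').2 x).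
move: u; apply: (gen_ind grL) => [|c u v hu hv|i y a _|i v m _|i z _].
- by rewrite ar eF ar'.
- by rewrite !ar !eF hu hv !ar'.
- by rewrite (sl2_actJ actP) !FJ (sl2_actJ actP').
- by rewrite (sl2_actM actP) !FM (sl2_actM actP').
- by rewrite (sl2_actB actP) !FB (sl2_actB actP') eF.
Qed.

End Functoriality.

(** * The functor TAG *)

Section SumMap.
Variables (K : numFieldType) (A A' : ternary K) (eta : ternary_hom A A').
Variables (T1 T2 B T1' T2' B' : superType K)
  (t1 : {bilinear sl2 K -> tJ A -> T1}) (t2 : {bilinear natrep K -> tM A -> T2})
  (t1' : {bilinear sl2 K -> tJ A' -> T1'}) (t2' : {bilinear natrep K -> tM A' -> T2'}).
Hypotheses (tT1 : is_tensor t1) (tT2 : is_tensor t2).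
Variable phi : B -> B'.
Hypothesis lphi : linear phi.

Lemma sum_map_exists : exists F : sum_super T1 T2 B -> sum_super T1' T2' B',
  [/\ linear F, forall x a, F (sumJ T2 B t1 x a) = sumJ T2' B' t1' x (hom1 eta a),
      forall v m, F (sumM T1 B t2 v m) = sumM T1' B' t2' v (hom2 eta m) &
      forall z, F (sumB T1 T2 B z) = sumB T1' T2' B' (phi z)].
Proof.
have [F1 lF1 F1E] : exists2 F : T1 -> T1', linear F &
    forall x a, F (t1 x a) = t1' x (hom1 eta a).
  apply: (ten_lift tT1 (f := fun x a => t1' x (hom1 eta a))); split=> w.
    by linearity.
  by apply: lin_bilr; exact: linearP.
have [F2 lF2 F2E] : exists2 F : T2 -> T2', linear F &
    forall x a, F (t2 x a) = t2' x (hom2 eta a).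
  apply: (ten_lift tT2 (f := fun x a => t2' x (hom2 eta a))); split=> w.
    by linearity.
  by apply: lin_bilr; exact: linearP.
exists (fun u => (F1 u.1.1, F2 u.1.2, phi u.2)); split.
- by move=> c u v; rewrite /= lF1 lF2 lphi.
- move=> x a; rewrite -[sumJ _ _ _ _ _]/(injJ _ _ _ _ _) -[RHS]/(injJ _ _ _ _ _).
  by rewrite /injJ /= F1E (linear_rules lF2) (linear_rules lphi).
- move=> v m; rewrite -[sumM _ _ _ _ _]/(injM _ _ _ _ _) -[RHS]/(injM _ _ _ _ _).
  by rewrite /injM /= F2E (linear_rules lF1) (linear_rules lphi).
- move=> z; rewrite -[sumB _ _ _ _]/(injB _ _ _) -[RHS]/(injB _ _ _).
  by rewrite /injB /= (linear_rules lF1) (linear_rules lF2).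
Qed.
End SumMap.

Section LieOf.
Variables (K : numFieldType) (A : ternary K).
Variables (B : superType K) (bJ : {bilinear tJ A -> tJ A -> B})
  (bM : {bilinear tM A -> tM A -> B}).
Hypothesis prB : presents bJ bM.
Variables (actJ : B -> tJ A -> tJ A) (actM : B -> tM A -> tM A) (actB : B -> B -> B).
Hypothesis cB : center_action bJ bM actJ actM actB.
Variables (L : superType K) (gJ : {bilinear sl2 K -> tJ A -> L})
  (gM : {bilinear natrep K -> tM A -> L}) (gB : {linear B -> L}).
Hypothesis grL : generated_by gJ gM gB.
Variable br : L -> L -> L.
Hypothesis brP : bracket_on bJ bM actJ actM actB gJ gM gB br.
Variable act : sl2 K -> L -> L.
Hypothesis actP : sl2_action gJ gM gB act.

Definition lieSuper_of : lieSuper_on L :=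
  LieSuperOn (lbr := bilinear_of (br_bilin brP)) (br_even prB cB grL brP)
    (@br_skew _ _ _ _ _ prB _ _ _ cB _ _ _ _ grL _ brP)
    (@br_jacobi _ _ _ _ _ prB _ _ _ cB _ _ _ _ grL _ brP).

Definition shortLie_of (sf : short_form act) : shortLie_on L :=
  ShortLieOn (short_lie := lieSuper_of) (short_act := bilinear_of (sl2_act_bilin actP))
    (sl2_act_br grL actP) (sl2_act_even grL actP) (sl2_act_der grL brP actP) sf.
End LieOf.

Lemma sign_addb (R : pzRingType) (i j k : bool) :
  (-1) ^+ ((i (+) j) * k) = (-1) ^+ ((i + j) * k) :> R.
Proof. by rewrite -signr_odd -[RHS]signr_odd !oddM oddD; case: i; case: j. Qed.

Section TAGStructure.
Variables (K : numFieldType) (A : ternary K).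
Local Notation J := (tJ A).
Local Notation M := (tM A).
Local Notation bJ := (Bs_J A).
Local Notation bM := (Bs_M A).

Local Notation T1 := (tensor_super (sl2 K) J).
Local Notation T2 := (tensor_super (natrep K) M).
Local Notation B := (Bs_super A).

Definition TAG_generated :=
  sum_generated B (tensor_spec (sl2 K) J) (tensor_spec (natrep K) M).

Definition TAG_like (S : shortLie_on (TAG A)) : Prop :=
  TAG_operations (tens_bilinear (sl2 K) J) (tens_bilinear (natrep K) M) bJ bM
    (lbr S) (short_act S).
Local Notation gJ := (sumJ T2 B (tens_bilinear (sl2 K) J)).
Local Notation gM := (sumM T1 B (tens_bilinear (natrep K) M)).
Local Notation gB := (sumB T1 T2 B).

Lemma TAG_short_form act : sl2_action gJ gM gB act -> short_form (L := TAG A) act.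
Proof.
move=> actP; exists J, M, B, idfun; split=> //.
- by exists idfun.
- exact (sl2_actJ actP).
- exact (sl2_actM actP).
- exact (sl2_actB actP).
Qed.

Lemma TAG_like_exists : exists S, TAG_like S.
Proof.
have [br [act [actJ [actM [actB [cB brP actP]]]]]] := TAG_operations_exist
  (tensor_spec (sl2 K) J) (tensor_spec (natrep K) M) (@Bs_presents K A).
exists (shortLie_of (@Bs_presents K A) cB TAG_generated brP actP (TAG_short_form actP)).
exists actJ, actM, actB; split; [exact cB | exact brP | exact actP].
Qed.

Lemma TAG_like_is_TAG S : TAG_like S -> is_TAG S.
Proof.
case=> actJ [actM [actB [cB brP actP]]].
have prB := @Bs_presents K A.
have sgn := @sign_addb K.
split.
- exact (sl2_actJ actP).
- exact (sl2_actM actP).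
- exact (sl2_actB actP).
- exact (br_JJ brP).
- exact (br_JM brP).
- exact (br_MM brP).
- move=> i j a b ha hb x c; apply: etrans (br_BJ brP _ _ _) _.
  by rewrite (act_JJ cB _ ha hb).
- move=> i j a b ha hb x c; apply: etrans (br_BM brP _ _ _) _.
  by rewrite (act_JM cB _ ha hb).
- move=> i j k a b c d ha hb hc; apply: etrans (br_BB brP _ _) _.
  have := act_BJ cB d (pres_evenJ prB ha hb) hc.
  rewrite !(act_JJ cB _ ha hb) sgn => e; exact: (congr1 gB e).
- move=> i j k a b r s ha hb hr; apply: etrans (br_BB brP _ _) _.
  have := act_BM cB s (pres_evenJ prB ha hb) hr.
  rewrite !(act_JM cB _ ha hb) sgn => e; exact: (congr1 gB e).
- move=> i j k m n c hm hn hc x; apply: etrans (br_BJ brP _ _ _) _.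
  by rewrite (act_MJ cB hm hn hc).
- move=> m n v r; apply: etrans (br_BM brP _ _ _) _.
  by rewrite (act_MM cB).
- move=> i j k l m n c d hm hn hc hd; apply: etrans (br_BB brP _ _) _.
  have := act_BJ cB d (pres_evenM prB hm hn) hc.
  rewrite (act_MJ cB hm hn hc) (act_MJ cB hm hn hd) sgn => e; exact: (congr1 gB e).
- move=> i j k m n r s hm hn hr; apply: etrans (br_BB brP _ _) _.
  have := act_BM cB s (pres_evenM prB hm hn) hr.
  rewrite !(act_MM cB) sgn => e; exact: (congr1 gB e).
Qed.

Lemma TAG_ext (W : lmodType K) (F G : TAG A -> W) : linear F -> linear G ->
  (forall x a, F (tagJ x a) = G (tagJ x a)) ->
  (forall v m, F (tagM v m) = G (tagM v m)) ->
  (forall a b, F (tagB (brJ a b)) = G (tagB (brJ a b))) ->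
  (forall m n, F (tagB (brM m n)) = G (tagB (brM m n))) -> F =1 G.
Proof.
move=> lF lG FJ FM FBJ FBM.
apply: (gen_ind TAG_generated) => [|c u v hu hv|i y a _|i v m _|i z _].
- by rewrite (linear_rules lF) (linear_rules lG).
- by rewrite lF lG hu hv.
- exact: FJ.
- exact: FM.
have lFB := lin_comp (lin_map gB) lF; have lGB := lin_comp (lin_map gB) lG.
move: z; apply: (pres_ind (@Bs_presents K A)) => [|c u v hu hv|k l a b _ _|k l m n _ _].
- by rewrite (linear_rules lFB) (linear_rules lGB).
- by rewrite lFB lGB hu hv.
- exact: FBJ.
- exact: FBM.
Qed.
End TAGStructure.

Lemma TAG_hom_exists (K : numFieldType) (A A' : ternary K) (eta : ternary_hom A A')
    (S : shortLie_on (TAG A)) (S' : shortLie_on (TAG A')) :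
  TAG_like S -> TAG_like S' ->
  exists F : shortLie_hom (ShortLie S) (ShortLie S'), is_TAG_map eta F.
Proof.
case=> actJ [actM [actB [cB brP actP]]] [actJ' [actM' [actB' [cB' brP' actP']]]].
have prB := @Bs_presents K A; have prB' := @Bs_presents K A'.
have [phi [lphi phiJ phiM]] := center_map_exists eta prB prB'.
have [F [lF FJ FM FB]] := sum_map_exists eta
  (tens_bilinear (sl2 K) (tJ A')) (tens_bilinear (natrep K) (tM A'))
  (tensor_spec (sl2 K) (tJ A)) (tensor_spec (natrep K) (tM A)) lphi.
have grL := @TAG_generated K A; have grL' := @TAG_generated K A'.
have Fe := map_even prB prB' lphi phiJ phiM grL grL' lF FJ FM FB.
have Fbr := map_br prB prB' cB cB' lphi phiJ phiM grL lF FJ FM FB brP brP'.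
have Fact := map_act grL lF FJ FM FB actP actP'.
exists (@ShortLieHom K (ShortLie S) (ShortLie S') (linear_of lF) Fe Fbr Fact).
split.
- exact: FJ.
- exact: FM.
- by move=> a b; apply: etrans (FB _) _; rewrite phiJ.
- by move=> a b; apply: etrans (FB _) _; rewrite phiM.
Qed.

Theorem corollary4p12 (R : realType) :
  exists (S : forall A : ternary (R[i])%C, shortLie_on (TAG A))
         (F : forall A B : ternary (R[i])%C, ternary_hom A B ->
                shortLie_hom (ShortLie (S A)) (ShortLie (S B))),
    [/\ forall A, is_TAG (S A),
        forall A B (eta : ternary_hom A B), is_TAG_map eta (F A B eta) &
        @is_functor (ternaryCat (R[i])%C) (shortLieCat (R[i])%C)
          (fun A => ShortLie (S A)) F].
Proof.
pose S (A : ternary (R[i])%C) := sval (cid (TAG_like_exists A)).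
have SP A : TAG_like (S A) := svalP (cid (TAG_like_exists A)).
pose F A B (eta : ternary_hom A B) := sval (cid (TAG_hom_exists eta (SP A) (SP B))).
have FP A B (eta : ternary_hom A B) : is_TAG_map eta (F A B eta) :=
  svalP (cid (TAG_hom_exists eta (SP A) (SP B))).
exists S, F; split=> // [A|]; first exact: TAG_like_is_TAG.
split=> [A|A B C g f]; apply: shortLie_hom_ext; apply: TAG_ext; try exact: linearP.
- by move=> x a; rewrite (tag_mapJ (FP _ _ _)).
- by move=> x a; rewrite (tag_mapM (FP _ _ _)).
- by move=> a b; rewrite (tag_map_brJ (FP _ _ _)).
- by move=> a b; rewrite (tag_map_brM (FP _ _ _)).
- by move=> x a; rewrite /= !(tag_mapJ (FP _ _ _)).
- by move=> x a; rewrite /= !(tag_mapM (FP _ _ _)).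
- by move=> a b; rewrite /= !(tag_map_brJ (FP _ _ _)).
- by move=> a b; rewrite /= !(tag_map_brM (FP _ _ _)).
Qed.
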